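(* Let $k$ be a commutative ring and $R$ be an associative, unital $k$-algebra. Assume that the ring $R\otimes_kR^{\mathrm{op}}$ is countably Noetherian. Then: (a) The category $R_k\text{-}\mathsf{Corings}_{\mathsf{sur}}$ of $R$-corings over $k$ with surjective counits is $\aleph_1$-accessible. The $\aleph_1$-presentable objects of $R_k\text{-}\mathsf{Corings}_{\mathsf{sur}}$ are precisely all the $R$-corings $C$ over $k$ with surjective counits whose underlying $R$-$R$-bimodules $C$ are countably presentable as objects of the category of $R$-$R$-bimodules over $k$, $(R\otimes_kR^{\mathrm{op}})\text{-}\mathsf{Mod}$, or equivalently, countably generated as modules over $R\otimes_kR^{\mathrm{op}}$. (b) The category $R_k\text{-}\mathsf{Corings}_{\overline{\mathsf{bifl}}}$ of $R$-corings over $k$ with flat kernels is $\aleph_1$-accessible. The $\aleph_1$-presentable objects of $R_k\text{-}\mathsf{Corings}_{\overline{\mathsf{bifl}}}$ are precisely all the $R$-corings $C$ over $k$ with flat kernels whose underlying $R$-$R$-bimodules $C$ are countably presentable as objects of the category of $R$-$R$-bimodules over $k$, or equivalently, countably generated as modules over $R\otimes_kR^{\mathrm{op}}$.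
   Context: For a regular cardinal $\kappa$, a poset is $\kappa$-directed if each of its subsets of cardinality smaller than $\kappa$ has an upper bound. In a category $\mathsf K$ with $\kappa$-directed colimits, an object $S$ is $\kappa$-presentable if $\mathrm{Hom}_{\mathsf K}(S,-)$ preserves $\kappa$-directed colimits. The category $\mathsf K$ is $\kappa$-accessible if it has $\kappa$-directed colimits and a set of $\kappa$-presentable objects such that every object is a $\kappa$-directed colimit of objects from this set. ''Countably presentable'' means $\aleph_1$-presentable; the $\aleph_1$-presentable modules over a ring are exactly the cokernels of morphisms between free modules with at most countably many generators. A module is countably generated if it has a set of generators that is at most countable. A ring $S$ is left countably Noetherian if every left ideal of $S$ is (at most) countably generated, equivalently, every submodule of a countably generated left $S$-module is countably generated. Since $S=R\otimes_kR^{\mathrm{op}}$ is isomorphic to its opposite ring, the left and right conditions are equivalent for it, and one says simply ''countably Noetherian''. An $R$-$R$-bimodule over $k$ is an $R$-$R$-bimodule in which the left and right actions of $k$ agree, i.e., a left $R\otimes_kR^{\mathrm{op}}$-module. A (coassociative, counital) $R$-coring over $k$ is an $R$-$R$-bimodule $C$ over $k$ with $R$-$R$-bimodule maps $\mu\colon C\to C\otimes_RC$ and $\epsilon\colon C\to R$ (the counit) such that $(\mu\otimes\mathrm{id}_C)\circ\mu=(\mathrm{id}_C\otimes\mu)\circ\mu$ and $(\epsilon\otimes\mathrm{id}_C)\circ\mu=\mathrm{id}_C=(\mathrm{id}_C\otimes\epsilon)\circ\mu$. Morphisms of $R$-corings are $R$-$R$-bimodule maps compatible with comultiplication and counit. An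 $R$-coring $C$ over $k$ has surjective counit if $\epsilon\colon C\to R$ is surjective. It has flat kernel if $\epsilon$ is surjective and the kernel $\overline C=\ker(\epsilon)$ is a flat module over $R\otimes_kR^{\mathrm{op}}$. $R_k\text{-}\mathsf{Corings}_{\mathsf{sur}}$ and $R_k\text{-}\mathsf{Corings}_{\overline{\mathsf{bifl}}}$ are the corresponding full subcategories of the category of $R$-corings over $k$. *)

(* Defs.v *)
From HB Require Import structures.
From mathcomp Require Import all_boot all_order all_algebra.
From mathcomp Require Import boolp classical_sets cardinality.

Set Implicit Arguments.
Unset Strict Implicit.
Unset Printing Implicit Defensive.

Import GRing.Theory.
Local Open Scope quotient_scope.
Local Open Scope ring_scope.

#[local] Obligation Tactic := idtac.

(* Size is measured by the universe in which the carriers of modules live;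
   every ring has its carrier there too. An unconstrained universe in its place
   would let the "set of objects" in the definition of accessibility be a
   proper class. *)
Notation small := Type@{GRing.Lmodule.axioms_.u0}.

Record category := Category {
  obj :> Type;
  hom : obj -> obj -> small;
  idm : forall X, hom X X;
  comp : forall X Y Z, hom Y Z -> hom X Y -> hom X Z;
  comp_idl : forall X Y (f : hom X Y), comp (idm Y) f = f;
  comp_idr : forall X Y (f : hom X Y), comp f (idm X) = f;
  compA : forall X Y Z W (f : hom Z W) (g : hom Y Z) (h : hom X Y),
    comp f (comp g h) = comp (comp f g) h }.
Arguments idm {c} X.
Arguments comp {c X Y Z} f g.

Record functor (C D : category) := Functor {
  fobj :> C -> D;
  fmap : forall X Y, hom X Y -> hom (fobj X) (fobj Y);
  fmap_id : forall X, fmap (idm X) = idm (fobj X);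
  fmap_comp : forall X Y Z (f : hom Y Z) (g : hom X Y),
    fmap (comp f g) = comp (fmap f) (fmap g) }.
Arguments fmap {C D} F {X Y} f : rename.

Program Definition functor_comp (B C D : category)
    (G : functor C D) (F : functor B C) : functor B D :=
  @Functor B D (fun X => G (F X)) (fun X Y f => fmap G (fmap F f)) _ _.
Next Obligation. by move=> B C D G F X /=; rewrite !fmap_id. Qed.
Next Obligation. by move=> B C D G F X Y Z f g /=; rewrite !fmap_comp. Qed.

Program Definition full_subcategory (C : category) (P : C -> Prop) : category :=
  @Category {X : C | P X} (fun X Y => hom (sval X) (sval Y))
    (fun X => idm (sval X)) (fun X Y Z f g => comp f g) _ _ _.
Next Obligation. by move=> C P X Y f /=; rewrite comp_idl. Qed.
Next Obligation. by move=> C P X Y f /=; rewrite comp_idr. Qed.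
Next Obligation. by move=> C P X Y Z W f g h /=; rewrite compA. Qed.

Program Definition sets : category :=
  @Category small (fun X Y => X -> Y) (fun X => id) (fun X Y Z f g => f \o g)
    _ _ _.
Next Obligation. by []. Qed.
Next Obligation. by []. Qed.
Next Obligation. by []. Qed.

Program Definition hom_functor (C : category) (S : C) : functor C sets :=
  @Functor C sets (fun X => hom S X) (fun X Y f g => comp f g) _ _.
Next Obligation. by move=> C S X; apply/funext => f /=; rewrite comp_idl. Qed.
Next Obligation.
by move=> C S X Y Z f g; apply/funext => h /=; rewrite compA.
Qed.

Section Colimits.
Variables (J C : category).

Record cocone (D : functor J C) := Cocone {
  apex : C;
  leg : forall i, hom (D i) apex;
  leg_comp : forall i j (f : hom i j), comp (leg j) (fmap D f) = leg i }.

Definition is_colimit (D : functor J C) (c : cocone D) : Prop :=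
  forall c' : cocone D,
    exists! h : hom (apex c) (apex c'), forall i, comp h (leg c i) = leg c' i.

End Colimits.

Program Definition map_cocone (J C C' : category) (F : functor C C')
    (D : functor J C) (c : cocone D) : cocone (functor_comp F D) :=
  @Cocone J C' (functor_comp F D) (F (apex c)) (fun i => fmap F (leg c i)) _.
Next Obligation.
by move=> J C C' F D c i j f /=; rewrite -fmap_comp leg_comp.
Qed.

Record poset := Poset {
  pos :> small;
  ple : pos -> pos -> Prop;
  ple_refl : forall x, ple x x;
  ple_trans : forall y x z, ple x y -> ple y z -> ple x z;
  ple_anti : forall x y, ple x y -> ple y x -> x = y }.

Program Definition poset_cat (I : poset) : category :=
  @Category I (@ple I) (@ple_refl I) (fun i j k f g => ple_trans g f) _ _ _.
Next Obligation. by move=> *; apply: Prop_irrelevance. Qed.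
Next Obligation. by move=> *; apply: Prop_irrelevance. Qed.
Next Obligation. by move=> *; apply: Prop_irrelevance. Qed.

(* [countable A] means at most countable, so these are the subsets of
   cardinality smaller than aleph_1. *)
Definition aleph1_directed (I : poset) : Prop :=
  forall A : set I, countable A -> exists u : I, forall a, A a -> ple a u.

Section Accessible.
Variable C : category.

Definition has_aleph1_directed_colimits : Prop :=
  forall (I : poset) (D : functor (poset_cat I) C),
    aleph1_directed I -> exists c : cocone D, is_colimit c.

Definition aleph1_presentable (S : C) : Prop :=
  forall (I : poset) (D : functor (poset_cat I) C) (c : cocone D),
    aleph1_directed I -> is_colimit c ->
    is_colimit (map_cocone (hom_functor S) c).

Definition aleph1_accessible : Prop :=
  has_aleph1_directed_colimits /\
  exists (T : small) (G : T -> C),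
    (forall t, aleph1_presentable (G t)) /\
    forall X : C, exists (I : poset) (D : functor (poset_cat I) C)
      (c : cocone D),
      [/\ aleph1_directed I, forall i, exists t, D i = G t,
          is_colimit c & apex c = X].

End Accessible.

(* The tensor product of M and N over A, where A acts by ra on the right of M
   and by la on the left of N: formal finite sums of pairs modulo the
   congruence generated by the usual relations. Negation is - (m, n) = (- m, n).
   The actions are plain functions so that one construction serves tensor
   products over k, over R and over R (x)_k R^op. *)
Section Tensor.
Variables (M N : zmodType) (A : Type) (ra : M -> A -> M) (la : A -> N -> N).

Inductive tens_eqv : seq (M * N) -> seq (M * N) -> Prop :=
| TensRefl s : tens_eqv s s
| TensSym s t : tens_eqv s t -> tens_eqv t s
| TensTrans s t u : tens_eqv s t -> tens_eqv t u -> tens_eqv s u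
| TensCat s s' t t' :
    tens_eqv s s' -> tens_eqv t t' -> tens_eqv (s ++ t) (s' ++ t')
| TensCatC s t : tens_eqv (s ++ t) (t ++ s)
| TensZero n : tens_eqv [:: (0, n)] [::]
| TensDl m m' n : tens_eqv [:: (m + m', n)] [:: (m, n); (m', n)]
| TensDr m n n' : tens_eqv [:: (m, n + n')] [:: (m, n); (m, n')]
| TensBal m a n : tens_eqv [:: (ra m a, n)] [:: (m, la a n)].

Definition tens_rel : rel (seq (M * N)) := fun s t => `[< tens_eqv s t >].

Lemma tens_relP : equiv_class_of tens_rel.
Proof.
split.
- by move=> s; apply/asboolP; apply: TensRefl.
- by move=> s t; apply/asboolP/asboolP; apply: TensSym.
- move=> t s u /asboolP st /asboolP tu; apply/asboolP.
  exact: TensTrans st tu.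
Qed.
Canonical tens_equiv := EquivRelPack tens_relP.

Definition tens := {eq_quot tens_rel}.
HB.instance Definition _ := Choice.on tens.
HB.instance Definition _ := EqQuotient.on tens.

Definition tpi (s : seq (M * N)) : tens := \pi_tens s.

Lemma tpiP s t : tens_eqv s t -> tpi s = tpi t.
Proof. by move=> st; apply/eqmodP/asboolP. Qed.

Lemma tpiE s t : tpi s = tpi t -> tens_eqv s t.
Proof. by move/eqmodP/asboolP. Qed.

Lemma reprK_eqv s : tens_eqv (repr (tpi s)) s.
Proof. by apply: tpiE; rewrite /tpi reprK. Qed.

Definition tneg (s : seq (M * N)) := [seq (- p.1, p.2) | p <- s].
Definition tens_zero : tens := tpi [::].
Definition tens_add (x y : tens) : tens := tpi (repr x ++ repr y).
Definition tens_opp (x : tens) : tens := tpi (tneg (repr x)).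

Lemma tens_add_pi s t : tens_add (tpi s) (tpi t) = tpi (s ++ t).
Proof. by apply: tpiP; apply: TensCat; apply: reprK_eqv. Qed.

Lemma tneg_cat s : tpi (tneg s ++ s) = tens_zero.
Proof.
elim: s => [|[m n] s IHs] //=; apply: tpiP.
apply: (@TensTrans _ (([:: (- m, n)] ++ [:: (m, n)]) ++ (tneg s ++ s))).
  rewrite -!catA -[_ :: (_ ++ _)]/([:: (- m, n)] ++
    (tneg s ++ ([:: (m, n)] ++ s))).
  apply: TensCat; first exact: TensRefl.
  rewrite !catA; apply: TensCat; last exact: TensRefl.
  exact: TensCatC.
rewrite -[[::]]/([::] ++ [::]); apply: TensCat; last exact: tpiE.
apply: TensTrans (TensZero n); rewrite -(addNr m).
exact/TensSym/TensDl.
Qed.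

Lemma tens_addA : associative tens_add.
Proof.
elim/quotW=> s; elim/quotW=> t; elim/quotW=> u.
by rewrite -!/(tpi _) !tens_add_pi catA.
Qed.

Lemma tens_addC : commutative tens_add.
Proof.
elim/quotW=> s; elim/quotW=> t; rewrite -!/(tpi _) !tens_add_pi.
by apply: tpiP; apply: TensCatC.
Qed.

Lemma tens_add0 : left_id tens_zero tens_add.
Proof. by elim/quotW=> s; rewrite -!/(tpi _) tens_add_pi. Qed.

Lemma tens_addN : left_inverse tens_zero tens_opp tens_add.
Proof.
move=> x; rewrite /tens_opp -{2}(reprK x) -/(tpi _) tens_add_pi.
exact: tneg_cat.
Qed.

HB.instance Definition _ := GRing.isZmodule.Build tens
  tens_addA tens_addC tens_add0 tens_addN.

Definition tpure (m : M) (n : N) : tens := tpi [:: (m, n)].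

Definition balanced (G : zmodType) (f : M -> N -> G) : Prop :=
  [/\ forall m m' n, f (m + m') n = f m n + f m' n,
      forall m n n', f m (n + n') = f m n + f m n'
    & forall m a n, f (ra m a) n = f m (la a n)].

(* The additive map induced by f. It is meaningful only if f is balanced, see
   [tlift_pure]; this holds wherever it is used below. *)
Definition tlift (G : zmodType) (f : M -> N -> G) (x : tens) : G :=
  \sum_(p <- repr x) f p.1 p.2.

Lemma tpi_sum s : tpi s = \sum_(p <- s) tpure p.1 p.2.
Proof.
elim: s => [|[m n] s IHs]; first by rewrite big_nil.
by rewrite big_cons -IHs -[RHS]/(tens_add _ _) tens_add_pi.
Qed.

Lemma tens_ind (P : tens -> Prop) :
  P 0 -> (forall x y, P x -> P y -> P (x + y)) ->
  (forall m n, P (tpure m n)) -> forall x, P x.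
Proof.
move=> P0 PD Pp; elim/quotW=> s; rewrite -/(tpi s) tpi_sum.
by apply: big_ind => // p _; apply: Pp.
Qed.

Lemma tpureDl m m' n : tpure (m + m') n = tpure m n + tpure m' n.
Proof. by rewrite -[RHS]/(tens_add _ _) tens_add_pi; apply/tpiP/TensDl. Qed.

Lemma tpureDr m n n' : tpure m (n + n') = tpure m n + tpure m n'.
Proof. by rewrite -[RHS]/(tens_add _ _) tens_add_pi; apply/tpiP/TensDr. Qed.

Lemma tpure_bal m a n : tpure (ra m a) n = tpure m (la a n).
Proof. exact/tpiP/TensBal. Qed.

Section Lift.
Variables (G : zmodType) (f : M -> N -> G).
Hypothesis fP : balanced f.

Lemma tlift_pi s : tlift f (tpi s) = \sum_(p <- s) f p.1 p.2.
Proof.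
have [fDl fDr fB] := fP.
have: tens_eqv (repr (tpi s)) s by apply: reprK_eqv.
rewrite /tlift; move: (repr _) => t; elim=> {s t} //=.
- by move=> s t u _ -> _ ->.
- by move=> s s' t t' _ es _ et; rewrite !big_cat /= es et.
- by move=> s t; rewrite !big_cat /= addrC.
- move=> n; rewrite big_seq1 big_nil /=.
  by apply: (addrI (f 0 n)); rewrite -fDl !addr0.
- by move=> m m' n; rewrite big_seq1 big_cons big_seq1 /= fDl.
- by move=> m n n'; rewrite big_seq1 big_cons big_seq1 /= fDr.
- by move=> m a n; rewrite !big_seq1 /= fB.
Qed.

Lemma tlift_pure m n : tlift f (tpure m n) = f m n.
Proof. by rewrite tlift_pi big_seq1. Qed.

Lemma tliftD x y : tlift f (x + y) = tlift f x + tlift f y.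
Proof.
elim/quotW: x => s; elim/quotW: y => t; rewrite -!/(tpi _).
by rewrite -[X in tlift f X]/(tens_add _ _) tens_add_pi !tlift_pi big_cat.
Qed.

Lemma tlift0 : tlift f 0 = 0.
Proof. by apply: (addrI (tlift f 0)); rewrite -tliftD !addr0. Qed.

End Lift.
End Tensor.

Definition tmap (M N M' N' : zmodType) (A A' : Type)
    (ra : M -> A -> M) (la : A -> N -> N)
    (ra' : M' -> A' -> M') (la' : A' -> N' -> N')
    (f : M -> M') (g : N -> N') : tens ra la -> tens ra' la' :=
  tlift (fun m n => tpure ra' la' (f m) (g n)).
Arguments tmap {M N M' N' A A'} ra la ra' la' f g.

Section Lift2.
Variables (M N M' N' G : zmodType) (A A' : Type).
Variables (ra : M -> A -> M) (la : A -> N -> N).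
Variables (ra' : M' -> A' -> M') (la' : A' -> N' -> N').
Variable f : M -> N -> M' -> N' -> G.
Hypothesis f1 : forall m' n', balanced ra la (fun m n => f m n m' n').
Hypothesis f2 : forall m n, balanced ra' la' (f m n).

Lemma tlift2_balanced (t : tens ra' la') :
  balanced ra la (fun m n => tlift (f m n) t).
Proof.
split=> [m m' n|m n n'|m a n]; elim/tens_ind: t => [|s t IHs IHt|x y];
  rewrite ?(tlift0 (f2 _ _)) ?addr0 ?(tliftD (f2 _ _)) ?(tlift_pure (f2 _ _)) //.
- by rewrite IHs IHt addrACA.
- by have [->] := f1 x y.
- by rewrite IHs IHt addrACA.
- by have [_ ->] := f1 x y.
- by rewrite IHs IHt.
- by have [_ _ ->] := f1 x y.
Qed.

Definition tlift2 (s : tens ra la) (t : tens ra' la') : G :=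
  tlift (fun m n => tlift (f m n) t) s.

Lemma tlift2_pure m n m' n' :
  tlift2 (tpure ra la m n) (tpure ra' la' m' n') = f m n m' n'.
Proof.
by rewrite /tlift2 (tlift_pure (tlift2_balanced _)) (tlift_pure (f2 _ _)).
Qed.

Lemma tlift2Dl s s' t : tlift2 (s + s') t = tlift2 s t + tlift2 s' t.
Proof. exact: (tliftD (tlift2_balanced _)). Qed.

Lemma tlift2Dr s t t' : tlift2 s (t + t') = tlift2 s t + tlift2 s t'.
Proof.
rewrite /tlift2; elim/tens_ind: s => [|s s' IHs IHs'|m n].
- by rewrite !(tlift0 (tlift2_balanced _)) addr0.
- by rewrite !(tliftD (tlift2_balanced _)) IHs IHs' addrACA.
- by rewrite !(tlift_pure (tlift2_balanced _)) (tliftD (f2 _ _)).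
Qed.

Lemma tlift20l t : tlift2 0 t = 0.
Proof. exact: (tlift0 (tlift2_balanced _)). Qed.

Lemma tlift20r s : tlift2 s 0 = 0.
Proof. by apply: (addrI (tlift2 s 0)); rewrite -tlift2Dr !addr0. Qed.

End Lift2.

(* [algType k] would exclude the zero ring, whence this record. *)
Record kalgebra (k : comPzRingType) := KAlgebra {
  kring :> pzRingType;
  kstruct : {rmorphism k -> kring};
  kstruct_central : forall a x, kstruct a * x = x * kstruct a }.

Section Enveloping.
Variables (k : comPzRingType) (R : kalgebra k).
Local Notation eta := (kstruct R).

Definition env_ra (x : R) (a : k) : R := x * eta a.
Definition env_la (a : k) (y : R) : R := eta a * y.

(* The ring R (x)_k R^op. *)
Definition env := tens env_ra env_la.
HB.instance Definition _ := GRing.Zmodule.on env.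

Definition epure (x y : R) : env := tpure env_ra env_la x y.

Definition env_mul : env -> env -> env :=
  tlift2 (fun a b c d => epure (a * c) (d * b)).
Definition env_one : env := epure 1 1.

Lemma epureDl x x' y : epure (x + x') y = epure x y + epure x' y.
Proof. exact: tpureDl. Qed.
Lemma epureDr x y y' : epure x (y + y') = epure x y + epure x y'.
Proof. exact: tpureDr. Qed.
Lemma epure_bal x a y : epure (x * eta a) y = epure x (eta a * y).
Proof. exact: tpure_bal. Qed.
Lemma env_ind (P : env -> Prop) :
  P 0 -> (forall x y, P x -> P y -> P (x + y)) ->
  (forall m n, P (epure m n)) -> forall x, P x.
Proof. exact: tens_ind. Qed.

Lemma env_mul_bal1 c d :
  balanced env_ra env_la (fun a b => epure (a * c) (d * b)).
Proof.
split=> [a a' b|a b b'|a x b]; first by rewrite mulrDl epureDl.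
  by rewrite mulrDr epureDr.
rewrite /env_ra /env_la -mulrA kstruct_central mulrA epure_bal.
by rewrite !mulrA kstruct_central.
Qed.

Lemma env_mul_bal2 a b :
  balanced env_ra env_la (fun c d => epure (a * c) (d * b)).
Proof.
split=> [c c' d|c d d'|c x d]; first by rewrite mulrDr epureDl.
  by rewrite mulrDl epureDr.
by rewrite /env_ra /env_la mulrA epure_bal mulrA.
Qed.

Lemma env_mul_pure a b c d :
  env_mul (epure a b) (epure c d) = epure (a * c) (d * b).
Proof. exact: (tlift2_pure env_mul_bal1 env_mul_bal2). Qed.

Lemma env_mulDl : left_distributive env_mul +%R.
Proof. move=> s s' t; exact: (tlift2Dl env_mul_bal1 env_mul_bal2). Qed.
Lemma env_mulDr : right_distributive env_mul +%R.
Proof. move=> s s' t; exact: (tlift2Dr env_mul_bal1 env_mul_bal2). Qed.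
Lemma env_mul0l : left_zero 0 env_mul.
Proof. move=> s; exact: (tlift20l env_mul_bal1 env_mul_bal2). Qed.
Lemma env_mul0r : right_zero 0 env_mul.
Proof. move=> s; exact: (tlift20r env_mul_bal1 env_mul_bal2). Qed.

Lemma env_mulA : associative env_mul.
Proof.
elim/env_ind => [|x x' IHx IHx'|a b] y z.
- by rewrite !env_mul0l.
- by rewrite !env_mulDl IHx IHx'.
elim/env_ind: y => [|y y' IHy IHy'|c d].
- by rewrite !(env_mul0l, env_mul0r).
- by rewrite !(env_mulDl, env_mulDr) IHy IHy'.
elim/env_ind: z => [|z z' IHz IHz'|e f].
- by rewrite !env_mul0r.
- by rewrite !env_mulDr IHz IHz'.
- by rewrite !env_mul_pure !mulrA.
Qed.

Lemma env_mul1l : left_id env_one env_mul.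
Proof.
elim/env_ind => [|x y IHx IHy|a b]; first by rewrite env_mul0r.
  by rewrite env_mulDr IHx IHy.
by rewrite env_mul_pure mul1r mulr1.
Qed.

Lemma env_mul1r : right_id env_one env_mul.
Proof.
elim/env_ind => [|x y IHx IHy|a b]; first by rewrite env_mul0l.
  by rewrite env_mulDl IHx IHy.
by rewrite env_mul_pure mul1r mulr1.
Qed.

HB.instance Definition _ := GRing.Zmodule_isPzRing.Build env
  env_mulA env_mul1l env_mul1r env_mulDl env_mulDr.

Lemma epureM a b c d : epure a b * epure c d = epure (a * c) (d * b).
Proof. exact: env_mul_pure. Qed.

(* Left [env]-modules are the R-R-bimodules over k. *)
Definition lact (C : lmodType env) (a : R) (c : C) : C := epure a 1 *: c.
Definition ract (C : lmodType env) (c : C) (b : R) : C := epure 1 b *: c.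

Section Actions.
Variable C : lmodType env.
Implicit Types (c : C) (a b : R).

Lemma lactDl a a' c : lact (a + a') c = lact a c + lact a' c.
Proof. by rewrite /lact epureDl scalerDl. Qed.
Lemma lactDr a c c' : lact a (c + c') = lact a c + lact a c'.
Proof. exact: scalerDr. Qed.
Lemma ractDl c c' b : ract (c + c') b = ract c b + ract c' b.
Proof. exact: scalerDr. Qed.
Lemma ractDr c b b' : ract c (b + b') = ract c b + ract c b'.
Proof. by rewrite /ract epureDr scalerDl. Qed.
Lemma lactA a a' c : lact a (lact a' c) = lact (a * a') c.
Proof. by rewrite /lact scalerA epureM !mulr1. Qed.
Lemma ractA c b b' : ract (ract c b) b' = ract c (b * b').
Proof. by rewrite /ract scalerA epureM !mulr1. Qed.
Lemma lact1 c : lact 1 c = c.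
Proof. exact: scale1r. Qed.
Lemma ract1 c : ract c 1 = c.
Proof. exact: scale1r. Qed.
Lemma lractC a c b : ract (lact a c) b = lact a (ract c b).
Proof. by rewrite /lact /ract !scalerA !epureM !mul1r !mulr1. Qed.
Lemma epure_act a b c : epure a b *: c = lact a (ract c b).
Proof. by rewrite /lact /ract scalerA epureM !mulr1. Qed.
Lemma kact_agree x c : lact (eta x) c = ract c (eta x).
Proof.
by rewrite /lact /ract -[eta x in LHS]mul1r epure_bal mulr1.
Qed.
End Actions.

(* C (x)_R D, with bimodule structure (a (x) b) (c (x) d) = a c (x) d b. *)
Section BimoduleTensor.
Variables C D : lmodType env.

Definition btens := tens (@ract C) (@lact D).
HB.instance Definition _ := GRing.Zmodule.on btens.

Definition bpure (c : C) (d : D) : btens := tpure (@ract C) (@lact D) c d.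

Definition btens_scale : env -> btens -> btens :=
  tlift2 (fun a b c d => bpure (lact a c) (ract d b)).

Lemma bpureDl c c' d : bpure (c + c') d = bpure c d + bpure c' d.
Proof. exact: tpureDl. Qed.
Lemma bpureDr c d d' : bpure c (d + d') = bpure c d + bpure c d'.
Proof. exact: tpureDr. Qed.
Lemma bpure_bal c r d : bpure (ract c r) d = bpure c (lact r d).
Proof. exact: tpure_bal. Qed.
Lemma btens_ind (P : btens -> Prop) :
  P 0 -> (forall x y, P x -> P y -> P (x + y)) ->
  (forall c d, P (bpure c d)) -> forall x, P x.
Proof. exact: tens_ind. Qed.

Lemma btens_scale_bal1 c d :
  balanced env_ra env_la (fun a b => bpure (lact a c) (ract d b)).
Proof.
split=> [a a' b|a b b'|a x b]; first by rewrite lactDl bpureDl.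
  by rewrite ractDr bpureDr.
rewrite /env_ra /env_la -lactA kact_agree -lractC bpure_bal kact_agree ractA.
by rewrite kstruct_central.
Qed.

Lemma btens_scale_bal2 a b :
  balanced (@ract C) (@lact D) (fun c d => bpure (lact a c) (ract d b)).
Proof.
split=> [c c' d|c d d'|c r d]; first by rewrite lactDr bpureDl.
  by rewrite ractDl bpureDr.
by rewrite -lractC bpure_bal lractC.
Qed.

Lemma btens_scale_pure a b c d :
  btens_scale (epure a b) (bpure c d) = bpure (lact a c) (ract d b).
Proof. exact: (tlift2_pure btens_scale_bal1 btens_scale_bal2). Qed.

Lemma btens_scaleDr : right_distributive btens_scale +%R.
Proof. move=> s x y; exact: (tlift2Dr btens_scale_bal1 btens_scale_bal2). Qed.
Lemma btens_scaleDl x : {morph btens_scale^~ x : s t / s + t}.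
Proof. move=> s t; exact: (tlift2Dl btens_scale_bal1 btens_scale_bal2). Qed.
Lemma btens_scale0l x : btens_scale 0 x = 0.
Proof. exact: (tlift20l btens_scale_bal1 btens_scale_bal2). Qed.
Lemma btens_scale0r s : btens_scale s 0 = 0.
Proof. exact: (tlift20r btens_scale_bal1 btens_scale_bal2). Qed.

Lemma btens_scaleA s t x : btens_scale s (btens_scale t x) = btens_scale (s * t) x.
Proof.
elim/btens_ind: x => [|x y IHx IHy|c d].
- by rewrite !btens_scale0r.
- by rewrite !btens_scaleDr IHx IHy.
elim/env_ind: s => [|s s' IHs IHs'|a b].
- by rewrite mul0r !btens_scale0l.
- by rewrite mulrDl !btens_scaleDl IHs IHs'.
elim/env_ind: t => [|t t' IHt IHt'|a' b'].
- by rewrite mulr0 !btens_scale0l btens_scale0r.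
- by rewrite mulrDr !btens_scaleDl btens_scaleDr IHt IHt'.
- by rewrite epureM !btens_scale_pure lactA ractA.
Qed.

Lemma btens_scale1 : left_id 1 btens_scale.
Proof.
elim/btens_ind => [|x y IHx IHy|c d]; first by rewrite btens_scale0r.
  by rewrite btens_scaleDr IHx IHy.
by rewrite btens_scale_pure lact1 ract1.
Qed.

HB.instance Definition _ := GRing.Zmodule_isLmodule.Build env btens
  btens_scaleA btens_scale1 btens_scaleDr btens_scaleDl.

Lemma epure_bpure a b c d :
  epure a b *: bpure c d = bpure (lact a c) (ract d b).
Proof. exact: btens_scale_pure. Qed.

End BimoduleTensor.

(* R as a bimodule over itself: (a (x) b) r = a r b. *)
Definition rbim : Type := R.
HB.instance Definition _ := GRing.Zmodule.on rbim.

Definition rbim_scale (s : env) (r : rbim) : rbim :=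
  tlift (fun a b => (a * r * b : rbim)) s.

Lemma rbim_scale_bal (r : rbim) :
  balanced env_ra env_la (fun a b => (a * r * b : rbim)).
Proof.
split=> [a a' b|a b b'|a x b]; first by rewrite !mulrDl.
  by rewrite mulrDr.
by rewrite /env_ra /env_la -[a * _ * r]mulrA kstruct_central !mulrA.
Qed.

Lemma rbim_scale_pure a b r : rbim_scale (epure a b) r = a * r * b.
Proof. exact: (tlift_pure (rbim_scale_bal r)). Qed.
Lemma rbim_scaleDl r : {morph rbim_scale^~ r : s t / s + t}.
Proof. move=> s t; exact: (tliftD (rbim_scale_bal r)). Qed.
Lemma rbim_scale0l r : rbim_scale 0 r = 0.
Proof. exact: (tlift0 (rbim_scale_bal r)). Qed.

Lemma rbim_scaleDr : right_distributive rbim_scale +%R.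
Proof.
elim/env_ind=> [|s s' IHs IHs'|a b] x y.
- by rewrite !rbim_scale0l addr0.
- by rewrite !rbim_scaleDl IHs IHs' addrACA.
- by rewrite !rbim_scale_pure mulrDr mulrDl.
Qed.

Lemma rbim_scale0r s : rbim_scale s 0 = 0.
Proof. by apply: (addrI (rbim_scale s 0)); rewrite -rbim_scaleDr !addr0. Qed.

Lemma rbim_scaleA s t x : rbim_scale s (rbim_scale t x) = rbim_scale (s * t) x.
Proof.
elim/env_ind: s => [|s s' IHs IHs'|a b].
- by rewrite mul0r !rbim_scale0l.
- by rewrite mulrDl !rbim_scaleDl IHs IHs'.
elim/env_ind: t => [|t t' IHt IHt'|a' b'].
- by rewrite mulr0 !rbim_scale0l rbim_scale0r.
- by rewrite mulrDr !rbim_scaleDl rbim_scaleDr IHt IHt'.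
- by rewrite epureM !rbim_scale_pure !mulrA.
Qed.

Lemma rbim_scale1 : left_id 1 rbim_scale.
Proof. by move=> r; rewrite rbim_scale_pure mul1r mulr1. Qed.

HB.instance Definition _ := GRing.Zmodule_isLmodule.Build env rbim
  rbim_scaleA rbim_scale1 rbim_scaleDr rbim_scaleDl.

Definition btmap (C D C' D' : lmodType env)
    (f : {linear C -> C'}) (g : {linear D -> D'}) : btens C D -> btens C' D' :=
  tlift (fun c d => bpure (f c) (g d)).

(* The canonical maps (C (x) D) (x) E -> C (x) (D (x) E), R (x) C -> C and
   C (x) R -> C. *)
Definition bassoc (C D E : lmodType env) :
    btens (btens C D) E -> btens C (btens D E) :=
  tlift (fun x e => tlift (fun c d => bpure c (bpure d e)) x).
Definition blunit (C : lmodType env) : btens rbim C -> C :=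
  tlift (fun r c => lact r c).
Definition brunit (C : lmodType env) : btens C rbim -> C :=
  tlift (fun c r => ract c r).

Section CanonicalMaps.

Lemma ract_linear (C D : lmodType env) (f : {linear C -> D}) c r :
  f (ract c r) = ract (f c) r.
Proof. exact: linearZ. Qed.
Lemma lact_linear (C D : lmodType env) (f : {linear C -> D}) c r :
  f (lact r c) = lact r (f c).
Proof. exact: linearZ. Qed.
Lemma ract_bpure (C D : lmodType env) (c : C) (d : D) r :
  ract (bpure c d) r = bpure c (ract d r).
Proof. by rewrite /ract epure_bpure lact1. Qed.
Lemma lact_bpure (C D : lmodType env) (c : C) (d : D) r :
  lact r (bpure c d) = bpure (lact r c) d.
Proof. by rewrite /lact epure_bpure ract1. Qed.

Section Btmap.
Variables (C D C' D' : lmodType env).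
Variables (f : {linear C -> C'}) (g : {linear D -> D'}).

Lemma btmap_balanced :
  balanced (@ract C) (@lact D) (fun c d => bpure (f c) (g d)).
Proof.
split=> [x x' y|x y y'|x r y].
- by rewrite linearD bpureDl.
- by rewrite linearD bpureDr.
- by rewrite ract_linear bpure_bal lact_linear.
Qed.

Lemma btmap_pure c d : btmap f g (bpure c d) = bpure (f c) (g d).
Proof. exact: (tlift_pure btmap_balanced). Qed.
Lemma btmapD x y : btmap f g (x + y) = btmap f g x + btmap f g y.
Proof. exact: (tliftD btmap_balanced). Qed.
Lemma btmap0 : btmap f g 0 = 0.
Proof. exact: (tlift0 btmap_balanced). Qed.

End Btmap.

Lemma btmap_id (C D : lmodType env) (x : btens C D) :
  btmap idfun idfun x = x.
Proof.
elim/btens_ind: x => [|x y IHx IHy|c d]; first by rewrite btmap0.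
  by rewrite btmapD IHx IHy.
by rewrite btmap_pure.
Qed.

Lemma btmap_comp (C D C' D' C'' D'' : lmodType env)
    (f : {linear C' -> C''}) (g : {linear D' -> D''})
    (f' : {linear C -> C'}) (g' : {linear D -> D'}) (x : btens C D) :
  btmap (f \o f') (g \o g') x = btmap f g (btmap f' g' x).
Proof.
elim/btens_ind: x => [|x y IHx IHy|c d]; first by rewrite !btmap0.
  by rewrite !btmapD IHx IHy.
by rewrite !btmap_pure.
Qed.

Lemma bassoc_pure (C D E : lmodType env) (c : C) (d : D) (e : E) :
  bassoc (bpure (bpure c d) e) = bpure c (bpure d e).
Proof.
have bal2 (e' : E) : balanced (@ract C) (@lact D)
    (fun c d => bpure c (bpure d e')).
  split=> [x x' y|x y y'|x r y]; first by rewrite bpureDl.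
    by rewrite bpureDl bpureDr.
  by rewrite bpure_bal lact_bpure.
have bal1 : balanced (@ract (btens C D)) (@lact E)
    (fun x e' => tlift (fun c d => bpure c (bpure d e')) x).
  split=> [x x' y|x y y'|x r y].
  - exact: (tliftD (bal2 y)).
  - elim/btens_ind: x => [|x x' IHx IHx'|c' d'].
    + by rewrite !(tlift0 (bal2 _)) addr0.
    + by rewrite !(tliftD (bal2 _)) IHx IHx' addrACA.
    + by rewrite !(tlift_pure (bal2 _)) !bpureDr.
  - elim/btens_ind: x => [|x x' IHx IHx'|c' d'].
    + by rewrite [ract _ _]scaler0 !(tlift0 (bal2 _)).
    + by rewrite ractDl !(tliftD (bal2 _)) IHx IHx'.
    + by rewrite ract_bpure !(tlift_pure (bal2 _)) bpure_bal.
by rewrite /bassoc (tlift_pure bal1) (tlift_pure (bal2 e)).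
Qed.

Lemma blunit_pure (C : lmodType env) (r : rbim) (c : C) :
  blunit (bpure r c) = lact r c.
Proof.
apply: tlift_pure; split=> [x x' y|x y y'|x s y].
- exact: lactDl.
- exact: lactDr.
- by rewrite lactA; congr (lact _ y); rewrite [LHS]rbim_scale_pure mul1r.
Qed.

Lemma brunit_pure (C : lmodType env) (c : C) (r : rbim) :
  brunit (bpure c r) = ract c r.
Proof.
apply: tlift_pure; split=> [x x' y|x y y'|x s y].
- exact: ractDl.
- exact: ractDr.
- by rewrite ractA; congr (ract x _); rewrite [RHS]rbim_scale_pure mulr1.
Qed.

End CanonicalMaps.

Record coring := Coring {
  cobj :> lmodType env;
  comul : {linear cobj -> btens cobj cobj};
  counit : {linear cobj -> rbim};
  comulA : forall c,
    bassoc (btmap comul idfun (comul c)) = btmap idfun comul (comul c);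
  counitl : forall c, blunit (btmap counit idfun (comul c)) = c;
  counitr : forall c, brunit (btmap idfun counit (comul c)) = c }.

Record coring_hom (C D : coring) := CoringHom {
  cfun :> {linear C -> D};
  cfun_comul : forall c, comul D (cfun c) = btmap cfun cfun (comul C c);
  cfun_counit : forall c, counit D (cfun c) = counit C c }.

End Enveloping.

Lemma linear_eq (S : pzRingType) (U V : lmodType S) (f g : {linear U -> V}) :
  f =1 g -> f = g.
Proof.
move=> /funext; case: f g => [f [[fa] [fs]]] [g [[ga] [gs]]] /= E.
rewrite {}E in fa fs *.
by rewrite (Prop_irrelevance fa ga) (Prop_irrelevance fs gs).
Qed.

Program Definition Mod (S : pzRingType) : category :=
  @Category (lmodType S) (fun U V => {linear U -> V}) (fun U => idfun)
    (fun U V W f g => f \o g) _ _ _.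
Next Obligation. by move=> *; apply: linear_eq. Qed.
Next Obligation. by move=> *; apply: linear_eq. Qed.
Next Obligation. by move=> *; apply: linear_eq. Qed.

Section ModuleNotions.
Variable S : pzRingType.

Definition is_submodule (M : lmodType S) (N : set M) : Prop :=
  N 0 /\ forall (a : S) x y, N x -> N y -> N (a *: x + y).

Definition countably_generated_submodule (M : lmodType S) (N : set M) : Prop :=
  exists A : set M, countable A /\ N = smallest (@is_submodule M) A.

Definition countably_generated (M : lmodType S) : Prop :=
  countably_generated_submodule [set: M]%classic.

Definition left_countably_noetherian : Prop :=
  forall I : set S^o, is_submodule I -> countably_generated_submodule I.

(* Exactness of - (x)_S M on right S-modules; these are the left S^c-modules. *)
Definition rmod_act (N : lmodType S^c) (n : N) (s : S) : N := (s : S^c) *: n.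
Definition lmod_act (M : lmodType S) (s : S) (m : M) : M := s *: m.

Definition flat (M : lmodType S) : Prop :=
  forall (N N' : lmodType S^c) (f : {linear N -> N'}), injective f ->
    injective (tmap (@rmod_act N) (@lmod_act M) (@rmod_act N') (@lmod_act M)
                 f id).

Section Kernel.
Variables (U V : lmodType S) (f : {linear U -> V}).

Definition kernel_pred : {pred U} := fun x => f x == 0.

Lemma kernel_submod : GRing.submod_closed kernel_pred.
Proof.
split=> [|a x y]; rewrite !unfold_in ?linear0 //.
by move=> /eqP fx /eqP fy; rewrite linearP fx fy scaler0 addr0.
Qed.
HB.instance Definition _ := GRing.isSubmodClosed.Build S U
  kernel_pred kernel_submod.

Definition kernel := {x : U | x \in kernel_pred}.
HB.instance Definition _ := SubChoice.on kernel.
HB.instance Definition _ := [SubChoice_isSubLmodule of kernel by <:].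

End Kernel.

End ModuleNotions.

Section CoringCategories.
Variables (k : comPzRingType) (R : kalgebra k).

Lemma coring_hom_eq (C D : coring R) (f g : coring_hom C D) :
  f =1 g -> f = g.
Proof.
case: f g => [f fm fe] [g gm ge] /= /linear_eq E.
rewrite {}E in fm fe *.
by rewrite (Prop_irrelevance fm gm) (Prop_irrelevance fe ge).
Qed.

Program Definition coring_id (C : coring R) : coring_hom C C :=
  @CoringHom k R C C idfun _ _.
Next Obligation. by move=> C c; rewrite btmap_id. Qed.
Next Obligation. by []. Qed.

Program Definition coring_comp (C D E : coring R)
    (f : coring_hom D E) (g : coring_hom C D) : coring_hom C E :=
  @CoringHom k R C E (cfun f \o cfun g) _ _.
Next Obligation.
by move=> C D E f g c; rewrite /= btmap_comp -!cfun_comul.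
Qed.
Next Obligation. by move=> C D E f g c /=; rewrite !cfun_counit. Qed.

Program Definition Corings : category :=
  @Category (coring R) (@coring_hom k R) coring_id coring_comp _ _ _.
Next Obligation. by move=> *; apply: coring_hom_eq. Qed.
Next Obligation. by move=> *; apply: coring_hom_eq. Qed.
Next Obligation. by move=> *; apply: coring_hom_eq. Qed.

Definition surjective_counit (C : coring R) : Prop :=
  forall r : R, exists c : C, counit C c = r.

Definition flat_kernel (C : coring R) : Prop :=
  surjective_counit C /\ flat (kernel (counit C)).

Definition Corings_sur : category :=
  full_subcategory (C := Corings) surjective_counit.
Definition Corings_bifl : category :=
  full_subcategory (C := Corings) flat_kernel.

End CoringCategories.

(* Main.v *)
(* Let S be the enveloping ring, so that bimodules are S-modules and, S being
   countably Noetherian, a bimodule is aleph_1-presentable iff it is countably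
   generated. Directed colimits of corings are created by the forgetful functor
   to bimodules, as tensor products commute with them; this yields "countably
   generated => presentable". Conversely, let C be a coring. A countably
   generated subbimodule D of C need not be a subcoring, but the restriction of
   the comultiplication to D lifts to a map from D to the tensor square of some
   larger D', and any identity which holds in a tensor power of C already holds
   in a tensor power of some larger D''. The union of a countable chain of such
   enlargements carries a coring structure making the inclusion a morphism. The
   pairs of a countably generated subbimodule and such a structure (which is
   not unique, tensor squares of inclusions need not be injective) form an
   aleph_1-directed poset with colimit C. Surjectivity of the counit is ensured
   by including one element, and flatness of the kernel by trivialising, along
   the chain, the countably many relations that matter in the equational
   criterion of flatness. *)

Require Import Defs.
From HB Require Import structures.
From mathcomp Require Import all_boot all_order all_algebra.
From mathcomp Require Import boolp classical_sets cardinality.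

Set Implicit Arguments.
Unset Strict Implicit.
Unset Printing Implicit Defensive.

Import Defs GRing.Theory.
Local Open Scope classical_set_scope.
Local Open Scope ring_scope.

(** * Submodules and countable generation *)

(** Colimits are handled on elements: over an aleph_1-directed poset, a cocone of modules is a
    colimit iff every element of the apex comes from a stage and every element that becomes zero in
    the apex is already zero at a later stage. This form passes to tensor powers and to corings, and
    turns each statement about a countably generated module into countably many conditions, each met
    at some stage. The obstacle is that tensor powers of an inclusion need not be injective. The
    counit axioms of a substructure take place in the module itself and are inherited;
    coassociativity takes place in a triple tensor product and has to be forced along the chain.
    Parts (a) and (b) are two instances of one argument about a property [P] of corings that is
    stable under directed colimits and under unions of suitable chains. The definition of
    accessibility asks for diagrams whose objects are equal, not merely isomorphic, to members of a
    set; hence the canonical diagram is finally replaced by an isomorphic one whose objects are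
    carried by subsets of one fixed type. *)

Lemma countable_image T U (f : T -> U) (A : set T) :
  countable A -> countable (f @` A).
Proof. exact/sub_countable/card_image_le. Qed.

Lemma countable_setU T (A B : set T) :
  countable A -> countable B -> countable (A `|` B).
Proof.
move=> Ac Bc; have -> : A `|` B = \bigcup_(b : bool) (if b then A else B).
  apply/seteqP; split=> [x [h|h]|x [[] _ h]]; [by exists true|by exists false| |];
    by [left | right].
by apply: bigcup_countable => // -[] _.
Qed.

Section Submodules.
Variables (S : pzRingType) (M : lmodType S).
Implicit Types (A N : set M) (x y : M).

Definition gspan A : set M := smallest (@is_submodule S M) A.

Lemma gspan_min A N : is_submodule N -> A `<=` N -> gspan A `<=` N.
Proof. by move=> hN AN x; apply. Qed.

Lemma sub_gspan A : A `<=` gspan A.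
Proof. by move=> x Ax N [_]; apply. Qed.

Lemma gspan_submodule A : is_submodule (gspan A).
Proof.
split=> [N [[]] //|a x y Ax Ay N [hN AN]].
by apply: (hN.2); [apply: Ax | apply: Ay].
Qed.

Lemma gspan_mono A A' : A `<=` A' -> gspan A `<=` gspan A'.
Proof.
move=> AA'; apply: gspan_min; first exact: gspan_submodule.
by move=> x /AA'; apply: sub_gspan.
Qed.

Section Closure.
Variables (N : set M) (hN : is_submodule N).

Lemma submod0 : N 0. Proof. exact: hN.1. Qed.
Lemma submodD x y : N x -> N y -> N (x + y).
Proof. by move=> Nx Ny; rewrite -[x]scale1r; apply: hN.2. Qed.
Lemma submodZ a x : N x -> N (a *: x).
Proof. by move=> Nx; rewrite -[_ *: _]addr0; apply: hN.2 => //; exact: submod0. Qed.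
Lemma submodN x : N x -> N (- x).
Proof. by rewrite -scaleN1r; apply: submodZ. Qed.
Lemma submodB x y : N x -> N y -> N (x - y).
Proof. by move=> Nx /submodN; apply: submodD. Qed.
Lemma submod_sum I (r : seq I) (P : pred I) (F : I -> M) :
  (forall i, P i -> N (F i)) -> N (\sum_(i <- r | P i) F i).
Proof. by move=> NF; apply: big_ind => //; [exact: submod0 | exact: submodD]. Qed.
End Closure.

Lemma gspanT A : (forall x, gspan A x) -> [set: M] = gspan A.
Proof. by move=> hA; apply/seteqP; split=> // x _; apply: hA. Qed.

(** A coefficient vector can be padded with zeros. The statement is about all large [r] so that
    finitely many elements can be expressed in the same first [r] generators. *)
Lemma gspan_range_ev (x : nat -> M) y : gspan (range x) y ->
  exists n, forall r, (n <= r)%N -> exists v : 'rV[S]_r, y = \sum_(j < r) v 0 j *: x j.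
Proof.
move: y; apply: gspan_min => [|_ [n _ <-]]; last first.
  exists n.+1 => r nr; exists (delta_mx 0 (Ordinal nr)).
  rewrite (bigD1 (Ordinal nr)) //= big1 => [|j jn].
    by rewrite mxE !eqxx scale1r addr0.
  by rewrite mxE eqxx (negPf jn) scale0r.
split; first by exists 0 => r _; exists 0; rewrite big1 // => j _; rewrite mxE scale0r.
move=> a y z [n yn] [m zm]; exists (maxn n m) => r.
rewrite geq_max => /andP [/yn [v ->] /zm [w ->]]; exists (a *: v + w).
rewrite scaler_sumr -big_split; apply: eq_bigr => j _.
by rewrite !mxE scalerDl scalerA.
Qed.

Lemma gspan_rangeP (x : nat -> M) y :
  gspan (range x) y <-> exists n (v : 'rV[S]_n), y = \sum_(j < n) v 0 j *: x j.
Proof.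
split=> [/gspan_range_ev [n /(_ n (leqnn n)) h]|[n [v ->]]]; first by exists n.
apply: (submod_sum (gspan_submodule _)) => j _.
by apply: (submodZ (gspan_submodule _)); apply: sub_gspan; exists j.
Qed.

Lemma countably_generatedP N : countably_generated_submodule N <->
  exists x : nat -> M, N = gspan (range x).
Proof.
split=> [[A [/countable_injP [f fI] ->]]|[x ->]]; last first.
  by exists (range x); split=> //; exact: countable_image.
(* Indices not hit by the enumeration give [0], which does not change the span and also covers an
   empty [A]. *)
pose x n := if pselect (exists a, A a /\ f a = n) is left h
            then projT1 (cid h) else 0.
exists x; apply/seteqP; split; apply: gspan_min; try exact: gspan_submodule.
  move=> a Aa; apply: sub_gspan; exists (f a) => //; rewrite /x.
  case: pselect => [h|]; last by case; exists a.
  by case: cid => b [Ab fb] /=; apply: fI; rewrite ?inE.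
move=> _ [n _ <-]; rewrite /x; case: pselect => [h|_].
  by case: cid => b [Ab _] /=; apply: sub_gspan.
exact: submod0 (gspan_submodule _).
Qed.

Lemma cg_gspan A : countable A -> countably_generated_submodule (gspan A).
Proof. by exists A. Qed.

End Submodules.

Lemma gspan_image (S : pzRingType) (M M' : lmodType S) (f : {linear M -> M'})
    (A : set M) : f @` gspan A = gspan (f @` A).
Proof.
apply/seteqP; split.
  move=> _ [x Ax <-]; move: x Ax.
  apply: (@gspan_min _ _ _ (f @^-1` gspan (f @` A))).
    split=> [|a x y /= hx hy]; rewrite /preimage /= ?linear0.
      exact: submod0 (gspan_submodule _).
    by rewrite linearP; apply: (gspan_submodule _).2.
  by move=> x Ax; apply: sub_gspan; exists x.
apply: gspan_min; last by apply: image_subset; exact: sub_gspan.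
split; first by exists 0; rewrite ?linear0 //; exact: submod0 (gspan_submodule _).
move=> a _ _ [x Ax <-] [y Ay <-]; exists (a *: x + y); rewrite ?linearP //.
exact: (gspan_submodule A).2.
Qed.

Lemma cg_image (S : pzRingType) (M M' : lmodType S) (f : {linear M -> M'})
    (N : set M) : countably_generated_submodule N ->
  countably_generated_submodule (f @` N).
Proof.
by move=> [A [Ac ->]]; rewrite -/(gspan A) gspan_image; apply: cg_gspan; apply: countable_image.
Qed.

Lemma cg_bigcup (S : pzRingType) (M : lmodType S) T (A : set T) (N : T -> set M) :
  countable A -> (forall t, A t -> countably_generated_submodule (N t)) ->
  countably_generated_submodule (gspan (\bigcup_(t in A) N t)).
Proof.
move=> Ac Ncg.
have /choice [x xP] : forall t, exists X : set M,
    A t -> countable X /\ N t = gspan X.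
  move=> t; have [/Ncg [X hX]|nA] := pselect (A t); first by exists X.
  by exists set0.
rewrite (_ : gspan _ = gspan (\bigcup_(t in A) x t)).
  by apply: cg_gspan; apply: bigcup_countable => // t /xP [].
apply/seteqP; split; apply: gspan_min; try exact: gspan_submodule.
  move=> y [t At]; rewrite (xP t At).2; apply: gspan_mono => z xz.
  by exists t.
move=> y [t At xy]; apply: sub_gspan; exists t => //.
by rewrite (xP t At).2; apply: sub_gspan.
Qed.

Section SubLmodule.
Variables (S : pzRingType) (M : lmodType S) (N : set M).
Hypothesis hN : is_submodule N.

(** The closure proof is an argument so that the closedness instance, and with it the module
    structure on the subtype, can be found from the predicate. *)
Definition submod_pred of is_submodule N : {pred M} := fun x => `[< N x >].

Lemma submod_pred_closed : GRing.submod_closed (submod_pred hN).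
Proof.
split=> [|a x y /asboolP Nx /asboolP Ny]; apply/asboolP; first exact: submod0.
exact: hN.2.
Qed.
HB.instance Definition _ := GRing.isSubmodClosed.Build S M
  (submod_pred hN) submod_pred_closed.

Definition sub_lmod := {x : M | x \in submod_pred hN}.
HB.instance Definition _ := SubChoice.on sub_lmod.
HB.instance Definition _ := [SubChoice_isSubLmodule of sub_lmod by <:].

Definition sub_val (x : sub_lmod) : M := val x.
Lemma sub_val_linear : linear sub_val.
Proof. by move=> a x y; rewrite /sub_val linearP. Qed.
HB.instance Definition _ := GRing.isLinear.Build S sub_lmod M _ sub_val sub_val_linear.

Lemma sub_valP x : N (sub_val x).
Proof. by case: x => x /= hx; apply/asboolP. Qed.
Lemma sub_val_inj : injective sub_val.
Proof. exact: val_inj. Qed.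
Definition sub_mk x (Nx : N x) : sub_lmod := exist _ x (asboolT Nx).
Lemma sub_mkK x (Nx : N x) : sub_val (sub_mk Nx) = x.
Proof. by []. Qed.
Lemma sub_val_range : range sub_val = N.
Proof.
apply/seteqP; split=> [_ [x _ <-]|x Nx]; first exact: sub_valP.
by exists (sub_mk Nx).
Qed.

End SubLmodule.

Lemma cg_injective (S : pzRingType) (M M' : lmodType S) (f : {linear M -> M'}) :
  injective f -> countably_generated_submodule (range f) -> countably_generated M.
Proof.
move=> fI [A [Ac fA]].
have fAc : countable (f @^-1` A).
  move/countable_injP: Ac => [g gI]; apply/countable_injP; exists (g \o f).
  by move=> x y; rewrite !inE => fx fy /gI /fI; rewrite !inE; apply.
exists (f @^-1` A); split=> //.
apply/gspanT => x.
have : range f (f x) by exists x.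
rewrite fA => hx.
have /(_ (f x) hx) [y hy /fI <- //] : gspan A `<=` f @` gspan (f @^-1` A).
apply: gspan_min => [|a Aa].
  rewrite gspan_image; exact: gspan_submodule.
have [y _ ya] : range f a by rewrite fA; exact: sub_gspan.
by exists y => //; apply: sub_gspan; rewrite /preimage /= ya.
Qed.

Lemma cg_sub_lmod (S : pzRingType) (M : lmodType S) (N : set M)
    (hN : is_submodule N) : countably_generated_submodule N ->
  countably_generated (sub_lmod hN).
Proof.
move=> cN; apply: (@cg_injective _ _ _ (@sub_val _ _ _ hN)).
  exact: sub_val_inj.
by rewrite sub_val_range.
Qed.

Section Noetherian.
Variables (S : pzRingType) (noethS : left_countably_noetherian S).

(** The hypothesis concerns left ideals only. As in Hilbert's basis theorem, one filters by the
    number of generators of [N'] used and looks at leading coefficients: those occurring in [N] at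
    level [n] form an ideal, countably many lifts of its generators suffice at that level, and
    subtracting a combination of them lowers the level. *)
Lemma cg_submodule (M : lmodType S) (N N' : set M) : is_submodule N ->
  N `<=` N' -> countably_generated_submodule N' -> countably_generated_submodule N.
Proof.
move=> hN NN' /countably_generatedP [c N'E].
pose part n y := exists v : 'rV[S]_n, y = \sum_(j < n) v 0 j *: c j.
have partP n a x y : part n x -> part n y -> part n (a *: x + y).
  move=> [v ->] [w ->]; exists (a *: v + w).
  rewrite scaler_sumr -big_split; apply: eq_bigr => j _.
  by rewrite !mxE scalerDl scalerA.
have part0 n : part n 0.
  by exists 0; rewrite big1 // => j _; rewrite mxE scale0r.
have partS n y : part n.+1 y -> exists s, part n (y - s *: c n).
  move=> [v ->]; rewrite big_ord_recr /=; exists (v 0 ord_max).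
  rewrite addrK; exists (\row_j v 0 (widen_ord (leqnSn n) j)).
  by apply: eq_bigr => j _; rewrite mxE.
(* The ideal of possible coefficients at [c n] of elements of [N] that are combinations of [c 0],
   ..., [c n]. A coefficient need not be determined by the element. *)
pose J n : set S^o := [set s | exists x, N x /\ part n (x - s *: c n)].
have hJ n : is_submodule (J n).
  split; first by exists 0; rewrite scale0r subr0; split=> //; exact: submod0.
  move=> a s t [x [Nx xs]] [y [Ny yt]]; exists (a *: x + y); split; first exact: hN.2.
  rewrite scalerDl -scalerA opprD addrACA -scalerBr; exact: partP.
have /choice [s sP] n : exists s : nat -> S, J n = gspan (range (s : nat -> S^o)).
  by have /countably_generatedP [s ->] := noethS (hJ n); exists s.
have /choice [x xP] (p : nat * nat) : exists x, N x /\ part p.1 (x - s p.1 p.2 *: c p.1).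
  have : J p.1 (s p.1 p.2) by rewrite sP; apply: sub_gspan; exists p.2.
  by [].
exists (range x); split; first exact: countable_image.
rewrite -/(gspan _); apply/seteqP; split; last first.
  by apply: gspan_min => // _ [p _ <-]; case: (xP p).
have key n y : N y -> part n y -> gspan (range x) y.
  elim: n y => [|n IHn] y Ny.
    by move=> [v ->]; rewrite big_ord0; exact: submod0 (gspan_submodule _).
  move=> /partS [t yt].
  have : J n t by exists y.
  rewrite sP => /gspan_rangeP [m [v tE]].
  pose z := \sum_(j < m) v 0 j *: x (n, j : nat).
  have zx : gspan (range x) z.
    apply: submod_sum; first exact: gspan_submodule.
    by move=> j _; apply: (submodZ (gspan_submodule _)); apply: sub_gspan; exists (n, j : nat).
  have Nz : N z.
    by apply: (submod_sum hN) => j _; apply: (submodZ hN); case: (xP (n, j : nat)).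
  rewrite -(subrK z y); apply: (submodD (gspan_submodule _)) => //.
  apply: IHn; first exact: submodB.
  (* The element [z] of [N] has the same leading coefficient [t] as [y], so [y - z] uses only the
     first [n] generators. *)
  have zt : part n (z - t *: c n).
    rewrite tE scaler_suml -sumrB.
    apply: big_ind => // [u w hu hw|j _]; first by rewrite -[u]scale1r; apply: partP.
    rewrite -scalerA -scalerBr -[_ *: _]addr0; apply: partP => //.
    by case: (xP (n, j : nat)).
  have -> : y - z = (-1) *: (z - t *: c n) + (y - t *: c n).
    by rewrite scaleN1r opprB [RHS]addrC addrA subrK.
  exact: partP.
move=> y Ny; have := NN' y Ny; rewrite N'E => /gspan_rangeP [n [v yE]].
by apply: (key n) => //; exists v.
Qed.

End Noetherian.

(** * Directed colimits of modules, elementwise *)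

Lemma linear_ex (S : pzRingType) (U V : lmodType S) (f : U -> V) :
  linear f -> exists g : {linear U -> V}, g =1 f.
Proof.
move=> fL.
pose g : {linear U -> V} := HB.pack f (GRing.isLinear.Build S U V _ f fL).
by exists g.
Qed.

Section UpperBounds.
Variables (I : poset) (dI : aleph1_directed I).

Lemma ub_image T (A : set T) (f : T -> I) : countable A ->
  exists u, forall t, A t -> ple (f t) u.
Proof.
move=> Ac; have [u uP] := dI (countable_image f Ac).
by exists u => t At; apply: uP; exists t.
Qed.

Lemma ub_seq (f : nat -> I) : exists u, forall n, ple (f n) u.
Proof. by have [u uP] := ub_image f (countableP [set: nat]); exists u => n; apply: uP. Qed.

Lemma ub2 (i j : I) : exists u, ple i u /\ ple j u.
Proof.
have [u uP] := ub_seq (fun n => if n is 0 then i else j).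
by exists u; split; [exact: uP 0 | exact: uP 1].
Qed.

Lemma ub_nonempty : exists u : I, True.
Proof. by have [u _] := @dI set0 (countable0 _); exists u. Qed.

End UpperBounds.

Section Systems.
Variables (I : poset) (S : pzRingType) (D : functor (poset_cat I) (Mod S)).

Definition tr (i j : I) (h : ple i j) : {linear D i -> D j} := fmap D h.

Lemma tr_id i (h : ple i i) x : tr h x = x.
Proof.
rewrite (Prop_irrelevance h (ple_refl i)) /tr.
by rewrite [fmap D _](fmap_id D i).
Qed.

Lemma tr_comp i j l (h : ple i j) (h' : ple j l) (h'' : ple i l) x :
  tr h' (tr h x) = tr h'' x.
Proof.
rewrite (Prop_irrelevance h'' (ple_trans h h')) /tr.
by rewrite [fmap D (ple_trans _ _)](@fmap_comp _ _ D i j l h' h).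
Qed.

Lemma tr_irr i j (h h' : ple i j) x : tr h x = tr h' x.
Proof. by rewrite (Prop_irrelevance h h'). Qed.

Variable c : cocone D.

Definition lg (i : I) : {linear D i -> apex c} := leg c i.

Lemma lg_tr i j (h : ple i j) x : lg j (tr h x) = lg i x.
Proof. by rewrite /lg /tr -(@leg_comp _ _ D c i j h). Qed.

(** The concrete description of a directed colimit. It is equivalent to the universal property by
    [ew_colimit] and [colimit_elementwise], and is the form used in all later arguments. *)
Definition elementwise : Prop :=
  (forall x, exists i (y : D i), lg i y = x) /\
  (forall i (x : D i), lg i x = 0 -> exists j (h : ple i j), tr h x = 0).

Hypothesis dI : aleph1_directed I.

Lemma ew_dies2 i (x y : D i) : elementwise -> lg i x = lg i y ->
  exists j (h : ple i j), tr h x = tr h y.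
Proof.
move=> [_ cE] /eqP; rewrite -subr_eq0 -linearB => /eqP /cE [j [h /eqP]].
by rewrite linearB subr_eq0 => /eqP e; exists j, h.
Qed.

Lemma ew_eq i j (x : D i) (y : D j) : elementwise -> lg i x = lg j y ->
  exists l (h : ple i l) (h' : ple j l), tr h x = tr h' y.
Proof.
move=> cE e; have [u [iu ju]] := ub2 dI i j.
have : lg u (tr iu x) = lg u (tr ju y) by rewrite !lg_tr.
move=> /(ew_dies2 cE) [l [h]].
rewrite (tr_comp _ _ (ple_trans iu h)) (tr_comp _ _ (ple_trans ju h)) => e'.
by exists l, (ple_trans iu h), (ple_trans ju h).
Qed.

(** Two preimages of one element become equal at a common later stage, so a compatible family has a
    well-defined value there. The target is a bare type; linearity is added afterwards. *)
Lemma ew_glue T (F : forall i, D i -> T) : elementwise ->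
  (forall i j (h : ple i j) x, F j (tr h x) = F i x) ->
  exists g : apex c -> T, forall i x, g (lg i x) = F i x.
Proof.
move=> cE FP.
have gP x : exists t, forall i (y : D i), lg i y = x -> F i y = t.
  have [i [y yx]] := cE.1 x; exists (F i y) => j z; rewrite -yx => e.
  have [l [h [h' e']]] := ew_eq cE e.
  by rewrite -(FP _ _ h) e' FP.
have /choice [g gE] := gP.
by exists g => i x; rewrite (gE (lg i x) i x erefl).
Qed.

Lemma ew_lift2 x y : elementwise ->
  exists i (x' y' : D i), lg i x' = x /\ lg i y' = y.
Proof.
move=> [sur _]; have [i [x' <-]] := sur x; have [j [y' <-]] := sur y.
have [u [iu ju]] := ub2 dI i j.
by exists u, (tr iu x'), (tr ju y'); rewrite !lg_tr.
Qed.

Lemma ew_glue_linear (E : lmodType S) (F : forall i, {linear D i -> E}) :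
  elementwise -> (forall i j (h : ple i j) x, F j (tr h x) = F i x) ->
  exists g : {linear apex c -> E}, forall i x, g (lg i x) = F i x.
Proof.
move=> cE FP; have [g gF] := @ew_glue E F cE FP.
have gL : linear g.
  move=> a x y; have [i [x' [y' [<- <-]]]] := ew_lift2 x y cE.
  by rewrite -linearP !gF linearP.
by have [g' g'E] := linear_ex gL; exists g' => i x; rewrite g'E.
Qed.

Lemma ew_colimit : elementwise -> is_colimit c.
Proof.
move=> cE c'.
have [|g gE] := @ew_glue_linear (apex c') (leg c') cE.
  move=> i j h x; exact: (congr1 (fun f : {linear _ -> _} => f x)
    (@leg_comp _ _ D c' i j h)).
exists g; split; first by move=> i; apply: linear_eq => x; exact: gE.
move=> g' g'E; apply: linear_eq => x.
have [i [y <-]] := cE.1 x; rewrite gE -(g'E i); reflexivity.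
Qed.

End Systems.

Arguments tr {I S D i j} h.

(** * A construction of the directed colimit of modules *)

Section ConstructedColimit.
Variables (I : poset) (S : pzRingType) (D : functor (poset_cat I) (Mod S)).
Variable dI : aleph1_directed I.

Definition dtotal := {i : I & D i}.
Definition drel (p q : dtotal) : Prop :=
  exists l (h : ple (tag p) l) (h' : ple (tag q) l),
    tr h (tagged p) = tr h' (tagged q).

Lemma drel_refl p : drel p p.
Proof. by exists (tag p), (ple_refl _), (ple_refl _). Qed.
Lemma drel_sym p q : drel p q -> drel q p.
Proof. by move=> [l [h [h' e]]]; exists l, h', h. Qed.
Lemma drel_trans q p r : drel p q -> drel q r -> drel p r.
Proof.
move=> [l [h [h' e]]] [m [g [g' e']]]; have [u [lu mu]] := ub2 dI l m.
exists u, (ple_trans h lu), (ple_trans g' mu).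
rewrite -(tr_comp h lu) -(tr_comp g' mu) e -e'.
by rewrite (tr_comp _ _ (ple_trans h' lu)) (tr_comp _ _ (ple_trans h' lu)).
Qed.

(** Elements are the equivalence classes of [drel], taken as sets. Directedness is an argument
    because the module operations on classes need common upper bounds. *)
Definition dcolim of aleph1_directed I : small :=
  {A : set dtotal | exists p, A = drel p}.
Local Notation L := (dcolim dI).

Definition dclass p : L := exist _ (drel p) (ex_intro _ p erefl).
Definition drepr (x : L) : dtotal := projT1 (cid (proj2_sig x)).

Lemma dcolim_eq (x y : L) : sval x = sval y -> x = y.
Proof. by case: x y => [A hA] [B hB] /= e; apply: eq_exist. Qed.
Lemma dclassP p q : drel p q -> dclass p = dclass q.
Proof.
move=> pq; apply: dcolim_eq; apply/funext => r; apply/propext.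
by split; apply: drel_trans => //; apply: drel_sym.
Qed.
Lemma dclassE p q : dclass p = dclass q -> drel p q.
Proof. by move=> /(congr1 sval) /= ->; apply: drel_refl. Qed.
Lemma dreprK x : dclass (drepr x) = x.
Proof.
by apply: dcolim_eq; rewrite /drepr; case: cid => p /= e.
Qed.

Definition dcl i (x : D i) : L := dclass (Tagged (fun i => D i) x).

Lemma dcl_tr i j (h : ple i j) x : dcl (tr h x) = dcl x.
Proof.
apply/dclassP; exists j, (ple_refl j), h => /=; exact: tr_id.
Qed.

Lemma dcl_eq i (x y : D i) : dcl x = dcl y -> exists l (h : ple i l), tr h x = tr h y.
Proof.
by move=> /dclassE [l [h [h' /= e]]]; exists l, h; rewrite e; apply: tr_irr.
Qed.

Lemma dcl_sur x : exists i (y : D i), x = dcl y.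
Proof. by rewrite -(dreprK x); case: (drepr x) => i y; exists i, y. Qed.

Lemma dcl_sur2 x y : exists i (x' y' : D i), x = dcl x' /\ y = dcl y'.
Proof.
have [i [x' ->]] := dcl_sur x; have [j [y' ->]] := dcl_sur y.
have [u [iu ju]] := ub2 dI i j.
by exists u, (tr iu x'), (tr ju y'); rewrite !dcl_tr.
Qed.

Lemma dcl_sur3 x y z : exists i (x' y' z' : D i),
  [/\ x = dcl x', y = dcl y' & z = dcl z'].
Proof.
have [i [x' [y' [-> ->]]]] := dcl_sur2 x y; have [j [z' ->]] := dcl_sur z.
have [u [iu ju]] := ub2 dI i j.
by exists u, (tr iu x'), (tr iu y'), (tr ju z'); rewrite !dcl_tr.
Qed.

HB.instance Definition _ := gen_eqMixin L.
HB.instance Definition _ := gen_choiceMixin L.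

Definition dzero : L := dcl (0 : D (projT1 (cid (ub_nonempty dI)))).
Definition dopp (x : L) : L := dcl (- tagged (drepr x)).
Definition dscale (a : S) (x : L) : L := dcl (a *: tagged (drepr x)).
Definition dadd (x y : L) : L :=
  let p := drepr x in let q := drepr y in
  let u := cid (ub2 dI (tag p) (tag q)) in
  dcl (tr (projT2 u).1 (tagged p) + tr (projT2 u).2 (tagged q)).

Lemma dzeroE i : dzero = dcl (0 : D i).
Proof.
rewrite /dzero; case: cid => j _ /=; have [u [iu ju]] := ub2 dI i j.
by rewrite -(dcl_tr iu) -(dcl_tr ju) !linear0.
Qed.

Lemma drepr_rel i (x : D i) : drel (drepr (dcl x)) (Tagged (fun i => D i) x).
Proof. by apply: dclassE; rewrite dreprK. Qed.

Lemma doppE i (x : D i) : dopp (dcl x) = dcl (- x).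
Proof.
have [u [h [h' e]]] := drepr_rel x.
by rewrite /dopp -(dcl_tr h) linearN e -linearN dcl_tr.
Qed.

Lemma dscaleE a i (x : D i) : dscale a (dcl x) = dcl (a *: x).
Proof.
have [u [h [h' e]]] := drepr_rel x.
by rewrite /dscale -(dcl_tr h) linearZ e -linearZ dcl_tr.
Qed.

(** The sum is defined through chosen representatives and a chosen upper bound; pushing everything
    to one stage above all of them shows that the choices do not matter. *)
Lemma daddE i (x y : D i) : dadd (dcl x) (dcl y) = dcl (x + y).
Proof.
rewrite /dadd; case: cid => u [/= h h'].
have [v [g [g' /= e]]] := drepr_rel x; have [w [k [k' /= e']]] := drepr_rel y.
have [z1 [vz1 wz1]] := ub2 dI v w; have [z [z1z uz]] := ub2 dI z1 u.
have vz := ple_trans vz1 z1z; have wz := ple_trans wz1 z1z.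
rewrite -(dcl_tr uz) linearD (tr_comp _ _ (ple_trans g vz)).
rewrite (tr_comp _ _ (ple_trans k wz)) -(tr_comp g vz) -(tr_comp k wz) e e'.
rewrite (tr_comp _ _ (ple_trans g' vz)) (tr_comp _ _ (ple_trans g' vz)).
by rewrite -linearD dcl_tr.
Qed.

Lemma daddA : associative dadd.
Proof.
by move=> x y z; have [i [x' [y' [z' [-> -> ->]]]]] := dcl_sur3 x y z;
  rewrite !daddE addrA.
Qed.
Lemma daddC : commutative dadd.
Proof.
by move=> x y; have [i [x' [y' [-> ->]]]] := dcl_sur2 x y; rewrite !daddE addrC.
Qed.
Lemma dadd0 : left_id dzero dadd.
Proof. by move=> x; have [i [y ->]] := dcl_sur x; rewrite (dzeroE i) daddE add0r. Qed.
Lemma daddN : left_inverse dzero dopp dadd.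
Proof.
by move=> x; have [i [y ->]] := dcl_sur x; rewrite doppE (dzeroE i) daddE addNr.
Qed.
HB.instance Definition _ := GRing.isZmodule.Build L daddA daddC dadd0 daddN.

Lemma dscaleA a b x : dscale a (dscale b x) = dscale (a * b) x.
Proof. by have [i [y ->]] := dcl_sur x; rewrite !dscaleE scalerA. Qed.
Lemma dscale1 : left_id 1 dscale.
Proof. by move=> x; have [i [y ->]] := dcl_sur x; rewrite dscaleE scale1r. Qed.
Lemma dscaleDr : right_distributive dscale +%R.
Proof.
move=> a x y; have [i [x' [y' [-> ->]]]] := dcl_sur2 x y.
by rewrite -[_ + _]/(dadd _ _) -[RHS]/(dadd _ _) daddE !dscaleE daddE scalerDr.
Qed.
Lemma dscaleDl x : {morph dscale^~ x : a b / a + b}.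
Proof.
move=> a b; have [i [y ->]] := dcl_sur x.
by rewrite -[RHS]/(dadd _ _) !dscaleE daddE scalerDl.
Qed.
HB.instance Definition _ := GRing.Zmodule_isLmodule.Build S L
  dscaleA dscale1 dscaleDr dscaleDl.

Lemma dcl_linear i : linear (@dcl i).
Proof.
by move=> a x y; rewrite -[RHS]/(dadd _ _) -[a *: dcl x]/(dscale _ _) dscaleE daddE.
Qed.
HB.instance Definition _ i := GRing.isLinear.Build S (D i) L _ (@dcl i) (@dcl_linear i).

Lemma dcolim_leg_comp (i j : I) (h : @hom (poset_cat I) i j) :
  comp (c := Mod S) (@dcl j : {linear D j -> L}) (fmap D h)
  = (@dcl i : {linear D i -> L}).
Proof. by apply: linear_eq => x; exact: dcl_tr. Qed.

Definition dcolim_cocone : cocone D :=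
  @Cocone (poset_cat I) (Mod S) D (L : lmodType S)
    (fun i => (@dcl i : {linear D i -> L})) dcolim_leg_comp.

Lemma dcolim_elementwise : elementwise dcolim_cocone.
Proof.
split=> [x|i x]; first by have [i [y ->]] := dcl_sur x; exists i, y.
rewrite -(linear0 (lg dcolim_cocone i)) => /dcl_eq [l [h e]].
by exists l, h; rewrite e linear0.
Qed.

End ConstructedColimit.

Section ColimitElementwise.
Variables (I : poset) (S : pzRingType) (D : functor (poset_cat I) (Mod S)).
Hypothesis dI : aleph1_directed I.

(** The constructed colimit has the property, and the comparison map from [c] to it has a left
    inverse; this is enough to carry both halves back to [c]. *)
Lemma colimit_elementwise (c : cocone D) : is_colimit c -> elementwise c.
Proof.
move=> cC.
pose c0 := dcolim_cocone D dI.
have c0E : elementwise c0 := dcolim_elementwise D dI.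
have [f [fE _]] := cC c0.
have [g [gE _]] := ew_colimit dI c0E c.
have [e [eE eU]] := cC c.
have gf : comp g f = idm (apex c).
  rewrite -(eU (comp g f)) ?(eU (idm _)) // => i; first exact: comp_idl.
  by rewrite -compA fE gE.
have gfx x : g (f x) = x.
  exact: (congr1 (fun h : {linear apex c -> apex c} => h x) gf).
have fE' i x : f (lg c i x) = lg c0 i x.
  exact: (congr1 (fun h : {linear _ -> _} => h x) (fE i)).
split=> [x|i x xE].
  have [i [y yE]] := c0E.1 (f x); exists i, y; rewrite -[RHS]gfx -yE.
  exact: (congr1 (fun h : {linear _ -> _} => h y) (esym (gE i))).
by apply: c0E.2; rewrite -fE' xE linear0.
Qed.

End ColimitElementwise.

(** * Presentability *)

Section HomColimits.
Variables (C : category) (I : poset) (dI : aleph1_directed I).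
Variables (D : functor (poset_cat I) C) (c : cocone D) (X : C).

Lemma hom_colimit :
  (forall f : hom X (apex c), exists i (g : hom X (D i)), comp (leg c i) g = f) ->
  (forall i (f g : hom X (D i)), comp (leg c i) f = comp (leg c i) g ->
     exists j (h : @hom (poset_cat I) i j), comp (fmap D h) f = comp (fmap D h) g) ->
  is_colimit (map_cocone (hom_functor X) c).
Proof.
move=> sur inj c'.
have c'E i j (h : @hom (poset_cat I) i j) (g : hom X (D i)) :
    leg c' j (comp (fmap D h) g) = leg c' i g.
  exact: (congr1 (fun u => u g) (leg_comp c' h)).
have wd i j (f : hom X (D i)) (g : hom X (D j)) :
    comp (leg c i) f = comp (leg c j) g -> leg c' i f = leg c' j g.
  have [u [iu ju]] := ub2 dI i j.
  rewrite -(leg_comp c (iu : @hom (poset_cat I) i u)).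
  rewrite -(leg_comp c (ju : @hom (poset_cat I) j u)) -!compA.
  move=> /inj [l [h e]].
  by rewrite -(c'E _ _ iu) -(c'E _ _ ju) -(c'E _ _ h) e c'E.
have /choice [F FE] (f : hom X (apex c)) : exists t, forall i (g : hom X (D i)),
    comp (leg c i) g = f -> leg c' i g = t.
  have [i [g gf]] := sur f; exists (leg c' i g) => j g' g'f.
  by apply: wd; rewrite g'f.
exists F; split; first by move=> i; apply/funext => g /=; rewrite (FE (comp (leg c i) g) i g erefl).
move=> F' F'E; apply/funext => f; have [i [g <-]] := sur f.
by rewrite -(FE (comp (leg c i) g) i g erefl) -(F'E i).
Qed.

(** Test the colimit against [bool]: the constant [true] and the indicator of the maps that factor
    through a stage agree on all legs, hence are equal. *)
Lemma hom_colimit_sur : is_colimit (map_cocone (hom_functor X) c) ->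
  forall f : hom X (apex c), exists i (g : hom X (D i)), comp (leg c i) g = f.
Proof.
move=> cC f.
pose c' : cocone (functor_comp (hom_functor X) D) :=
  @Cocone (poset_cat I) sets (functor_comp (hom_functor X) D) bool
    (fun _ _ => true) (fun _ _ _ => erefl).
have [h [_ hU]] := cC c'.
pose im (f : hom X (apex c)) := `[< exists i (g : hom X (D i)), comp (leg c i) g = f >].
have hT : h = (fun=> true) by apply: hU.
have hI : h = im by apply: hU => i; apply/funext => g; apply/asboolP; exists i, g.
by apply/asboolP; rewrite -[asbool _]/(im f) -hI hT.
Qed.

End HomColimits.

Section CgMaps.
Variables (I : poset) (dI : aleph1_directed I) (S : pzRingType).
Variables (D : functor (poset_cat I) (Mod S)) (c : cocone D).
Hypothesis cE : elementwise c.
Variables (P : lmodType S) (Pcg : countably_generated P).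

(** Each of countably many generators is equalised at some stage; at an upper bound of these stages
    the equaliser is a submodule containing all generators. *)
Lemma cg_agree i (f g : {linear P -> D i}) :
  (forall x, lg c i (f x) = lg c i (g x)) ->
  exists j (h : ple i j), forall x, tr h (f x) = tr h (g x).
Proof.
move=> fg; have [x PE] := (countably_generatedP _).1 Pcg.
have /choice [t tP] n : exists p : {j | ple i j},
    tr (proj2_sig p) (f (x n)) = tr (proj2_sig p) (g (x n)).
  have [j [h e]] := ew_dies2 cE (fg (x n)).
  by exists (exist _ j h).
have [u uP] := ub_seq dI (fun n => sval (t n)).
have iu := ple_trans (proj2_sig (t 0)) (uP 0); exists u, iu => y.
have : gspan (range x) y by rewrite -PE.
apply: (@gspan_min _ _ _ [set y | tr iu (f y) = tr iu (g y)]) y.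
  by split=> [|a y z /= ey ez]; rewrite /= ?linear0 // !linearP ey ez.
move=> _ [n _ <-] /=.
by rewrite -(tr_comp (proj2_sig (t n)) (uP n)) tP (tr_comp _ _ iu).
Qed.

Hypothesis noethS : left_countably_noetherian S.

(* The submodule [G] generated by pairs lifting the generators is a
   multivalued lift of [f]; its ambiguity [K] is again countably generated, so
   it vanishes at a later stage, where [G] becomes the graph of a map. *)
Lemma cg_factor (f : {linear P -> apex c}) :
  exists i (g : {linear P -> D i}), forall x, lg c i (g x) = f x.
Proof.
have [x PE] := (countably_generatedP _).1 Pcg.
have /choice [t tP] n : exists p : {i : I & D i}, lg c (tag p) (tagged p) = f (x n).
  by have [i [y yE]] := cE.1 (f (x n)); exists (Tagged (fun i => D i) y).
have [u uP] := ub_seq dI (fun n => tag (t n)).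
pose y n := tr (uP n) (tagged (t n)).
pose G : set (P * D u)%type := gspan (range (fun n => (x n, y n))).
have GE p : G p -> lg c u p.2 = f p.1.
  move: p; apply: gspan_min => [|_ [n _ <-] /=]; last by rewrite lg_tr.
  by split=> [|a p q /= ep eq]; rewrite /= ?linear0 // !linearP ep eq.
have Gsur p : exists q, G (p, q).
  have : gspan (range x) p by rewrite -PE.
  apply: (@gspan_min _ _ _ [set p | exists q, G (p, q)]) p.
    split=> [|a p p' [q Gq] [q' Gq']]; first by exists 0; exact: (gspan_submodule _).1.
    by exists (a *: q + q'); exact: (gspan_submodule _).2 Gq Gq'.
  by move=> _ [n _ <-]; exists (y n); apply: sub_gspan; exists n.
pose K : set (P * D u)%type := [set p | G p /\ p.1 = 0].
have hK : is_submodule K.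
  split=> [|a p q [Gp p0] [Gq q0]]; first by split=> //; exact: (gspan_submodule _).1.
  by split; [exact: (gspan_submodule _).2 | rewrite /= p0 q0 scaler0 addr0].
have KG : K `<=` G by move=> p [].
have Gcg : countably_generated_submodule G.
  by apply: cg_gspan; exact: countable_image.
have [z KE] := (countably_generatedP _).1 (cg_submodule noethS hK KG Gcg).
have /choice [w wP] n : exists p : {j | ple u j}, tr (proj2_sig p) (z n).2 = 0.
  have /GE : G (z n) by apply: KG; rewrite KE; apply: sub_gspan; exists n.
  have -> : (z n).1 = 0.
    by have [] : K (z n) by rewrite KE; apply: sub_gspan; exists n.
  by rewrite linear0 => /cE.2 [j [h e]]; exists (exist _ j h).
have [v vP] := ub_seq dI (fun n => sval (w n)).
have uv := ple_trans (proj2_sig (w 0)) (vP 0).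
have K0 p : K p -> tr uv p.2 = 0.
  rewrite KE; apply: (@gspan_min _ _ _ [set p | tr uv p.2 = 0]) p.
    by split=> [|a p q /= ep eq]; rewrite /= ?linear0 // linearP ep eq scaler0 addr0.
  move=> _ [n _ <-] /=; rewrite -(tr_comp (proj2_sig (w n)) (vP n)) wP.
  exact: linear0.
have /choice [g0 g0P] p : exists q, forall q', G (p, q') -> tr uv q' = q.
  have [q Gq] := Gsur p; exists (tr uv q) => q' Gq'.
  apply/eqP; rewrite -subr_eq0 -linearB; apply/eqP.
  apply: (K0 (p - p, q' - q)); split; last by rewrite /= subrr.
  exact: (submodB (gspan_submodule _) Gq' Gq).
have g0L : linear g0.
  move=> a p p'; have [q Gq] := Gsur p; have [q' Gq'] := Gsur p'.
  rewrite -(g0P _ _ Gq) -(g0P _ _ Gq') -linearP; apply/esym/g0P.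
  exact: (gspan_submodule _).2 Gq Gq'.
have [g gE] := linear_ex g0L; exists v, g => p.
by have [q Gq] := Gsur p; rewrite gE -(g0P _ _ Gq) lg_tr (GE _ Gq).
Qed.

End CgMaps.

Lemma cg_presentable (S : pzRingType) (P : Mod S) :
  left_countably_noetherian S -> countably_generated P -> aleph1_presentable P.
Proof.
move=> noethS Pcg I D c dI /(colimit_elementwise dI) cE.
apply: (hom_colimit dI) => [f|i f g e].
  have [i [g gE]] := cg_factor dI cE Pcg noethS f.
  by exists i, g; apply: linear_eq => x; exact: gE.
have [|j [h hE]] := cg_agree dI cE Pcg (i := i) (f := f) (g := g).
  by move=> x; exact: (congr1 (fun u : {linear _ -> _} => u x) e).
by exists j, h; apply: linear_eq => x; exact: hE.
Qed.

(** * Tensor products of directed systems *)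

Section TensorSystems.
Variables (k : comPzRingType) (R : kalgebra k).
Local Notation S := (env R).

Section BtmapLinear.
Variables (C D C' D' : lmodType S) (f : {linear C -> C'}) (g : {linear D -> D'}).

(** Scalars and tensors are sums of pure ones, so the claim reduces to compatibility with the left
    and right actions of [R]. *)
Lemma btmap_linear : linear (btmap f g).
Proof.
move=> a x y; rewrite btmapD; congr (_ + _).
elim/env_ind: a => [|a b IHa IHb|a b]; first by rewrite !scale0r btmap0.
  by rewrite !scalerDl btmapD IHa IHb.
elim/btens_ind: x => [|x x' IHx IHx'|m n]; first by rewrite !scaler0 btmap0 scaler0.
  by rewrite scalerDr !btmapD scalerDr IHx IHx'.
by rewrite epure_bpure !btmap_pure lact_linear ract_linear epure_bpure.
Qed.
HB.instance Definition _ :=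
  GRing.isLinear.Build S (btens C D) (btens C' D') _ (btmap f g) btmap_linear.

End BtmapLinear.

Lemma btmap_ext (C D C' D' : lmodType S) (f f' : {linear C -> C'})
    (g g' : {linear D -> D'}) : f =1 f' -> g =1 g' -> btmap f g =1 btmap f' g'.
Proof. by move=> /linear_eq -> /linear_eq ->. Qed.

(** Functoriality with the composites known only pointwise, so that bundled linear maps need not
    match syntactically. *)
Lemma btmapM (C D C' D' C'' D'' : lmodType S)
    (f : {linear C' -> C''}) (g : {linear D' -> D''})
    (f' : {linear C -> C'}) (g' : {linear D -> D'})
    (h : {linear C -> C''}) (h' : {linear D -> D''}) (x : btens C D) :
  (forall c, f (f' c) = h c) -> (forall d, g (g' d) = h' d) ->
  btmap f g (btmap f' g' x) = btmap h h' x.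
Proof.
by move=> e e'; rewrite -btmap_comp; apply: btmap_ext => z /=.
Qed.

Variable I : poset.
Variables (D E : functor (poset_cat I) (Mod S)).

Program Definition tens_system : functor (poset_cat I) (Mod S) :=
  @Functor (poset_cat I) (Mod S) (fun i => btens (D i) (E i) : lmodType S)
    (fun i j h => btmap (fmap D h) (fmap E h) : {linear _ -> _}) _ _.
Next Obligation.
by apply: linear_eq => x /=; rewrite !fmap_id -[RHS]btmap_id; apply: btmap_ext.
Qed.
Next Obligation.
by apply: linear_eq => x /=; rewrite !fmap_comp -btmap_comp; apply: btmap_ext.
Qed.

Variables (c : cocone D) (c' : cocone E).

Program Definition tens_cocone : cocone tens_system :=
  @Cocone (poset_cat I) (Mod S) tens_system (btens (apex c) (apex c') : lmodType S)
    (fun i => btmap (leg c i) (leg c' i) : {linear _ -> _}) _.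
Next Obligation.
apply: linear_eq => x /=; rewrite -btmap_comp.
apply: btmap_ext => y.
  exact: (congr1 (fun u : {linear _ -> _} => u y) (@leg_comp _ _ _ c i j f)).
exact: (congr1 (fun u : {linear _ -> _} => u y) (@leg_comp _ _ _ c' i j f)).
Qed.

Lemma tr_tens i j (h : ple i j) x : @tr _ _ tens_system i j h x = btmap (tr h) (tr h) x.
Proof. by []. Qed.
Lemma lg_tens i x : lg tens_cocone i x = btmap (lg c i) (lg c' i) x.
Proof. by []. Qed.

Hypothesis dI : aleph1_directed I.
Hypotheses (cE : elementwise c) (c'E : elementwise c').

Lemma ew_lift_pair x y : exists i (x' : D i) (y' : E i), lg c i x' = x /\ lg c' i y' = y.
Proof.
have [i [x' <-]] := cE.1 x; have [j [y' <-]] := c'E.1 y.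
have [u [iu ju]] := ub2 dI i j.
by exists u, (tr iu x'), (tr ju y'); rewrite !lg_tr.
Qed.

(* An inverse of the comparison map from the colimit of the tensor products,
   defined on pure tensors by choosing lifts. *)
Lemma tens_elementwise : elementwise tens_cocone.
Proof.
split=> [|i x x0].
  elim/btens_ind => [|x y|x y].
  - have [i _] := ub_nonempty dI; exists i, 0; exact: linear0.
  - move=> [i [x' <-]] [j [y' <-]]; have [u [iu ju]] := ub2 dI i j.
    exists u, (tr iu x' + tr ju y').
    by rewrite linearD !lg_tr.
  - have [i [x' [y' [<- <-]]]] := ew_lift_pair x y; exists i, (bpure x' y').
    by rewrite lg_tens btmap_pure.
pose c0 := dcolim_cocone tens_system dI.
have c0E : elementwise c0 := dcolim_elementwise tens_system dI.
have /choice [b0 b0E] (p : apex c * apex c') : exists t, forall i (x : D i) (y : E i),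
    lg c i x = p.1 -> lg c' i y = p.2 -> lg c0 i (bpure x y) = t.
  have [i0 [x0' [y0' [e1 e2]]]] := ew_lift_pair p.1 p.2.
  exists (lg c0 i0 (bpure x0' y0')) => j x' y'; rewrite -e1 -e2.
  move=> /(ew_eq dI cE) [l1 [h1 [h1' e1']]] /(ew_eq dI c'E) [l2 [h2 [h2' e2']]].
  have [u [l1u l2u]] := ub2 dI l1 l2.
  have ex : tr (ple_trans h1 l1u) x' = tr (ple_trans h1' l1u) x0'.
    by rewrite -(tr_comp h1 l1u) -(tr_comp h1' l1u) e1'.
  have ey : tr (ple_trans h1 l1u) y' = tr (ple_trans h1' l1u) y0'.
    rewrite (tr_irr _ (ple_trans h2 l2u)) (tr_irr _ (ple_trans h2' l2u)).
    by rewrite -(tr_comp h2 l2u) -(tr_comp h2' l2u) e2'.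
  rewrite -(lg_tr c0 (ple_trans h1 l1u)) -(lg_tr c0 (ple_trans h1' l1u)).
  by rewrite !tr_tens !btmap_pure ex ey.
pose b x y := b0 (x, y).
have bE j (x' : D j) (y' : E j) : b (lg c j x') (lg c' j y') = lg c0 j (bpure x' y').
  by rewrite /b -(b0E (_, _) j x' y').
have bal : balanced (@ract _ R (apex c)) (@lact _ R (apex c')) b.
  split=> [m m' n|m n n'|m r n].
  - have [j [x1 [y1 [<- <-]]]] := ew_lift_pair m n; have [l [x2 <-]] := cE.1 m'.
    have [u [ju lu]] := ub2 dI j l.
    rewrite -(lg_tr c ju) -(lg_tr c lu) -(lg_tr c' ju) -linearD !bE.
    by rewrite bpureDl linearD.
  - have [j [x1 [y1 [<- <-]]]] := ew_lift_pair m n; have [l [y2 <-]] := c'E.1 n'.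
    have [u [ju lu]] := ub2 dI j l.
    rewrite -(lg_tr c ju) -(lg_tr c' lu) -(lg_tr c' ju) -linearD !bE.
    by rewrite bpureDr linearD.
  - have [j [x1 [y1 [<- <-]]]] := ew_lift_pair m n.
    by rewrite -ract_linear -lact_linear !bE bpure_bal.
have inv j (t : btens (D j) (E j)) : tlift b (btmap (lg c j) (lg c' j) t) = lg c0 j t.
  elim/btens_ind: t => [|t t' IHt IHt'|m n].
  - by rewrite btmap0 (tlift0 bal) linear0.
  - by rewrite btmapD (tliftD bal) IHt IHt' linearD.
  - by rewrite btmap_pure (tlift_pure bal) bE.
by apply: c0E.2; rewrite -inv -lg_tens x0 (tlift0 bal).
Qed.

End TensorSystems.

(** * The equational criterion of flatness *)

Section PureTensors.
Variables (N M : zmodType) (A : Type) (ra : N -> A -> N) (la : A -> M -> M).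

Lemma tpure0l m : tpure ra la 0 m = 0.
Proof. by apply: (addrI (tpure ra la 0 m)); rewrite -tpureDl !addr0. Qed.
Lemma tpure0r n : tpure ra la n 0 = 0.
Proof. by apply: (addrI (tpure ra la n 0)); rewrite -tpureDr !addr0. Qed.

End PureTensors.

Section Lincomb.
Variables (S : pzRingType) (M : lmodType S).

Definition lincomb r (v : 'rV[S]_r) (m : 'I_r -> M) : M := \sum_(j < r) v 0 j *: m j.

Lemma lincombP r (m : 'I_r -> M) a v w :
  lincomb (a *: v + w) m = a *: lincomb v m + lincomb w m.
Proof.
rewrite /lincomb scaler_sumr -big_split; apply: eq_bigr => j _.
by rewrite !mxE scalerDl scalerA.
Qed.

Lemma lincomb0 r (m : 'I_r -> M) : lincomb 0 m = 0.
Proof. by rewrite /lincomb big1 // => j _; rewrite mxE scale0r. Qed.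

Lemma lincombB r (m : 'I_r -> M) v w : lincomb (v - w) m = lincomb v m - lincomb w m.
Proof. by rewrite [v - w]addrC [RHS]addrC -!scaleN1r lincombP. Qed.

Lemma lincomb_delta r (m : 'I_r -> M) i : lincomb (delta_mx 0 i) m = m i.
Proof.
rewrite /lincomb (bigD1 i) //= big1 ?addr0 => [|j ji]; first by rewrite mxE !eqxx scale1r.
by rewrite mxE eqxx (negPf ji) scale0r.
Qed.

Lemma lincomb_mul r r' (m : 'I_r -> M) (B : 'M[S]_(r, r')) y :
  (forall i, m i = lincomb (row i B) y) ->
  forall v, lincomb v m = lincomb (v *m B) y.
Proof.
move=> mE v; rewrite /lincomb; under eq_bigr => i _ do rewrite mE scaler_sumr.
rewrite exchange_big; apply: eq_bigr => j _ /=.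
by rewrite !mxE scaler_suml; apply: eq_bigr => i _; rewrite mxE scalerA.
Qed.

Definition join_fun r r' (m : 'I_r -> M) (m' : 'I_r' -> M) (i : 'I_(r + r')) : M :=
  match split i with inl j => m j | inr j => m' j end.

Lemma lincomb_row r r' (m : 'I_r -> M) (m' : 'I_r' -> M) v v' :
  lincomb (row_mx v v') (join_fun m m') = lincomb v m + lincomb v' m'.
Proof.
rewrite /lincomb big_split_ord /=; congr (_ + _); apply: eq_bigr => i _.
  by rewrite row_mxEl /join_fun (unsplitK (inl i)).
by rewrite row_mxEr /join_fun (unsplitK (inr i)).
Qed.

(** Vectors of coefficients are rows: right multiplication by [B] is a map of free left modules that
    kills [a] and through which the map given by [m] factors. *)
Definition eqflat : Prop := forall r (a : 'rV[S]_r) (m : 'I_r -> M),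
  lincomb a m = 0 -> exists r' (B : 'M[S]_(r, r')) (y : 'I_r' -> M),
    (forall i, m i = lincomb (row i B) y) /\ a *m B = 0.

Hypothesis flatM : eqflat.

(** Relations are killed one at a time. Each step replaces the generators, so the induction is over
    an arbitrary matrix [A] that accumulates the changes made so far. *)
Lemma eqflat_seq r (L : seq 'rV[S]_r) (m : 'I_r -> M) :
  (forall v, v \in L -> lincomb v m = 0) ->
  exists r' (B : 'M[S]_(r, r')) (y : 'I_r' -> M),
    (forall i, m i = lincomb (row i B) y) /\ forall v, v \in L -> v *m B = 0.
Proof.
have key r1 (A : 'M[S]_(r, r1)) (m1 : 'I_r1 -> M) :
    (forall v, v \in L -> lincomb (v *m A) m1 = 0) ->
    exists r' (B : 'M[S]_(r1, r')) (y : 'I_r' -> M),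
      (forall i, m1 i = lincomb (row i B) y) /\ forall v, v \in L -> v *m A *m B = 0.
  elim: L r1 A m1 => [|v L IHL] r1 A m1 Lm.
    exists r1, 1%:M, m1; split=> // i; rewrite -[LHS]lincomb_delta; congr lincomb.
    by rewrite rowE mulmx1.
  have [|r2 [B [y [mE vB]]]] := flatM (a := v *m A) (m := m1).
    by apply: Lm; rewrite mem_head.
  have [|r3 [C [z [yE LC]]]] := IHL r2 (A *m B) y.
    move=> w wL; rewrite mulmxA -(lincomb_mul mE); apply: Lm.
    by rewrite in_cons wL orbT.
  exists r3, (B *m C), z; split=> [i|w].
    by rewrite mE (lincomb_mul yE) -row_mul.
  rewrite in_cons => /orP [/eqP ->|wL]; first by rewrite mulmxA vB mul0mx.
  by rewrite mulmxA -[_ *m A *m B]mulmxA LC.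
move=> Lm; have [|r' [B [y [mE LB]]]] := key r 1%:M m.
  by move=> v; rewrite mulmx1; apply: Lm.
by exists r', B, y; split=> // v /LB; rewrite mulmx1.
Qed.

(** Coordinates in a finite free module for the members of [L]. As [w] is a function on [M],
    repeated entries of [L] receive the same coordinates. *)
Definition lifts r (z : 'I_r -> M) (w : M -> 'rV[S]_r) (L : seq M) : Prop :=
  forall m, m \in L -> lincomb (w m) z = m.

Lemma lifts_ex (L : seq M) : exists r (z : 'I_r -> M) w, lifts z w L.
Proof.
exists (size L), (fun i => L`_i).
(* The value [0] is taken only outside [L], where nothing is required. *)
exists (fun m => if insub (index m L) is Some i then delta_mx 0 i else 0) => m mL.
by rewrite insubT ?index_mem // => h; rewrite lincomb_delta /= nth_index.
Qed.

Lemma lifts_kill r (z : 'I_r -> M) w (L : seq M) (K : seq 'rV[S]_r) :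
  lifts z w L -> (forall v, v \in K -> lincomb v z = 0) ->
  exists r' (B : 'M[S]_(r, r')) (z' : 'I_r' -> M),
    lifts z' (fun m => w m *m B) L /\ forall v, v \in K -> v *m B = 0.
Proof.
move=> zL /eqflat_seq [r' [B [z' [zE KB]]]]; exists r', B, z'; split=> // m mL.
by rewrite -(lincomb_mul zE) zL.
Qed.

(** An element common to both lists has two coordinate vectors, and their difference is a relation
    among the joined generators. Killing these finitely many relations makes the two systems of
    coordinates agree. *)
Lemma lifts_merge r1 r2 (z1 : 'I_r1 -> M) (z2 : 'I_r2 -> M) w1 w2 (L1 L2 : seq M) :
  lifts z1 w1 L1 -> lifts z2 w2 L2 ->
  exists r (z : 'I_r -> M) w (A1 : 'M[S]_(r1, r)) (A2 : 'M[S]_(r2, r)),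
    [/\ lifts z w (L1 ++ L2), forall m, m \in L1 -> w m = w1 m *m A1
      & forall m, m \in L2 -> w m = w2 m *m A2].
Proof.
move=> z1L z2L.
pose K := [seq row_mx (w1 m) (- w2 m) | m <- L1 & m \in L2].
have [|r [B [z [zE KB]]]] := @eqflat_seq _ K (join_fun z1 z2).
  move=> v /mapP [m]; rewrite mem_filter => /andP [m2 m1] ->.
  by rewrite lincomb_row -[- w2 m]add0r lincombB lincomb0 z1L // z2L // sub0r subrr.
have BE m : m \in L1 -> m \in L2 -> w1 m *m usubmx B = w2 m *m dsubmx B.
  move=> m1 m2; apply/eqP; rewrite -subr_eq0; apply/eqP.
  rewrite -mulNmx -mul_row_col vsubmxK; apply: KB; apply/mapP.
  by exists m => //; rewrite mem_filter m2.
exists r, z, (fun m => if m \in L1 then w1 m *m usubmx B else w2 m *m dsubmx B).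
exists (usubmx B), (dsubmx B); split=> [m|m ->//|m m2]; last first.
  by case: ifP => // m1; apply: BE.
have e1 : m \in L1 -> lincomb (w1 m *m usubmx B) z = m.
  move=> m1; rewrite -[RHS](z1L m m1) -[RHS]addr0 -[in RHS](lincomb0 z2) -lincomb_row.
  by rewrite (lincomb_mul zE) -[in RHS](vsubmxK B) mul_row_col mul0mx addr0.
have e2 : m \in L2 -> lincomb (w2 m *m dsubmx B) z = m.
  move=> m2; rewrite -[RHS](z2L m m2) -[RHS]add0r -[in RHS](lincomb0 z1) -lincomb_row.
  by rewrite (lincomb_mul zE) -[in RHS](vsubmxK B) mul_row_col mul0mx add0r.
by rewrite mem_cat; case: ifP => [/e1 //|_ /= /e2].
Qed.

Section RightModule.
Variable N : lmodType S^c.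

Lemma rmod_actA (n : N) a b : rmod_act n (a * b) = rmod_act (rmod_act n a) b.
Proof. by rewrite /rmod_act scalerA. Qed.
Lemma rmod_actDl (n n' : N) a : rmod_act (n + n') a = rmod_act n a + rmod_act n' a.
Proof. exact: scalerDr. Qed.
Lemma rmod_actDr (n : N) a b : rmod_act n (a + b) = rmod_act n a + rmod_act n b.
Proof. exact: (@scalerDl S^c N). Qed.
Lemma rmod_act0l a : rmod_act (0 : N) a = 0.
Proof. exact: scaler0. Qed.
Lemma rmod_act_suml I (s : seq I) (F : I -> N) a :
  rmod_act (\sum_(i <- s) F i) a = \sum_(i <- s) rmod_act (F i) a.
Proof. exact: scaler_sumr. Qed.
Lemma rmod_act_sumr I (s : seq I) n (F : I -> S) :
  rmod_act (n : N) (\sum_(i <- s) F i) = \sum_(i <- s) rmod_act n (F i).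
Proof. exact: (@scaler_suml S^c N). Qed.

(** The coefficient of the [j]-th generator once every second component is expanded in the
    coordinates [w]. *)
Definition rsum r (w : M -> 'rV[S]_r) (s : seq (N * M)) j : N :=
  \sum_(p <- s) rmod_act p.1 (w p.2 0 j).

Lemma rsum_mul r r' (w : M -> 'rV[S]_r) (w' : M -> 'rV[S]_r') (A : 'M[S]_(r, r')) s j :
  (forall m, m \in unzip2 s -> w' m = w m *m A) ->
  rsum w' s j = \sum_(i < r) rmod_act (rsum w s i) (A i j).
Proof.
move=> wE; rewrite /rsum; under [RHS]eq_bigr do rewrite rmod_act_suml.
rewrite exchange_big /= big_seq [RHS]big_seq; apply: eq_bigr => p ps.
rewrite wE ?map_f // mxE rmod_act_sumr.
by apply: eq_bigr => i _; rewrite rmod_actA.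
Qed.

(** Under the equational criterion, an equality of tensors is already visible in the tensor product
    of [N] with a finite free module, which is a power of [N]. The proof is by induction on the
    congruence; transitivity and concatenation need coordinates compatible with both derivations,
    which [lifts_merge] supplies. *)
Lemma tens_eqv_lifts (s t : seq (N * M)) :
  tens_eqv (@rmod_act S N) (@lmod_act S M) s t ->
  exists r (z : 'I_r -> M) w,
    lifts z w (unzip2 s ++ unzip2 t) /\ forall j, rsum w s j = rsum w t j.
Proof.
elim=> {s t}.
- move=> s; have [r [z [w zw]]] := lifts_ex (unzip2 s ++ unzip2 s).
  by exists r, z, w.
- move=> s t _ [r [z [w [zw e]]]]; exists r, z, w; split=> // m.
  by rewrite mem_cat orbC -mem_cat; apply: zw.
- move=> s t u _ [r1 [z1 [w1 [zw1 e1]]]] _ [r2 [z2 [w2 [zw2 e2]]]].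
  have [r [z [w [A1 [A2 [zw wE1 wE2]]]]]] := lifts_merge zw1 zw2.
  exists r, z, w; split=> [m|j].
    by move=> h; apply: zw; move: h; rewrite !mem_cat => /orP [->|->]; rewrite ?orbT.
  have wsE1 x : x \in unzip2 s -> w x = w1 x *m A1.
    by move=> xs; apply: wE1; rewrite mem_cat xs.
  have wtE1 x : x \in unzip2 t -> w x = w1 x *m A1.
    by move=> xs; apply: wE1; rewrite mem_cat xs orbT.
  have wtE2 x : x \in unzip2 t -> w x = w2 x *m A2.
    by move=> xs; apply: wE2; rewrite mem_cat xs.
  have wuE2 x : x \in unzip2 u -> w x = w2 x *m A2.
    by move=> xs; apply: wE2; rewrite mem_cat xs orbT.
  transitivity (rsum w t j).
    by rewrite (rsum_mul _ wsE1) (rsum_mul _ wtE1); under eq_bigr do rewrite e1.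
  by rewrite (rsum_mul _ wtE2) (rsum_mul _ wuE2); under eq_bigr do rewrite e2.
- move=> s s' t t' _ [r1 [z1 [w1 [zw1 e1]]]] _ [r2 [z2 [w2 [zw2 e2]]]].
  have [r [z [w [A1 [A2 [zw wE1 wE2]]]]]] := lifts_merge zw1 zw2.
  exists r, z, w; split=> [m|j].
    move=> h; apply: zw; move: h; rewrite /unzip2 !map_cat !mem_cat.
    by move=> /orP [] /orP [] ->; rewrite ?orbT.
  rewrite /rsum !big_cat -!/(rsum _ _ _) /=; congr (_ + _).
    rewrite (@rsum_mul _ _ w1 w A1) 1?(@rsum_mul _ _ w1 w A1) => [|m ms|m ms].
    + by under eq_bigr do rewrite e1.
    + by apply: wE1; rewrite mem_cat ms orbT.
    + by apply: wE1; rewrite mem_cat ms.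
  rewrite (@rsum_mul _ _ w2 w A2) 1?(@rsum_mul _ _ w2 w A2) => [|m ms|m ms].
  + by under eq_bigr do rewrite e2.
  + by apply: wE2; rewrite mem_cat ms orbT.
  + by apply: wE2; rewrite mem_cat ms.
- move=> s t; have [r [z [w zw]]] := lifts_ex (unzip2 (s ++ t) ++ unzip2 (t ++ s)).
  by exists r, z, w; split=> // j; rewrite /rsum !big_cat /= addrC.
- move=> n; have [r [z [w zw]]] := lifts_ex ([:: n] ++ [::]).
  by exists r, z, w; split=> // j; rewrite /rsum big_seq1 big_nil rmod_act0l.
- move=> m m' n; have [r [z [w zw]]] := lifts_ex ([:: n] ++ [:: n; n]).
  exists r, z, w; split=> // j.
  by rewrite /rsum !big_cons !big_nil /= !addr0 rmod_actDl.
- move=> m n n'; have [r [z [w zw]]] := lifts_ex ([:: n + n'] ++ [:: n; n']).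
  (* The chosen coordinates need not be additive; the defect is a relation among the generators and
     is killed by new generators. *)
  have [|r' [B [z' [zw' KB]]]] := lifts_kill zw (K := [:: w (n + n') - (w n + w n')]).
    move=> v; rewrite inE => /eqP ->.
    rewrite lincombB -[w n]scale1r lincombP scale1r !zw ?subrr // !inE eqxx ?orbT //.
  exists r', z', (fun m => w m *m B); split=> // j.
  have /eqP := KB _ (mem_head _ _); rewrite mulmxBl subr_eq0 mulmxDl => /eqP e.
  by rewrite /rsum !big_cons !big_nil !addr0 /= e mxE rmod_actDr.
- move=> m a n; have [r [z [w zw]]] := lifts_ex ([:: n] ++ [:: a *: n]).
  have [|r' [B [z' [zw' KB]]]] := lifts_kill zw (K := [:: w (a *: n) - a *: w n]).
    move=> v; rewrite inE => /eqP ->.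
    rewrite lincombB -[a *: w n]addr0 lincombP lincomb0 addr0 !zw ?subrr //.
      by rewrite !inE eqxx.
    by rewrite !inE eqxx orbT.
  exists r', z', (fun m => w m *m B); split=> // j.
  have /eqP := KB _ (mem_head _ _); rewrite mulmxBl subr_eq0 -scalemxAl => /eqP e.
  by rewrite /rsum !big_cons !big_nil !addr0 /= /lmod_act e [fun_of_matrix (a *: _) 0 j]mxE rmod_actA.
Qed.

End RightModule.

(** An equality after applying [f] is witnessed by the coordinates in a power of [N'], where
    injectivity of [f] can be used coordinate by coordinate. *)
Lemma eqflat_flat : flat M.
Proof.
move=> N N' f fI x y.
rewrite -[x]reprK -[y]reprK -!/(tpi _ _ _).
set s := repr x; set t := repr y.
pose fm (q : seq (N * M)) := [seq (f p.1, p.2) | p <- q].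
have bal : balanced (@rmod_act S N) (@lmod_act S M)
    (fun m n => tpure (@rmod_act S N') (@lmod_act S M) (f m) (id n)).
  split=> [m m' n|m n n'|m a n]; first by rewrite linearD tpureDl.
    by rewrite tpureDr.
  by rewrite /rmod_act linearZ [LHS]tpure_bal.
have fmE q : tmap (@rmod_act S N) (@lmod_act S M) (@rmod_act S N') (@lmod_act S M) f id
    (tpi _ _ q) = tpi _ _ (fm q).
  by rewrite /tmap (tlift_pi bal) tpi_sum big_map.
rewrite !fmE => /tpiE /tens_eqv_lifts [r [z [w [zw e]]]].
have sumE q : (forall m, m \in unzip2 q -> lincomb (w m) z = m) ->
    tpi (@rmod_act S N) (@lmod_act S M) q
    = \sum_(j < r) tpure (@rmod_act S N) (@lmod_act S M) (rsum w q j) (z j).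
  move=> qE; rewrite tpi_sum.
  transitivity (\sum_(p <- q) \sum_(j < r)
      tpure (@rmod_act S N) (@lmod_act S M) (rmod_act p.1 (w p.2 0 j)) (z j)).
    rewrite big_seq [RHS]big_seq; apply: eq_bigr => p pq.
    rewrite -{1}[p.2](qE p.2) ?map_f // /lincomb.
    rewrite (big_morph _ (tpureDr _ _ p.1) (tpure0r _ _ p.1)); apply: eq_bigr => j _.
    by rewrite [RHS]tpure_bal.
  rewrite exchange_big; apply: eq_bigr => j _ /=.
  by rewrite /rsum (big_morph (fun n => tpure _ _ n (z j)) (fun _ _ => tpureDl _ _ _ _ _)
    (tpure0l _ _ (z j))).
have rsumE q j : rsum w (fm q) j = f (rsum w q j).
  by rewrite /rsum big_map linear_sum; apply: eq_bigr => p _; rewrite /rmod_act linearZ.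
have fmz q : unzip2 (fm q) = unzip2 q by rewrite /unzip2 -map_comp.
rewrite !sumE.
- by apply: eq_bigr => j _; congr (tpure _ _ _ _); apply: fI; rewrite -!rsumE e.
- by move=> m mt; apply: zw; rewrite !fmz mem_cat mt orbT.
- by move=> m mt; apply: zw; rewrite !fmz mem_cat mt.
Qed.

End Lincomb.

(* The relation [a m = 0] lives in the right ideal [N = a S^r]: flatness makes
   [sum a_i (x) m_i] vanish already in [N (x) M], and [c : N -> S^r] is a section
   of the covering [S^r -> N], additive only modulo its kernel. *)
Lemma flat_eqflat (S : pzRingType) (M : lmodType S) : flat M -> eqflat M.
Proof.
move=> flatM r a m am.
pose N0 : set (S^c)^o := [set x | exists c : 'cV[S]_r, x = (a *m c) 0 0].
have mulS (A : 'cV[S]_r) b : a *m (A *m b%:M) = (a *m A) *m b%:M by rewrite mulmxA.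
have scalE n (A : 'M[S]_(n, 1)) b i : (A *m b%:M) i 0 = A i 0 * b.
  by rewrite mxE big_ord1 mxE eqxx.
have hN : is_submodule N0.
  split; first by exists 0; rewrite mulmx0 mxE.
  move=> b _ _ [c ->] [c' ->]; exists (c *m b%:M + c').
  by rewrite mulmxDr mulS [RHS]mxE scalE.
have subE n (A B : 'M[S]_(n, 1)) i : (A - B) i 0 = A i 0 - B i 0 by rewrite !mxE.
pose N : lmodType S^c := sub_lmod hN.
pose v : {linear N -> (S^c)^o} := @sub_val _ _ _ hN.
have /choice [c cE] (n : N) : exists c : 'cV[S]_r, v n = (a *m c) 0 0.
  exact: (sub_valP n).
have ker1 (k : 'cV[S]_r) : (a *m k) 0 0 = 0 -> a *m k = 0.
  by move=> k0; apply/matrixP => i j; rewrite !ord1 k0 mxE.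
have ne i : N0 (a 0 i).
  exists (delta_mx i 0); rewrite mxE (bigD1 i) //= big1 => [|j ji].
    by rewrite mxE !eqxx mulr1 addr0.
  by rewrite mxE (negPf ji) mulr0.
pose n i : N := sub_mk hN (ne i).
pose s := [seq (n i, m i) | i <- enum 'I_r].
have s0 : tpi (@rmod_act S N) (@lmod_act S M) s = tpi _ _ [::].
  apply: (flatM _ _ v (@sub_val_inj _ _ _ hN)).
  have bal : balanced (@rmod_act S N) (@lmod_act S M)
      (fun m n => tpure (@rmod_act S (S^c)^o) (@lmod_act S M) (v m) (id n)).
    split=> [x x' y|x y y'|x b y]; first by rewrite linearD tpureDl.
      by rewrite tpureDr.
    by rewrite /rmod_act linearZ [LHS]tpure_bal.
  rewrite /tmap !(tlift_pi bal) big_nil big_map big_enum /=.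
  transitivity (tpure (@rmod_act S (S^c)^o) (@lmod_act S M) 1 (lincomb a m)).
    rewrite /lincomb (big_morph _ (tpureDr _ _ (1 : (S^c)^o)) (tpure0r _ _ _)); apply: eq_bigr => i _.
    rewrite -[RHS]tpure_bal; congr (tpure _ _ _ _).
    by rewrite /rmod_act [RHS](mul1r (a 0 i : S)).
  by rewrite am tpure0r.
(* The tuples expressible with coefficient columns in the kernel of [a]; the goal is that [m] is one
   of them. *)
pose KM (u : 'I_r -> M) := exists r' (B : 'M[S]_(r, r')) (y : 'I_r' -> M),
  (forall i, u i = lincomb (row i B) y) /\ a *m B = 0.
have KMD u u' : KM u -> KM u' -> KM (fun i => u i + u' i).
  move=> [q [B [y [uE aB]]]] [q' [B' [y' [uE' aB']]]].
  exists (q + q')%N, (row_mx B B'), (join_fun y y'); split=> [i|].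
    by rewrite row_row_mx lincomb_row uE uE'.
  by rewrite mul_mx_row aB aB' row_mx0.
have KMN u : KM u -> KM (fun i => - u i).
  move=> [q [B [y [uE aB]]]]; exists q, (- B), y; split=> [i|].
    by rewrite uE [row i (- B)]linearN -[- row i B]sub0r lincombB lincomb0 sub0r.
  by rewrite mulmxN aB oppr0.
have KM1 (k : 'cV[S]_r) (y : M) : (a *m k) 0 0 = 0 -> KM (fun i => k i 0 *: y).
  move=> /ker1 ak; exists 1%N, k, (fun=> y); split=> // i.
  by rewrite /lincomb big_ord1 mxE.
have KM0 : KM (fun=> 0) by exists 0%N, 0, (fun=> 0); split=> [i|]; rewrite ?mulmx0 // /lincomb big_ord0.
have KME u u' : KM u -> u =1 u' -> KM u' by move=> Ku /funext <-.
pose V (s : seq (N * M)) i := \sum_(p <- s) c p.1 i 0 *: p.2.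
have Vcat t t' i : V (t ++ t') i = V t i + V t' i by rewrite /V big_cat.
have key t t' : tens_eqv (@rmod_act S N) (@lmod_act S M) t t' -> KM (fun i => V t i - V t' i).
  elim=> {t t'}.
  - by move=> t; apply: (KME _ _ KM0) => i; rewrite subrr.
  - by move=> t t' _ /KMN h; apply: (KME _ _ h) => i; rewrite opprB.
  - move=> t u w _ h _ h'; apply: (KME _ _ (KMD _ _ h h')) => i.
    by rewrite addrA subrK.
  - move=> t t' u u' _ h _ h'; apply: (KME _ _ (KMD _ _ h h')) => i.
    by rewrite !Vcat opprD addrACA.
  - by move=> t u; apply: (KME _ _ KM0) => i; rewrite !Vcat [V u i + _]addrC subrr.
  - move=> y; have h : (a *m c 0) 0 0 = 0 by rewrite -cE linear0.
    by apply: (KME _ _ (KM1 _ y h)) => i; rewrite /V big_seq1 big_nil subr0.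
  - move=> x x' y; have h : (a *m (c (x + x') - c x - c x')) 0 0 = 0.
      by rewrite !mulmxBr !subE -!cE linearD addrAC addrK subrr.
    apply: (KME _ _ (KM1 _ y h)) => i; rewrite /V !big_cons !big_nil !addr0 /=.
    by rewrite !subE !scalerBl opprD addrA.
  - move=> x y y'; apply: (KME _ _ KM0) => i; rewrite /V !big_cons !big_nil !addr0 /=.
    by rewrite scalerDr subrr.
  - move=> x b y; have h : (a *m (c (rmod_act x b) - c x *m b%:M)) 0 0 = 0.
      rewrite mulmxBr mulS subE scalE -!cE /rmod_act linearZ.
      exact: subrr.
    apply: (KME _ _ (KM1 _ y h)) => i; rewrite /V !big_seq1 /=.
    by rewrite subE scalE scalerBl scalerA.
have Vs : KM (V s).
  by apply: (KME _ _ (key _ _ (tpiE s0))) => i; rewrite /V big_nil subr0.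
(* Column [l] of the matrix is the difference of two preimages of [a 0 l], namely [c (n l)] and the
   [l]-th unit vector, so [a] kills it. *)
have Vm : KM (fun i => V s i - m i).
  exists r, (\matrix_(i, l) (c (n l) i 0 - (i == l)%:R)), m; split=> [i|].
    rewrite -[m i]lincomb_delta /V big_map big_enum /= /lincomb -sumrB.
    by apply: eq_bigr => l _; rewrite !mxE scalerBl [i == l]eq_sym.
  apply/matrixP => i l; rewrite ord1 !mxE.
  under eq_bigr => j _ do rewrite mxE mulrBr.
  rewrite sumrB (bigD1 (F := fun j => a 0 j * (j == l)%:R) l) //= eqxx mulr1.
  rewrite [X in _ - (_ + X)]big1 ?addr0 => [|j jl]; last by rewrite (negPf jl) mulr0.
  have := cE (n l); rewrite mxE /= => <-; exact: subrr.
have [q [B [y [mE aB]]]] := KMD _ _ Vs (KMN _ Vm).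
by exists q, B, y; split=> // i; rewrite -mE opprB addrC subrK.
Qed.

(** * Flatness relative to a pair of subsets *)

Section RelativeFlatness.
Variables (S : pzRingType) (M : lmodType S).

(** Two sets occur because a relation inside one stage of a chain is trivialised only by elements of
    the next stage. *)
Definition eqflat_in (K K' : set M) : Prop := forall r (a : 'rV[S]_r) (m : 'I_r -> M),
  (forall i, K (m i)) -> lincomb a m = 0 ->
  exists r' (B : 'M[S]_(r, r')) (y : 'I_r' -> M),
    [/\ forall j, K' (y j), forall i, m i = lincomb (row i B) y & a *m B = 0].

Lemma lincomb_linear (N : lmodType S) (f : {linear N -> M}) r (v : 'rV[S]_r) m :
  f (lincomb v m) = lincomb v (f \o m).
Proof. by rewrite /lincomb linear_sum; apply: eq_bigr => i _; rewrite linearZ. Qed.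

Lemma eqflat_range (N : lmodType S) (f : {linear N -> M}) : injective f ->
  eqflat N <-> eqflat_in (range f) (range f).
Proof.
move=> fI; split=> flatN r a m; last first.
  move=> /(congr1 f); rewrite linear0 lincomb_linear => e.
  have [r' [B [y [yf yE aB]]]] := flatN _ _ (f \o m) (fun i => ex_intro2 _ _ (m i) I erefl) e.
  have /choice [z zE] j : exists z, f z = y j by have [z _ ez] := yf j; exists z.
  exists r', B, z; split=> // i; apply: fI; rewrite lincomb_linear -[LHS]/((f \o m) i) yE.
  by congr lincomb; apply/funext => j; rewrite /= zE.
move=> mf; have /choice [n nE] i : exists n, f n = m i.
  by have [n _ e] := mf i; exists n.
have -> : m = f \o n by apply/funext => i; rewrite /= nE.
rewrite -lincomb_linear -(linear0 f) => /fI /flatN [r' [B [y [yE aB]]]].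
exists r', B, (f \o y); split=> // i.
by rewrite -lincomb_linear -yE.
Qed.

(* Finitely many relations among the generators of [K :&: D] trivialise
   simultaneously in [K]; as the relations among finitely many generators form
   a countably generated module, countably many such trivialisations suffice. *)
Lemma eqflat_step (K D : set M) : left_countably_noetherian S ->
  is_submodule K -> is_submodule D -> eqflat_in K K ->
  countably_generated_submodule D ->
  exists D', [/\ D `<=` D', is_submodule D', countably_generated_submodule D'
    & eqflat_in (K `&` D) (K `&` D')].
Proof.
move=> noethS hK hD flatK Dcg.
have hKD : is_submodule (K `&` D).
  split=> [|a x y [Kx Dx] [Ky Dy]]; first by split; exact: submod0.
  by split; [exact: hK.2 | exact: hD.2].
have [x KDE] := (countably_generatedP _).1
  (cg_submodule noethS hKD (@subIsetr _ _ _) Dcg).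
have KDx n : (K `&` D) (x n) by rewrite KDE; apply: sub_gspan; exists n.
pose xr r (i : 'I_r) := x i.
pose Rel r : set 'rV[S]_r := [set v | lincomb v (@xr r) = 0].
have hRel r : is_submodule (Rel r).
  split=> [|a v w /= vE wE]; rewrite /Rel /= ?lincomb0 //.
  by rewrite lincombP vE wE scaler0 addr0.
have rowcg r : countably_generated_submodule [set: 'rV[S]_r].
  exists (range (fun i : 'I_r => delta_mx 0 i : 'rV[S]_r)); split.
    by apply: countable_image; exact: countableP.
  apply/gspanT => v; rewrite [v]row_sum_delta.
  apply: (submod_sum (gspan_submodule _)) => i _.
  by apply: (submodZ (gspan_submodule _)); apply: sub_gspan; exists i.
have kapP r : exists kap : nat -> 'rV[S]_r, Rel r = gspan (range kap).
  by apply/countably_generatedP; apply: cg_submodule (rowcg r).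
pose kap r := projT1 (cid (kapP r)).
have kapE r : Rel r = gspan (range (kap r)) := projT2 (cid (kapP r)).
have flatK' : eqflat (sub_lmod hK).
  by apply/(eqflat_range (@sub_val_inj _ _ _ hK)); rewrite sub_val_range.
(* The pair [t] selects the first [t.1] generators and the first [t.2] generators of the module of
   their relations; [Y] collects elements trivialising these. *)
have /choice [Y YP] (t : nat * nat) : exists Y : set M, [/\ countable Y, Y `<=` K
    & exists r' (B : 'M[S]_(t.1, r')) (y : 'I_r' -> M), [/\ forall j, Y (y j),
      forall i : 'I_t.1, x i = lincomb (row i B) y
      & forall l, (l < t.2)%N -> kap t.1 l *m B = 0]].
  pose x' (i : 'I_t.1) : sub_lmod hK := sub_mk hK (KDx i).1.
  have [|r' [B [y [yE LB]]]] := @eqflat_seq _ _ flatK' _ (mkseq (kap t.1) t.2) x'.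
    move=> v /mapP [l _ ->]; apply: (@sub_val_inj _ _ _ hK).
    rewrite lincomb_linear linear0; change (Rel t.1 (kap t.1 l)).
    by rewrite kapE; apply: sub_gspan; exists l.
  exists (range (@sub_val _ _ _ hK \o y)); split.
  - by apply: countable_image; exact: countableP.
  - by move=> _ [j _ <-]; exact: sub_valP.
  exists r', B, (@sub_val _ _ _ hK \o y); split=> [j|i|l lt]; first by exists j.
    by rewrite -lincomb_linear -yE.
  by apply: LB; apply: map_f; rewrite mem_iota.
have [A [Ac DE]] := Dcg.
pose D' := gspan (A `|` \bigcup_t Y t).
have DD' : D `<=` D' by rewrite DE; apply: gspan_mono; left.
exists D'; split=> //; first exact: gspan_submodule.
  apply: cg_gspan; apply: countable_setU => //.
  by apply: bigcup_countable => // t _; case: (YP t).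
move=> q a m mKD am.
have /choice [n nP] (i : 'I_q) : exists n, forall r, (n <= r)%N ->
    exists v : 'rV[S]_r, m i = lincomb v (@xr r).
  by apply: gspan_range_ev; rewrite -KDE; exact: mKD.
(* All entries of [m] are combinations of the first [r] generators. The given relation then becomes
   one among these, hence a combination of the first [p] members of [kap r], and the trivialisation
   chosen for [(r, p)] applies. *)
pose r := \max_i n i.
have /choice [C CE] (i : 'I_q) : exists v : 'rV[S]_r, m i = lincomb v (@xr r).
  by apply: nP; exact: leq_bigmax.
pose CM := \matrix_i C i.
have mE i : m i = lincomb (row i CM) (@xr r) by rewrite rowK.
have : Rel r (a *m CM) by rewrite /Rel /= -(lincomb_mul mE).
rewrite kapE => /gspan_rangeP [p [w wE]].
have [_ YK [r' [B [y [Yy xE kB]]]]] := YP (r, p).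
exists r', (CM *m B), y; split=> [j|i|].
- by split; [exact: YK (Yy j) | apply: sub_gspan; right; exists (r, p)].
- by rewrite mE (lincomb_mul xE) row_mul.
rewrite mulmxA wE mulmx_suml big1 // => l _.
by rewrite -scalemxAl kB ?scaler0.
Qed.

End RelativeFlatness.

(** * Corings and their directed colimits *)

Section CoringColimits.
Variables (k : comPzRingType) (R : kalgebra k).
Local Notation S := (env R).

Section Naturality.
Variables C D E : lmodType S.

Lemma bassoc_bal2 (e : E) : balanced (@ract _ R C) (@lact _ R D)
  (fun c d => bpure c (bpure d e)).
Proof.
split=> [x x' y|x y y'|x r y]; first by rewrite bpureDl.
  by rewrite bpureDl bpureDr.
by rewrite bpure_bal lact_bpure.
Qed.

Lemma bassoc_bal1 : balanced (@ract _ R (btens C D)) (@lact _ R E)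
  (fun x e => tlift (fun c d => bpure c (bpure d e)) x).
Proof.
split=> [x x' y|x y y'|x r y].
- exact: (tliftD (bassoc_bal2 y)).
- elim/btens_ind: x => [|x x' IHx IHx'|c' d'].
  + by rewrite !(tlift0 (bassoc_bal2 _)) addr0.
  + by rewrite !(tliftD (bassoc_bal2 _)) IHx IHx' addrACA.
  + by rewrite !(tlift_pure (bassoc_bal2 _)) !bpureDr.
- elim/btens_ind: x => [|x x' IHx IHx'|c' d'].
  + by rewrite [ract _ _]scaler0 !(tlift0 (bassoc_bal2 _)).
  + by rewrite ractDl !(tliftD (bassoc_bal2 _)) IHx IHx'.
  + by rewrite ract_bpure !(tlift_pure (bassoc_bal2 _)) bpure_bal.
Qed.

Lemma bassocD (x y : btens (btens C D) E) : bassoc (x + y) = bassoc x + bassoc y.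
Proof. exact: (tliftD bassoc_bal1). Qed.
Lemma bassoc0 : bassoc (0 : btens (btens C D) E) = 0.
Proof. exact: (tlift0 bassoc_bal1). Qed.

End Naturality.

Lemma bassoc_nat (C D E C' D' E' : lmodType S) (f : {linear C -> C'})
    (g : {linear D -> D'}) (h : {linear E -> E'}) t :
  bassoc (btmap (btmap f g) h t) = btmap f (btmap g h) (bassoc t).
Proof.
elim/btens_ind: t => [|x y IHx IHy|x e].
- by rewrite btmap0 !bassoc0 btmap0.
- by rewrite btmapD !bassocD btmapD IHx IHy.
elim/btens_ind: x => [|x y IHx IHy|c d].
- by rewrite [bpure 0 e]tpure0l btmap0 !bassoc0 btmap0.
- by rewrite bpureDl btmapD !bassocD btmapD IHx IHy.
rewrite bassoc_pure (btmap_pure f (btmap g h)) (btmap_pure (btmap f g) h) /=.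
by rewrite (btmap_pure f g) (btmap_pure g h) bassoc_pure.
Qed.

Lemma blunit_bal (C : lmodType S) :
  balanced (@ract _ R (rbim R)) (@lact _ R C) (fun r c => lact r c).
Proof.
split=> [x x' y|x y y'|x s y].
- exact: lactDl.
- exact: lactDr.
- by rewrite lactA; congr (lact _ y); rewrite [LHS]rbim_scale_pure mul1r.
Qed.

Lemma brunit_bal (C : lmodType S) :
  balanced (@ract _ R C) (@lact _ R (rbim R)) (fun c r => ract c r).
Proof.
split=> [x x' y|x y y'|x s y].
- exact: ractDl.
- exact: ractDr.
- by rewrite ractA; congr (ract x _); rewrite [RHS]rbim_scale_pure mulr1.
Qed.

Lemma blunit_nat (C D : lmodType S) (f : {linear C -> D}) t :
  blunit (btmap idfun f t) = f (blunit t).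
Proof.
elim/btens_ind: t => [|x y IHx IHy|r c].
- by rewrite btmap0 /blunit !(tlift0 (blunit_bal _)) linear0.
- by rewrite btmapD /blunit !(tliftD (blunit_bal _)) linearD -!/(blunit _) IHx IHy.
by rewrite btmap_pure !blunit_pure lact_linear.
Qed.

Lemma brunit_nat (C D : lmodType S) (f : {linear C -> D}) t :
  brunit (btmap f idfun t) = f (brunit t).
Proof.
elim/btens_ind: t => [|x y IHx IHy|c r].
- by rewrite btmap0 /brunit !(tlift0 (brunit_bal _)) linear0.
- by rewrite btmapD /brunit !(tliftD (brunit_bal _)) linearD -!/(brunit _) IHx IHy.
by rewrite btmap_pure !brunit_pure ract_linear.
Qed.

Section PushAxioms.
Variables (L : lmodType S) (mu : {linear L -> btens L L}) (ep : {linear L -> rbim R}).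
Variables (E : coring R) (f : {linear E -> L}).
Hypothesis fmu : forall x, mu (f x) = btmap f f (comul E x).
Hypothesis fep : forall x, ep (f x) = counit E x.

(** By naturality of the canonical maps, a coring identity holds on the image of any map that
    respects the structures. This serves colimits, where such images cover, and transport along
    isomorphisms. *)
Lemma push_coassoc x :
  bassoc (btmap mu idfun (mu (f x))) = btmap idfun mu (mu (f x)).
Proof.
have e t : btmap mu idfun (btmap f f t) = btmap (btmap f f) f (btmap (comul E) idfun t).
  rewrite -!btmap_comp; apply: btmap_ext => y //=; exact: fmu.
have e' t : btmap idfun mu (btmap f f t) = btmap f (btmap f f) (btmap idfun (comul E) t).
  rewrite -!btmap_comp; apply: btmap_ext => y //=; exact: fmu.
by rewrite fmu e e' bassoc_nat comulA.
Qed.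

Lemma push_counitl x : blunit (btmap ep idfun (mu (f x))) = f x.
Proof.
have e t : btmap ep idfun (btmap f f t) = btmap idfun f (btmap (counit E) idfun t).
  rewrite -!btmap_comp; apply: btmap_ext => y //=; exact: fep.
by rewrite fmu e blunit_nat counitl.
Qed.

Lemma push_counitr x : brunit (btmap idfun ep (mu (f x))) = f x.
Proof.
have e t : btmap idfun ep (btmap f f t) = btmap f idfun (btmap idfun (counit E) t).
  rewrite -!btmap_comp; apply: btmap_ext => y //=; exact: fep.
by rewrite fmu e brunit_nat counitr.
Qed.

End PushAxioms.

Program Definition forget : functor (Corings R) (Mod S) :=
  @Functor (Corings R) (Mod S) (@cobj k R) (fun X Y f => cfun f) _ _.

Program Definition subcat_incl (C : category) (P : C -> Prop) :
    functor (full_subcategory P) C :=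
  @Functor (full_subcategory P) C sval (fun X Y f => f) _ _.

Section Corings.
Variables (I : poset) (dI : aleph1_directed I) (D : functor (poset_cat I) (Corings R)).
Local Notation UD := (functor_comp forget D).

(** The comultiplications and counits of the stages glue to maps out of the colimit of modules; each
    axiom is checked on an element, which comes from a stage. *)
Lemma coring_elementwise_ex : exists c : cocone D, elementwise (map_cocone forget c).
Proof.
pose c0 := dcolim_cocone UD dI.
have c0E : elementwise c0 := dcolim_elementwise UD dI.
pose L : lmodType S := apex c0.
pose l i : {linear D i -> L} := lg c0 i.
have lsur x : exists i (y : D i), l i y = x := c0E.1 x.
have [|mu muE] := ew_glue_linear (D := UD) (E := btens L L) dI
    (F := fun i => (btmap (l i) (l i) \o comul (D i) : {linear D i -> btens L L})) c0E.
  move=> i j h x /=; rewrite [comul (D j) _](@cfun_comul _ _ _ _ (fmap D h)).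
  by apply: btmapM => y; exact: (@lg_tr _ _ UD c0 i j h y).
have [|ep epE] := ew_glue_linear (D := UD) (E := rbim R) dI
    (F := fun i => (counit (D i) : {linear D i -> rbim R})) c0E.
  by move=> i j h x; exact: (@cfun_counit _ _ _ _ (fmap D h)).
have Lc c : bassoc (btmap mu idfun (mu c)) = btmap idfun mu (mu c).
  have [i [y <-]] := lsur c; exact: (push_coassoc (f := l i) (muE i)).
have Ll c : blunit (btmap ep idfun (mu c)) = c.
  have [i [y <-]] := lsur c; exact: (push_counitl (f := l i) (muE i) (epE i)).
have Lr c : brunit (btmap idfun ep (mu c)) = c.
  have [i [y <-]] := lsur c; exact: (push_counitr (f := l i) (muE i) (epE i)).
pose LC := @Coring k R L mu ep Lc Ll Lr.
pose lc i : coring_hom (D i) LC := @CoringHom k R (D i) LC (l i) (muE i) (epE i).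
have lcE i j (h : @hom (poset_cat I) i j) : comp (c := Corings R) (lc j) (fmap D h) = lc i.
  by apply: coring_hom_eq => x; exact: (@lg_tr _ _ UD c0 i j h x).
by exists (@Cocone (poset_cat I) (Corings R) D LC lc lcE).
Qed.

End Corings.

Section FullSubcategory.
Variable P : coring R -> Prop.
Local Notation K := (full_subcategory (C := Corings R) P).
Definition forget_sub : functor K (Mod S) := functor_comp forget (subcat_incl (C := Corings R) P).

Variables (I : poset) (dI : aleph1_directed I) (D : functor (poset_cat I) K).

Lemma coring_elementwise_colimit (c : cocone D) :
  elementwise (map_cocone forget_sub c) -> is_colimit c.
Proof.
move=> cE c'.
have [|g gE] := ew_glue_linear (D := functor_comp forget_sub D) dI (E := cobj (sval (apex c')))
    (F := fun i => cfun (leg c' i)) cE.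
  by move=> i j h x; rewrite -(@leg_comp _ _ _ c' i j h).
have gm x : comul (sval (apex c')) (g x) = btmap g g (comul (sval (apex c)) x).
  have [i [y <-]] := cE.1 x.
  rewrite gE [comul (sval (apex c)) _](@cfun_comul _ _ _ _ (leg c i)) cfun_comul.
  by symmetry; apply: btmapM => z; exact: gE.
have ge x : counit (sval (apex c')) (g x) = counit (sval (apex c)) x.
  have [i [y <-]] := cE.1 x.
  by rewrite gE [counit (sval (apex c)) _](@cfun_counit _ _ _ _ (leg c i)) cfun_counit.
exists (@CoringHom k R _ _ g gm ge); split.
  by move=> i; apply: coring_hom_eq => x; exact: gE.
move=> g' g'E; apply: coring_hom_eq => x; have [i [y <-]] := cE.1 x.
rewrite /= gE -(g'E i); reflexivity.
Qed.

(** With [closed_chains] this is all that is used about the two subcategories. The cocone is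
    required to be elementwise so that concrete properties such as flatness can be tested on
    elements. *)
Definition closed_colimits : Prop :=
  forall (I : poset) (D : functor (poset_cat I) (Corings R)) (c : cocone D),
  aleph1_directed I -> elementwise (map_cocone forget c) -> (forall i, P (D i)) ->
  P (apex c).

Hypothesis Pcolim : closed_colimits.

Lemma subcat_elementwise_ex :
  exists c : cocone D, elementwise (map_cocone forget_sub c).
Proof.
have [c cE] := coring_elementwise_ex dI (functor_comp (subcat_incl (C := Corings R) P) D).
have Pc : P (apex c) := Pcolim dI cE (fun i => proj2_sig (D i)).
by exists (@Cocone (poset_cat I) K D (exist _ (apex c) Pc) (leg c) (@leg_comp _ _ _ c)).
Qed.

Lemma subcat_colimit_elementwise (c : cocone D) :
  is_colimit c -> elementwise (map_cocone forget_sub c).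
Proof.
move=> cC; have [c0 c0E] := subcat_elementwise_ex.
have [f [fE _]] := cC c0.
have [g [gE _]] := coring_elementwise_colimit c0E c.
have [e [eE eU]] := cC c.
have gf : comp g f = idm (apex c).
  rewrite -(eU (comp g f)) ?(eU (idm _)) // => i; first exact: comp_idl.
  by rewrite -compA fE gE.
have gfx x : g (f x) = x.
  exact: (congr1 (fun h : coring_hom (sval (apex c)) (sval (apex c)) => h x) gf).
have fE' i x : f (leg c i x) = leg c0 i x.
  exact: (congr1 (fun h : coring_hom (sval (D i)) (sval (apex c0)) => h x) (fE i)).
have gE' i x : g (leg c0 i x) = leg c i x.
  exact: (congr1 (fun h : coring_hom (sval (D i)) (sval (apex c)) => h x) (gE i)).
split=> [x|i x xE].
  have [i [y yE]] := c0E.1 (f x); exists i, y; rewrite -[RHS]gfx -yE.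
  exact: (esym (gE' i y)).
have [|j [h e0]] := c0E.2 i x; last by exists j, h.
exact: etrans (esym (fE' i x)) (etrans (congr1 f xE) (linear0 f)).
Qed.

Lemma subcat_has_colimits : exists c : cocone D, is_colimit c.
Proof.
have [c cE] := subcat_elementwise_ex; exists c; exact: coring_elementwise_colimit.
Qed.

End FullSubcategory.
End CoringColimits.

Section CgCorings.
Variables (k : comPzRingType) (R : kalgebra k).
Local Notation S := (env R).
Hypothesis noethS : left_countably_noetherian S.

(** A coring map into the colimit first factors through a stage as a linear map. The two ways to
    comultiply after it agree in the colimit of the tensor squares, hence at a later stage; the
    counit is respected at once, since the legs preserve counits. *)
Lemma cg_coring_presentable (P : coring R -> Prop) (Pcolim : closed_colimits P)
    (X : full_subcategory (C := Corings R) P) :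
  countably_generated (cobj (sval X)) -> aleph1_presentable X.
Proof.
move=> Xcg I D c dI /(subcat_colimit_elementwise dI Pcolim) cE.
pose UD := functor_comp (forget_sub P) D.
pose uc : cocone UD := map_cocone (forget_sub P) c.
pose l i : {linear sval (D i) -> sval (apex c)} := lg uc i.
have trm i j (h : ple i j) x : comul (sval (D j)) (@tr _ _ UD i j h x)
    = btmap (@tr _ _ UD i j h) (@tr _ _ UD i j h) (comul (sval (D i)) x).
  exact: (@cfun_comul _ _ _ _ (fmap D h)).
have tre i j (h : ple i j) x : counit (sval (D j)) (@tr _ _ UD i j h x)
    = counit (sval (D i)) x.
  exact: (@cfun_counit _ _ _ _ (fmap D h)).
have lm i x : comul (sval (apex c)) (l i x) = btmap (l i) (l i) (comul (sval (D i)) x).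
  exact: (@cfun_comul _ _ _ _ (leg c i)).
have le i x : counit (sval (apex c)) (l i x) = counit (sval (D i)) x.
  exact: (@cfun_counit _ _ _ _ (leg c i)).
apply: (hom_colimit dI) => [f|i f g e].
  have [i [g gE]] := cg_factor dI cE Xcg noethS (cfun f).
  have gE' x : l i (g x) = f x := gE x.
  have tE := tens_elementwise dI cE cE.
  have [|j [h hE]] := cg_agree dI tE Xcg (i := i)
      (f := comul (sval (D i)) \o g : {linear sval X -> btens (sval (D i)) (sval (D i))})
      (g := btmap g g \o comul (sval X)
        : {linear sval X -> btens (sval (D i)) (sval (D i))}).
    move=> x; rewrite !lg_tens /= -[LHS]lm gE' cfun_comul.
    by symmetry; apply: btmapM.
  pose f' : {linear sval X -> sval (D j)} := @tr _ _ UD i j h \o g.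
  have f'm x : comul (sval (D j)) (f' x) = btmap f' f' (comul (sval X) x).
    rewrite /= trm; apply: (etrans (hE x)).
    by apply: btmapM.
  have f'e x : counit (sval (D j)) (f' x) = counit (sval X) x.
    by rewrite /= tre -le gE' cfun_counit.
  exists j, (@CoringHom k R _ _ f' f'm f'e); apply: coring_hom_eq => x.
  by rewrite -gE'; exact: (@lg_tr _ _ UD uc i j h (g x)).
have [|j [h hE]] := cg_agree dI cE Xcg (i := i) (f := cfun f) (g := cfun g).
  by move=> x; exact: (congr1 (fun u : coring_hom _ _ => u x) e).
by exists j, h; apply: coring_hom_eq => x; exact: hE.
Qed.

Lemma bassoc_linear (C D E : lmodType S) : linear (@bassoc _ _ C D E).
Proof.
move=> a x y; rewrite bassocD; congr (_ + _).
elim/env_ind: a => [|a b IHa IHb|a b]; first by rewrite !scale0r bassoc0.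
  by rewrite !scalerDl bassocD IHa IHb.
elim/btens_ind: x => [|x x' IHx IHx'|x e]; first by rewrite !scaler0 bassoc0 scaler0.
  by rewrite scalerDr !bassocD scalerDr IHx IHx'.
rewrite epure_bpure; elim/btens_ind: x => [|x x' IHx IHx'|c d].
- rewrite [lact _ _]scaler0 [bpure 0 _ in LHS]tpure0l [bpure 0 _ in RHS]tpure0l.
  by rewrite bassoc0 scaler0.
- by rewrite lactDr !bpureDl !bassocD scalerDr IHx IHx'.
by rewrite lact_bpure !bassoc_pure epure_bpure ract_bpure.
Qed.
HB.instance Definition _ (C D E : lmodType S) :=
  GRing.isLinear.Build S (btens (btens C D) E) (btens C (btens D E)) _
    (@bassoc _ _ C D E) (@bassoc_linear C D E).

(** * Coassociative lifts of a comultiplication along chains *)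

Section Substructures.
Variables (I : poset) (dI : aleph1_directed I).
Variables (D : functor (poset_cat I) (Mod S)) (c : cocone D).
Hypothesis cE : elementwise c.
Hypothesis Dcg : forall i, countably_generated (D i).
Hypothesis lgI : forall i, injective (lg c i).
Variable mu : {linear apex c -> btens (apex c) (apex c)}.
Hypothesis muA : forall x, bassoc (btmap mu idfun (mu x)) = btmap idfun mu (mu x).

Lemma agree2 (E : functor (poset_cat I) (Mod S)) (e : cocone E) (P : lmodType S)
    i j (f : {linear P -> E i}) (g : {linear P -> E j}) : elementwise e ->
  countably_generated P -> (forall x, lg e i (f x) = lg e j (g x)) ->
  exists u, ple i u /\ ple j u /\
    forall (h : ple i u) (h' : ple j u) x, tr h (f x) = tr h' (g x).
Proof.
move=> eE Pcg fg; have [v [iv jv]] := ub2 dI i j.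
have [|u [vu uE]] := cg_agree dI eE Pcg (i := v) (f := tr iv \o f) (g := tr jv \o g).
  by move=> x; rewrite /= !lg_tr.
exists u; split; [exact: ple_trans iv vu | split; first exact: ple_trans jv vu].
by move=> h h' x; rewrite -(tr_comp iv vu) -(tr_comp jv vu) uE.
Qed.

Definition lifts_mu i j (nu : {linear D i -> btens (D j) (D j)}) : Prop :=
  forall x, btmap (lg c j) (lg c j) (nu x) = mu (lg c i x).

Lemma lifts_mu_ex i : exists p : {j : I & {linear D i -> btens (D j) (D j)}},
  ple i (tag p) /\ lifts_mu (tagged p).
Proof.
have tE := tens_elementwise dI cE cE.
have [j [g gE]] := cg_factor dI tE (Dcg i) noethS
  (mu \o lg c i : {linear D i -> btens (apex c) (apex c)}).
have [u [iu ju]] := ub2 dI i j.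
exists (existT _ u (btmap (tr ju) (tr ju) \o g : {linear D i -> btens (D u) (D u)})).
split=> //= x; rewrite -[RHS]/((mu \o lg c i) x) -gE lg_tens /=.
by apply: btmapM => y; rewrite lg_tr.
Qed.

Definition phi i : I := tag (projT1 (cid (lifts_mu_ex i))).
Definition nu i : {linear D i -> btens (D (phi i)) (D (phi i))} :=
  tagged (projT1 (cid (lifts_mu_ex i))).
Lemma ple_phi i : ple i (phi i).
Proof. exact: (projT2 (cid (lifts_mu_ex i))).1. Qed.
Lemma nuP i : lifts_mu (nu i).
Proof. exact: (projT2 (cid (lifts_mu_ex i))).2. Qed.

Lemma lg_btmap i j (h : ple i j) (t : btens (D i) (D i)) :
  btmap (lg c j) (lg c j) (btmap (tr h) (tr h) t) = btmap (lg c i) (lg c i) t.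
Proof. by apply: btmapM => x; exact: lg_tr. Qed.

Lemma tr_btmap i j l (h : ple i j) (h' : ple j l) (h'' : ple i l) (t : btens (D i) (D i)) :
  btmap (tr h') (tr h') (btmap (tr h) (tr h) t) = btmap (tr h'') (tr h'') t.
Proof. by apply: btmapM => x; exact: tr_comp. Qed.

(** Both are lifts of [mu], so they agree in the colimit of the tensor squares. *)
Lemma compat_stage i i' j j' (h : ple i i') (f : {linear D i -> btens (D j) (D j)})
    (f' : {linear D i' -> btens (D j') (D j')}) : lifts_mu f -> lifts_mu f' ->
  exists u, ple j u /\ ple j' u /\ forall (g : ple j u) (g' : ple j' u) x,
    btmap (tr g) (tr g) (f x) = btmap (tr g') (tr g') (f' (tr h x)).
Proof.
move=> fP f'P; have tE := tens_elementwise dI cE cE.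
have [|u [ju [j'u uE]]] := agree2 (E := tens_system D D) (i := j) (j := j') (f := f)
    (g := f' \o tr h : {linear D i -> btens (D j') (D j')}) tE (Dcg i).
  by move=> x; rewrite !lg_tens /= fP f'P lg_tr.
by exists u.
Qed.

(** Applying [nu j] to one factor lands at [phi j], so the other factor is moved there too. The two
    sides have the same image in the triple tensor product of the apex by [muA], and triple tensor
    products also commute with the colimit. *)
Lemma coassoc_stage i j (h : ple (phi i) j) :
  exists u, ple (phi j) u /\ forall (g : ple (phi j) u) x,
    let t := btmap (tr h) (tr h) (nu i x) in
    btmap (tr g) (btmap (tr g) (tr g)) (bassoc (btmap (nu j) (tr (ple_phi j)) t))
    = btmap (tr g) (btmap (tr g) (tr g)) (btmap (tr (ple_phi j)) (nu j) t).
Proof.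
have tE := tens_elementwise dI cE (tens_elementwise dI cE cE).
pose T := btens (D (phi j)) (btens (D (phi j)) (D (phi j))).
pose f : {linear D i -> T} := @bassoc _ _ _ _ _ \o
  (btmap (nu j) (tr (ple_phi j)) \o (btmap (tr h) (tr h) \o nu i)).
pose f' : {linear D i -> T} :=
  btmap (tr (ple_phi j)) (nu j) \o (btmap (tr h) (tr h) \o nu i).
have [|u [ju uE]] := cg_agree (D := tens_system D (tens_system D D)) dI tE (Dcg i)
    (i := phi j) (f := f) (g := f').
  move=> x; rewrite /lg /= -!/(lg c _).
  rewrite -bassoc_nat.
  have e1 t : btmap (btmap (lg c (phi j)) (lg c (phi j))) (lg c (phi j))
      (btmap (nu j) (tr (ple_phi j)) t)
      = btmap mu idfun (btmap (lg c j) (lg c j) t).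
    rewrite -!btmap_comp; apply: btmap_ext => y /=; [exact: nuP | exact: lg_tr].
  have e2 t : btmap (lg c (phi j)) (btmap (lg c (phi j)) (lg c (phi j)))
      (btmap (tr (ple_phi j)) (nu j) t)
      = btmap idfun mu (btmap (lg c j) (lg c j) t).
    rewrite -!btmap_comp; apply: btmap_ext => y /=; [exact: lg_tr | exact: nuP].
  by rewrite e1 e2 !lg_btmap nuP muA.
by exists u; split=> // g x; rewrite (Prop_irrelevance g ju); exact: uE.
Qed.

Hypothesis chain_sup : forall d : nat -> I, (forall n, ple (d n) (d n.+1)) ->
  exists u, (forall n, ple (d n) u) /\
    forall x : D u, exists n (h : ple (d n) u) y, tr h y = x.

Lemma tr_inj i j (h : ple i j) : injective (tr (D := D) h).
Proof. by move=> x y /(congr1 (lg c j)); rewrite !lg_tr => /lgI. Qed.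

(* Along a chain in which each stage absorbs the choices made at the two
   preceding ones, the lifts [nu] of [mu] glue on the union to a coassociative
   map. *)
Lemma substructure_ex T (A : set T) (it : T -> I)
    (mt : forall t, {linear D (it t) -> btens (D (it t)) (D (it t))})
    (Xi : I -> I) (i0 : I) : countable A -> (forall t, lifts_mu (mt t)) ->
  exists u (m : {linear D u -> btens (D u) (D u)}),
  [/\ lifts_mu m,
      forall x, bassoc (btmap m idfun (m x)) = btmap idfun m (m x),
      ple i0 u,
      forall t, A t -> exists h : ple (it t) u,
        forall x, m (tr h x) = btmap (tr h) (tr h) (mt t x)
    & exists d : nat -> I, (forall n, ple (d n) (d n.+1)) /\
      (forall n, ple (Xi (d n)) (d n.+1)) /\ (forall n, ple (d n) u) /\
      forall x : D u, exists n (h : ple (d n) u) y, tr h y = x].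
Proof.
move=> Ac mtP.
have [u0 [i0u0 Au0]] : exists u0, ple i0 u0 /\ forall t, A t -> ple (it t) u0.
  have [v vP] := ub_image dI it Ac; have [u [i0u vu]] := ub2 dI i0 v.
  by exists u; split=> // t /vP h; exact: ple_trans h vu.
(* The given lift [mt t] and the chosen [nu u0] agree only from some stage [it' t] on. All these
   stages are put below [u1], the second stage of the chain, so the union extends every given
   structure. *)
have /choice [it' it'P] t : exists v, A t -> ple (it t) v /\ ple (phi u0) v /\
    forall (h : ple (it t) u0) (g : ple (it t) v) (g' : ple (phi u0) v) x,
    btmap (tr g) (tr g) (mt t x) = btmap (tr g') (tr g') (nu u0 (tr h x)).
  have [At|nA] := pselect (A t); last by exists u0.
  have [v [h1 [h2 hE]]] := compat_stage (Au0 t At) (mtP t) (@nuP u0).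
  exists v => _; split=> //; split=> // h g g' x.
  by rewrite (Prop_irrelevance h (Au0 t At)) hE.
have [u1 [phi_u1 [Xi_u1 Au1]]] : exists u1, ple (phi u0) u1 /\ ple (Xi u0) u1 /\
    forall t, A t -> ple (it' t) u1.
  have [v vP] := ub_image dI it' Ac; have [w [h1 h2]] := ub2 dI (phi u0) (Xi u0).
  have [u [vu wu]] := ub2 dI v w.
  exists u; split; [exact: ple_trans h1 wu | split; first exact: ple_trans h2 wu].
  by move=> t /vP h; exact: ple_trans h vu.
(* From two consecutive stages, [F] produces the next one, where their lifts agree and
   coassociativity between them holds. This makes sense only if [phi p.1] is below [p.2], as is the
   case along the chain. *)
have /choice [F FP] (p : I * I) : exists e, ple (phi p.2) e /\ ple (Xi p.2) e /\
    (forall (h : ple (phi p.1) p.2),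
      (forall (hh : ple p.1 p.2) (g : ple (phi p.1) e) (g' : ple (phi p.2) e) x,
        btmap (tr g) (tr g) (nu p.1 x) = btmap (tr g') (tr g') (nu p.2 (tr hh x))) /\
      forall (g : ple (phi p.2) e) x,
        let t := btmap (tr h) (tr h) (nu p.1 x) in
        btmap (tr g) (btmap (tr g) (tr g)) (bassoc (btmap (nu p.2) (tr (ple_phi p.2)) t))
        = btmap (tr g) (btmap (tr g) (tr g)) (btmap (tr (ple_phi p.2)) (nu p.2) t)).
  case: p => a b /=.
  have [w [h1 h2]] := ub2 dI (phi b) (Xi b).
  have [h|nh] := pselect (ple (phi a) b); last by exists w.
  have ab : ple a b := ple_trans (ple_phi a) h.
  have [v [v1 [v2 vE]]] := compat_stage ab (@nuP a) (@nuP b).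
  have [v' [v3 vE']] := coassoc_stage h.
  have [z1 [wz1 vz1]] := ub2 dI w v; have [z [z1z v'z]] := ub2 dI z1 v'.
  have wz := ple_trans wz1 z1z; have vz := ple_trans vz1 z1z.
  exists z; split; [exact: ple_trans h1 wz | split; first exact: ple_trans h2 wz].
  move=> h'; rewrite (Prop_irrelevance h' h); split=> [hh g g' x|g x].
    rewrite (Prop_irrelevance hh ab) -(tr_btmap v1 vz) -(tr_btmap v2 vz).
    by rewrite vE.
  have tr3 (t : btens (D (phi b)) (btens (D (phi b)) (D (phi b)))) :
      btmap (tr g) (btmap (tr g) (tr g)) t
      = btmap (tr v'z) (btmap (tr v'z) (tr v'z)) (btmap (tr v3) (btmap (tr v3) (tr v3)) t).
    symmetry; apply: btmapM => y; first exact: tr_comp.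
    exact: tr_btmap.
  by rewrite /= !tr3 vE'.
pose pd := fix pd n := if n is n'.+1 then ((pd n').2, F (pd n')) else (u0, u1).
pose d n := (pd n).1.
have pdE n : pd n = (d n, d n.+1) by case: n => [|n] //; rewrite /d /=; case: (pd n).
have dSS n : d n.+2 = F (d n, d n.+1) by rewrite -pdE.
have phid n : ple (phi (d n)) (d n.+1).
  by case: n => [|n] //; rewrite dSS; case: (FP (d n, d n.+1)).
have Xid n : ple (Xi (d n)) (d n.+1).
  by case: n => [|n] //; rewrite dSS; case: (FP (d n, d n.+1)) => _ [].
have dS n : ple (d n) (d n.+1) := ple_trans (ple_phi _) (phid n).
have [u [du usur]] := chain_sup dS.
have phiu n : ple (phi (d n)) u := ple_trans (phid n) (du n.+1).
(* The comultiplication of the union, read off at stage [n]; it remains to see that it is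
   independent of [n]. *)
pose G n (y : D (d n)) := btmap (tr (phiu n)) (tr (phiu n)) (nu (d n) y).
have GS n (h : ple (d n) (d n.+1)) y : G n.+1 (tr h y) = G n y.
  have [_ [_ /(_ (phid n)) [cE' _]]] := FP (d n, d n.+1).
  rewrite -dSS /= in cE'.
  have h2 : ple (phi (d n)) (d n.+2) := ple_trans (phid n) (dS n.+1).
  rewrite /G -(tr_btmap h2 (du n.+2)) -(tr_btmap (phid n.+1) (du n.+2)).
  by rewrite -(cE' h h2).
have dleN n N : (n <= N)%N -> ple (d n) (d N).
  exact: (homo_leq (@ple_refl I) (@ple_trans I) dS).
have Gm n m y (h : ple (d n) (d (m + n))) : G (m + n)%N (tr h y) = G n y.
  elim: m h => [|m IHm] h; first by rewrite tr_id.
  by rewrite -(tr_comp (dleN _ _ (leq_addl m n)) (dS (m + n)%N)) GS IHm.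
have GN n N y (h : ple (d n) (d N)) : (n <= N)%N -> G N (tr h y) = G n y.
  by move=> nN; move: h; rewrite -(subnK nN) => h; exact: Gm.
have GE n m (y : D (d n)) (z : D (d m)) : tr (du n) y = tr (du m) z -> G n y = G m z.
  have h1 := dleN _ _ (leq_maxl n m); have h2 := dleN _ _ (leq_maxr n m).
  rewrite -(GN n _ y h1 (leq_maxl n m)) -(GN m _ z h2 (leq_maxr n m)) => e.
  congr (G _ _); apply: (tr_inj (h := du _)).
  by rewrite (tr_comp h1 _ (du n)) (tr_comp h2 _ (du m)).
have usur' x : exists n (y : D (d n)), tr (du n) y = x.
  by have [n [h [y <-]]] := usur x; exists n, y; exact: tr_irr.
have usur2 x x' : exists n (y y' : D (d n)), tr (du n) y = x /\ tr (du n) y' = x'.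
  have [n [y <-]] := usur' x; have [n' [y' <-]] := usur' x'.
  have h1 := dleN _ _ (leq_maxl n n'); have h2 := dleN _ _ (leq_maxr n n').
  by exists (maxn n n'), (tr h1 y), (tr h2 y'); split; exact: tr_comp.
have /choice [m0 m0E] (x : D u) : exists t, forall n (y : D (d n)),
    tr (du n) y = x -> G n y = t.
  have [n [y <-]] := usur' x; exists (G n y) => n' y' e; exact: GE.
have m0E' n y : m0 (tr (du n) y) = G n y by rewrite (m0E _ n y erefl).
have m0L : linear m0.
  move=> a x x'; have [n [y [y' [<- <-]]]] := usur2 x x'.
  by rewrite -linearP !m0E' /G !linearP.
have [m mE0] := linear_ex m0L.
have mE n y : m (tr (du n) y) = G n y by rewrite mE0 m0E'.
exists u, m; split.
- move=> x; have [n [y <-]] := usur' x.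
  by rewrite mE /G lg_btmap nuP lg_tr.
- move=> x; have [n [y <-]] := usur' x.
  (* The comultiplied element at stage [n.+1], where it can be comultiplied again by
     [nu (d n.+1)]. *)
  pose t := btmap (tr (phid n)) (tr (phid n)) (nu (d n) y).
  have -> : m (tr (du n) y) = btmap (tr (du n.+1)) (tr (du n.+1)) t.
    by rewrite mE /t (tr_btmap _ _ (phiu n)).
  pose q := tr (D := D) (phiu n.+1).
  have e1 s : btmap m idfun (btmap (tr (du n.+1)) (tr (du n.+1)) s)
      = btmap (btmap q q) q (btmap (nu (d n.+1)) (tr (ple_phi (d n.+1))) s).
    rewrite -!btmap_comp; apply: btmap_ext => z /=; first by rewrite mE.
    by rewrite /q tr_comp.
  have e2 s : btmap idfun m (btmap (tr (du n.+1)) (tr (du n.+1)) s)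
      = btmap q (btmap q q) (btmap (tr (ple_phi (d n.+1))) (nu (d n.+1)) s).
    rewrite -!btmap_comp; apply: btmap_ext => z /=; last by rewrite mE.
    by rewrite /q tr_comp.
  rewrite e1 e2 bassoc_nat.
  have [_ [_ /(_ (phid n)) [_ cA]]] := FP (d n, d n.+1).
  rewrite -dSS /= in cA.
  pose g := phid n.+1.
  have q3 (s : btens (D (phi (d n.+1))) (btens (D (phi (d n.+1))) (D (phi (d n.+1))))) :
      btmap q (btmap q q) s = btmap (tr (du n.+2)) (btmap (tr (du n.+2)) (tr (du n.+2)))
        (btmap (tr g) (btmap (tr g) (tr g)) s).
    symmetry; apply: btmapM => z; first exact: tr_comp.
    exact: tr_btmap.
  by rewrite !q3 cA.
- exact: ple_trans i0u0 (du 0%N).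
- move=> t At; have h := ple_trans (Au0 t At) (du 0%N); exists h => x.
  rewrite -(tr_comp (Au0 t At) (du 0%N)) [LHS](mE 0%N (tr (Au0 t At) x)) /G.
  have [g [g' hE]] := it'P t At.
  have v1 := ple_trans (Au1 t At) (du 1%N).
  by rewrite -(tr_btmap g v1) (hE (Au0 t At) g g') (tr_btmap g' v1 (phiu 0%N)).
by exists d.
Qed.

End Substructures.
End CgCorings.

(** * The system of countably generated submodules *)

Section CgSubmodules.
Variables (S : pzRingType) (M : lmodType S).

Definition cg_pred (N : set M) := is_submodule N /\ countably_generated_submodule N.
Definition cgsub_le (N N' : {N : set M | cg_pred N}) := sval N `<=` sval N'.

Lemma cgsub_le_refl N : cgsub_le N N. Proof. by []. Qed.
Lemma cgsub_le_trans N' N N'' : cgsub_le N N' -> cgsub_le N' N'' -> cgsub_le N N''.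
Proof. exact: subset_trans. Qed.
Lemma cgsub_le_anti N N' : cgsub_le N N' -> cgsub_le N' N -> N = N'.
Proof.
case: N N' => [N hN] [N' hN'] h h'.
by apply: eq_exist; apply/seteqP.
Qed.
Definition cgsub : poset := Poset cgsub_le_refl cgsub_le_trans cgsub_le_anti.

Definition cgsub_mk (N : set M) (hN : is_submodule N)
  (cN : countably_generated_submodule N) : cgsub := exist cg_pred N (conj hN cN).

Definition cgsub_gspan (A : set M) (Ac : countable A) : cgsub :=
  cgsub_mk (gspan_submodule A) (cg_gspan Ac).

Definition cgsub_lmod (N : cgsub) : lmodType S := sub_lmod (proj2_sig N).1.

Definition cgsub_incl_fun (N N' : cgsub) (h : ple N N') (x : cgsub_lmod N) :
  cgsub_lmod N' := sub_mk (proj2_sig N').1 (h _ (sub_valP x)).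
Lemma cgsub_incl_linear N N' h : linear (@cgsub_incl_fun N N' h).
Proof.
move=> a x y; apply: (@sub_val_inj _ _ _ (proj2_sig N').1).
by rewrite linearP !sub_mkK linearP.
Qed.
HB.instance Definition _ N N' h := GRing.isLinear.Build S (cgsub_lmod N) (cgsub_lmod N')
  _ (@cgsub_incl_fun N N' h) (@cgsub_incl_linear N N' h).

Program Definition cgsub_system : functor (poset_cat cgsub) (Mod S) :=
  @Functor (poset_cat cgsub) (Mod S) cgsub_lmod
    (fun N N' h => @cgsub_incl_fun N N' h : {linear _ -> _}) _ _.
Next Obligation. by apply: linear_eq => x; apply: val_inj. Qed.
Next Obligation. by apply: linear_eq => x; apply: val_inj. Qed.

Program Definition cgsub_cocone : cocone cgsub_system :=
  @Cocone (poset_cat cgsub) (Mod S) cgsub_system M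
    (fun N => @sub_val _ _ _ (proj2_sig N).1 : {linear _ -> _}) _.
Next Obligation. by apply: linear_eq. Qed.

Lemma cgsub_lg_inj N : injective (lg cgsub_cocone N).
Proof. exact: sub_val_inj. Qed.

Lemma cgsub_lg_range N : range (lg cgsub_cocone N) = sval N.
Proof. exact: sub_val_range. Qed.

Lemma cgsub_directed : aleph1_directed cgsub.
Proof.
move=> A Ac; have /choice [B BP] (N : cgsub) : exists B, countable B /\ sval N = gspan B.
  by have [_ [B [Bc NE]]] := proj2_sig N; exists B.
have Uc : countable (\bigcup_(N in A) B N).
  by apply: bigcup_countable => // N _; case: (BP N).
exists (cgsub_gspan Uc) => N AN x; rewrite (BP N).2 /=.
by apply: gspan_mono => y By; exists N.
Qed.

Lemma cgsub_elementwise : elementwise cgsub_cocone.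
Proof.
split=> [x|N x x0]; last first.
  exists N, (ple_refl N); rewrite tr_id; apply: (@cgsub_lg_inj N).
  by rewrite x0 linear0.
have := cgsub_lg_range (cgsub_gspan (countable1 x)).
move=> e; have : sval (cgsub_gspan (countable1 x)) x by apply: sub_gspan.
by rewrite -e => -[y _ yx]; exists (cgsub_gspan (countable1 x)), y.
Qed.

Lemma cgsub_cg N : countably_generated (cgsub_system N).
Proof. apply: cg_sub_lmod; exact: (proj2_sig N).2. Qed.

Lemma cgsub_chain_sup (d : nat -> cgsub) : (forall n, ple (d n) (d n.+1)) ->
  exists u, (forall n, ple (d n) u) /\
    forall x : cgsub_system u, exists n (h : ple (d n) u) y, tr (D := cgsub_system) h y = x.
Proof.
move=> dS; pose U := \bigcup_n sval (d n).
have dleN n N : (n <= N)%N -> ple (d n) (d N).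
  exact: (homo_leq (@ple_refl cgsub) (@ple_trans cgsub) dS).
have hU : is_submodule U.
  split=> [|a x y [n _ xn] [m _ ym]]; first by exists 0%N => //; exact: (proj2_sig (d 0%N)).1.1.
  exists (maxn n m) => //; apply: (proj2_sig (d (maxn n m))).1.2.
    exact: dleN (leq_maxl n m) _ xn.
  exact: dleN (leq_maxr n m) _ ym.
have cU : countably_generated_submodule U.
  rewrite (_ : U = gspan U); last first.
    by apply/seteqP; split; [exact: sub_gspan | exact: gspan_min].
  by apply: cg_bigcup => // n _; exact: (proj2_sig (d n)).2.
have du n : ple (d n) (cgsub_mk hU cU) by move=> x xn; exists n.
exists (cgsub_mk hU cU); split=> // x.
have [n _ xn] := sub_valP x.
exists n, (du n), (sub_mk (proj2_sig (d n)).1 xn); exact: val_inj.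
Qed.

(** The identity of [M] factors through a countably generated submodule, which is therefore all of
    [M]. *)
Lemma presentable_cg : aleph1_presentable (C := Mod S) M -> countably_generated M.
Proof.
move=> /(_ _ _ _ cgsub_directed (ew_colimit cgsub_directed cgsub_elementwise)).
move=> /hom_colimit_sur /(_ idfun) [N [g gE]].
have gE' x : lg cgsub_cocone N (g x) = x.
  exact: (congr1 (fun u : {linear _ -> _} => u x) gE).
have NT : [set: M] = sval N.
  rewrite -cgsub_lg_range; apply/seteqP; split=> // x _.
  by exists (g x).
rewrite /countably_generated NT; exact: (proj2_sig N).2.
Qed.

End CgSubmodules.

(** * Countably generated subcorings *)

Section Subcorings.
Variables (k : comPzRingType) (R : kalgebra k).
Local Notation S := (env R).
Hypothesis noethS : left_countably_noetherian S.

Section SubCoring.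
Variables (C : coring R) (N : cgsub C).
Local Notation L := (cgsub_system C N).
Local Notation l := (lg (cgsub_cocone C) N).
Variable m : {linear L -> btens L L}.
Hypothesis mP : forall x, btmap l l (m x) = comul C (l x).
Hypothesis mA : forall x, bassoc (btmap m idfun (m x)) = btmap idfun m (m x).

Definition sub_counit : {linear L -> rbim R} := counit C \o l.

Lemma sub_counitl x : blunit (btmap sub_counit idfun (m x)) = x.
Proof.
apply: (@cgsub_lg_inj _ _ N); rewrite -blunit_nat -[RHS](@counitl _ _ C) -mP.
congr blunit; rewrite -!btmap_comp; exact: btmap_ext.
Qed.

Lemma sub_counitr x : brunit (btmap idfun sub_counit (m x)) = x.
Proof.
apply: (@cgsub_lg_inj _ _ N); rewrite -brunit_nat -[RHS](@counitr _ _ C) -mP.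
congr brunit; rewrite -!btmap_comp; exact: btmap_ext.
Qed.

Definition sub_coring : coring R := Coring mA sub_counitl sub_counitr.

Definition sub_coring_hom : coring_hom sub_coring C :=
  @CoringHom k R sub_coring C l (fun x => esym (mP x)) (fun x => erefl).

End SubCoring.

Variable P : coring R -> Prop.
Local Notation K := (full_subcategory (C := Corings R) P).

(* [Xi] chooses, for each stage of a chain, what the next stage has to contain
   in order that the union satisfy [P]. *)
Definition closed_chains : Prop := forall C : coring R, P C ->
  exists Xi : cgsub C -> cgsub C,
  forall (E : coring R) (f : coring_hom E C) (d : nat -> cgsub C), injective f ->
    (forall n, ple (d n) (d n.+1)) -> (forall n, ple (Xi (d n)) (d n.+1)) ->
    range f = \bigcup_n sval (d n) -> P E.

Hypotheses (Pcolim : closed_colimits P) (Pchain : closed_chains).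

Section Poset.
Variable C : K.
Local Notation D := (cgsub_system (cobj (sval C))).
Local Notation c := (cgsub_cocone (cobj (sval C))).

Record subcoring : small := Subcoring {
  sc_sub : cgsub (cobj (sval C));
  sc_mu : {linear D sc_sub -> btens (D sc_sub) (D sc_sub)};
  sc_muP : forall x, btmap (lg c sc_sub) (lg c sc_sub) (sc_mu x)
    = comul (sval C) (lg c sc_sub x);
  sc_muA : forall x, bassoc (btmap sc_mu idfun (sc_mu x)) = btmap idfun sc_mu (sc_mu x);
  sc_P : P (sub_coring sc_muP sc_muA) }.

Definition sc_le (s t : subcoring) : Prop :=
  ple (sc_sub s) (sc_sub t) /\
  forall (h : ple (sc_sub s) (sc_sub t)) x,
    sc_mu t (tr (D := D) h x) = btmap (tr (D := D) h) (tr (D := D) h) (sc_mu s x).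

Lemma sc_le_refl s : sc_le s s.
Proof.
split=> [|h x]; first exact: ple_refl.
rewrite tr_id -[LHS]btmap_id; apply: btmap_ext => y; exact: (esym (tr_id (D := D) h y)).
Qed.

Lemma sc_le_trans t s u : sc_le s t -> sc_le t u -> sc_le s u.
Proof.
move=> [st hst] [tu htu]; split=> [|h x]; first exact: ple_trans st tu.
by rewrite -(tr_comp st tu) htu hst; apply: btmapM => y; exact: tr_comp.
Qed.

(** Once the submodules coincide, the transition map is the identity and compatibility identifies
    the comultiplications; the other fields are propositions. *)
Lemma sc_le_anti s t : sc_le s t -> sc_le t s -> s = t.
Proof.
move=> [st hst] [ts _]; have := ple_anti st ts.
case: s t st hst {ts} => [N m mP mA mQ] [N' m' mP' mA' mQ'] /= st hst e.
case: _ / e in m' mP' mA' mQ' st hst *.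
have e : m = m'.
  apply: linear_eq => x; rewrite -[in RHS](tr_id (D := D) st x).
  rewrite [RHS](hst st x) -[LHS]btmap_id; apply: btmap_ext => y.
    exact: (esym (tr_id (D := D) st y)).
  exact: (esym (tr_id (D := D) st y)).
case: _ / e in mP' mA' mQ' hst *.
case: _ / (Prop_irrelevance mP mP') in mQ' *.
case: _ / (Prop_irrelevance mA mA') in mQ' *.
by rewrite (Prop_irrelevance mQ mQ').
Qed.

Definition subcorings : poset := Poset sc_le_refl sc_le_trans sc_le_anti.

Definition sc_obj (s : subcorings) : K := exist _ (sub_coring (@sc_muP s) (@sc_muA s)) (sc_P s).

Definition sc_incl (s t : subcorings) (h : ple s t) : hom (sc_obj s) (sc_obj t) :=
  @CoringHom k R (sval (sc_obj s)) (sval (sc_obj t)) (tr (D := D) h.1)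
    (h.2 h.1) (fun x => congr1 (counit (sval C)) (lg_tr c h.1 x)).

Program Definition sc_system : functor (poset_cat subcorings) K :=
  @Functor (poset_cat subcorings) K sc_obj sc_incl _ _.
Next Obligation. by apply: coring_hom_eq => x; exact: (tr_id (D := D)). Qed.
Next Obligation. by apply: coring_hom_eq => x; apply/esym/(tr_comp (D := D)). Qed.

Definition sc_leg (s : subcorings) : hom (sc_obj s) C :=
  sub_coring_hom (@sc_muP s) (@sc_muA s).

Program Definition sc_cocone : cocone sc_system :=
  @Cocone (poset_cat subcorings) K sc_system C sc_leg _.
Next Obligation. by apply: coring_hom_eq => x; exact: (lg_tr c). Qed.

(** With [A] arbitrary this gives directedness; with [A] empty and [N0] spanned by one element it
    shows that the subcorings exhaust [C]. *)
Lemma sc_upper_bound (A : set subcorings) (N0 : cgsub (cobj (sval C))) : countable A ->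
  exists s : subcorings, ple N0 (sc_sub s) /\ forall a, A a -> ple a s.
Proof.
move=> Ac; have [Xi XiP] := Pchain (proj2_sig C).
have [N [m [mP mA N0N mt [d [dS [dXi [dN dsur]]]]]]] :=
  substructure_ex noethS (cgsub_directed (M := _)) (cgsub_elementwise _) (cgsub_cg (M := _))
    (cgsub_lg_inj (M := _)) (@comulA _ _ (sval C)) (cgsub_chain_sup (M := _)) (it := sc_sub) (mt := sc_mu)
    Xi N0 Ac sc_muP.
have mQ : P (sub_coring mP mA).
  apply: (XiP _ (sub_coring_hom mP mA) d) => //; first exact: cgsub_lg_inj.
  rewrite [LHS]cgsub_lg_range; apply/seteqP; split=> [x xN|x [n _ /dN] //].
  have [n [h [y /(congr1 (lg c N))]]] := dsur (sub_mk (proj2_sig N).1 xN).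
  rewrite lg_tr => e; exists n => //; rewrite -[x]/(lg c N (sub_mk (proj2_sig N).1 xN)) -e.
  by rewrite -cgsub_lg_range; exists y.
exists (Subcoring mQ); split=> // a /mt [h hE]; split=> // h' x.
by rewrite (Prop_irrelevance h' h) hE.
Qed.

Lemma sc_directed : aleph1_directed subcorings.
Proof.
move=> A Ac; have [u _] := ub_nonempty (cgsub_directed (M := cobj (sval C))).
by have [s [_ sP]] := sc_upper_bound u Ac; exists s.
Qed.

Lemma sc_elementwise : elementwise (map_cocone (forget_sub P) sc_cocone).
Proof.
split=> [x|s x x0]; last first.
  exists s, (ple_refl s); rewrite tr_id; apply: (@cgsub_lg_inj _ _ (sc_sub s)).
  by rewrite linear0.
have [s [xs _]] := sc_upper_bound (cgsub_gspan (countable1 x)) (countable0 _).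
have : sval (sc_sub s) x by apply: xs; exact: sub_gspan.
by rewrite -cgsub_lg_range => -[y _ yx]; exists s, y.
Qed.

Lemma coring_presentable_cg : aleph1_presentable C -> countably_generated (cobj (sval C)).
Proof.
move=> /(_ _ _ _ sc_directed (coring_elementwise_colimit sc_directed sc_elementwise)).
move=> /hom_colimit_sur /(_ (idm C)) [s [g gE]].
have gE' x : lg c (sc_sub s) (cfun g x) = x.
  exact: (congr1 (fun u : coring_hom _ _ => u x) gE).
have NT : [set: sval C] = sval (sc_sub s).
  rewrite -cgsub_lg_range; apply/seteqP; split=> // x _.
  by exists (cfun g x).
rewrite /countably_generated NT; exact: (proj2_sig (sc_sub s)).2.
Qed.

End Poset.
End Subcorings.

(** * A set of representatives *)

Section ReplaceDiagram.
Variables (C : category) (J : poset) (D : functor (poset_cat J) C) (c : cocone D).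
Variables (G : J -> C) (a : forall i, hom (D i) (G i)) (b : forall i, hom (G i) (D i)).
Hypothesis ba : forall i, comp (b i) (a i) = idm (D i).
Hypothesis ab : forall i, comp (a i) (b i) = idm (G i).

(** Conjugating the transition maps by isomorphisms replaces every object by a prescribed copy, as
    needed to have objects that are literally in a given set. *)
Program Definition iso_diagram : functor (poset_cat J) C :=
  @Functor (poset_cat J) C G
    (fun i j h => comp (a j) (comp (fmap D h) (b i))) _ _.
Next Obligation. by rewrite fmap_id comp_idl ab. Qed.
Next Obligation.
by rewrite fmap_comp -!compA [comp (b Y) _]compA ba comp_idl.
Qed.

Program Definition iso_cocone : cocone iso_diagram :=
  @Cocone (poset_cat J) C iso_diagram (apex c) (fun i => comp (leg c i) (b i)) _.
Next Obligation.
by rewrite -!compA [comp (b j) _]compA ba comp_idl compA (leg_comp c).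
Qed.

Lemma iso_colimit : is_colimit c -> is_colimit iso_cocone.
Proof.
move=> cC c'.
have c1E i j (h : @hom (poset_cat J) i j) :
    comp (comp (leg c' j) (a j)) (fmap D h) = comp (leg c' i) (a i).
  rewrite -(leg_comp c' h) /= -!compA ba comp_idr; reflexivity.
pose c1 : cocone D := @Cocone (poset_cat J) C D (apex c') (fun i => comp (leg c' i) (a i)) c1E.
have [h [hE hU]] := cC c1; exists h; split=> [i|h' h'E].
  by rewrite /= compA hE /= -compA ab comp_idr.
apply: hU => i; rewrite /= -h'E /= -!compA ba comp_idr; reflexivity.
Qed.

End ReplaceDiagram.

Section TransportModule.
Variables (S : pzRingType) (M : lmodType S) (Y : small).
Variables (f : M -> Y) (g : Y -> M).

(** The type [Y] alone does not determine the bijection along which the operations are carried, so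
    its proofs are arguments. *)
Definition transported of cancel f g & cancel g f : small := Y.

Variables (fK : cancel f g) (gK : cancel g f).
Local Notation T := (transported fK gK).

HB.instance Definition _ := gen_eqMixin T.
HB.instance Definition _ := gen_choiceMixin T.

Definition tadd (x y : T) : T := f (g x + g y).
Definition tzero : T := f 0.
Definition topp (x : T) : T := f (- g x).
Definition tscale (s : S) (x : T) : T := f (s *: g x).

Lemma taddA : associative tadd.
Proof. by move=> x y z; rewrite /tadd !fK addrA. Qed.
Lemma taddC : commutative tadd.
Proof. by move=> x y; rewrite /tadd addrC. Qed.
Lemma tadd0 : left_id tzero tadd.
Proof. by move=> x; rewrite /tadd fK add0r gK. Qed.
Lemma taddN : left_inverse tzero topp tadd.
Proof. by move=> x; rewrite /tadd fK addNr. Qed.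
HB.instance Definition _ := GRing.isZmodule.Build T taddA taddC tadd0 taddN.

Lemma tscaleA a b x : tscale a (tscale b x) = tscale (a * b) x.
Proof. by rewrite /tscale fK scalerA. Qed.
Lemma tscale1 : left_id 1 tscale.
Proof. by move=> x; rewrite /tscale scale1r gK. Qed.
Lemma tscaleDr : right_distributive tscale +%R.
Proof. by move=> a x y; rewrite /tscale -[RHS]/(tadd _ _) /tadd !fK scalerDr. Qed.
Lemma tscaleDl x : {morph tscale^~ x : a b / a + b}.
Proof. by move=> a b; rewrite /tscale -[RHS]/(tadd _ _) /tadd !fK scalerDl. Qed.
HB.instance Definition _ := GRing.Zmodule_isLmodule.Build S T
  tscaleA tscale1 tscaleDr tscaleDl.

Definition to_fun (x : M) : T := f x.
Definition of_fun (x : T) : M := g x.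
Lemma to_linear : linear to_fun.
Proof. by move=> a x y; rewrite -[RHS]/(tadd _ _) /tadd -[a *: to_fun x]/(tscale _ _) /tscale !fK. Qed.
Lemma of_linear : linear of_fun.
Proof. by move=> a x y; rewrite /of_fun -[a *: x + y]/(tadd _ _) /tadd fK -[a *: x]/(tscale _ _) fK. Qed.
HB.instance Definition _ := GRing.isLinear.Build S M T _ to_fun to_linear.
HB.instance Definition _ := GRing.isLinear.Build S T M _ of_fun of_linear.

(** The class is exposed so that the carrier is [Y] itself, the form in which [rep] stores a
    module. *)
Lemma transport_lmod : exists (c : GRing.Lmodule.axioms_ S Y)
    (f' : {linear M -> GRing.Lmodule.Pack c}) (g' : {linear GRing.Lmodule.Pack c -> M}),
  cancel f' g' /\ cancel g' f'.
Proof.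
exists (GRing.Lmodule.class (T : lmodType S)), to_fun, of_fun.
by split; [exact: fK | exact: gK].
Qed.

End TransportModule.

Section TransportCoring.
Variables (k : comPzRingType) (R : kalgebra k).
Local Notation S := (env R).

(** The structure separated from its module: the corings on all modules form a large type, those on
    a fixed module a small one. *)
Definition coring_str (L : lmodType S) : small :=
  {m : {linear L -> btens L L} & {e : {linear L -> rbim R} |
    [/\ forall x, bassoc (btmap m idfun (m x)) = btmap idfun m (m x),
        forall x, blunit (btmap e idfun (m x)) = x
      & forall x, brunit (btmap idfun e (m x)) = x]}}.

Definition str_coring (L : lmodType S) (s : coring_str L) : coring R :=
  let: And3 a l r := proj2_sig (projT2 s) in
  Coring a l r.

Lemma transport_coring (C : coring R) (L : lmodType S) (f : {linear C -> L})
    (g : {linear L -> C}) : cancel f g -> cancel g f ->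
  exists (s : coring_str L) (f' : coring_hom C (str_coring s)) (g' : coring_hom (str_coring s) C),
    cancel f' g' /\ cancel g' f'.
Proof.
move=> fK gK.
pose m : {linear L -> btens L L} := btmap f f \o (comul C \o g).
pose e : {linear L -> rbim R} := counit C \o g.
have mE x : m (f x) = btmap f f (comul C x) by rewrite /= fK.
have eE x : e (f x) = counit C x by rewrite /= fK.
have mA x : bassoc (btmap m idfun (m x)) = btmap idfun m (m x).
  rewrite -(gK x); exact: (push_coassoc mE).
have ml x : blunit (btmap e idfun (m x)) = x.
  rewrite -[x in LHS](gK x) -[RHS](gK x); exact: (push_counitl mE eE).
have mr x : brunit (btmap idfun e (m x)) = x.
  rewrite -[x in LHS](gK x) -[RHS](gK x); exact: (push_counitr mE eE).
pose s : coring_str L := existT _ m (exist _ e (And3 mA ml mr)).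
have gm x : comul C (g x) = btmap g g (m x).
  rewrite /= -[LHS]btmap_id; symmetry; apply: btmapM => y; exact: fK.
exists s, (@CoringHom k R C (str_coring s) f mE eE).
by exists (@CoringHom k R (str_coring s) C g gm (fun x => erefl)).
Qed.

End TransportCoring.

Section Representatives.
Variables (k : comPzRingType) (R : kalgebra k).
Local Notation S := (env R).
Variable P : coring R -> Prop.
Hypothesis Pcolim : closed_colimits P.
Local Notation K := (full_subcategory (C := Corings R) P).

Program Definition unit_poset : poset := @Poset unit (fun _ _ => True) _ _ _.
Next Obligation. by case: x y => -[]. Qed.

(** An isomorphism is a colimit cocone over the one-point poset, which is aleph_1-directed. *)
Lemma closed_iso (C E : coring R) (f : coring_hom C E) (g : coring_hom E C) :
  cancel f g -> cancel g f -> P C -> P E.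
Proof.
move=> fK gK PC.
pose D : functor (poset_cat unit_poset) (Corings R) :=
  @Functor (poset_cat unit_poset) (Corings R) (fun=> C) (fun _ _ _ => coring_id C)
    (fun=> erefl) (fun _ _ _ _ _ => esym (comp_idl (coring_id C : hom (c := Corings R) C C))).
pose c : cocone D := @Cocone (poset_cat unit_poset) (Corings R) D E (fun=> f)
  (fun _ _ _ => comp_idr (f : hom (c := Corings R) C E)).
apply: (Pcolim (D := D) (c := c)) => // [A _|]; first by exists tt.
split=> [x|i x x0]; first by exists tt, (g x); exact: gK.
exists i, (ple_refl i); rewrite tr_id; have fx0 : f x = 0 := x0.
by have := fK x; rewrite fx0 linear0.
Qed.

(* Relative to a sequence of generators [x], the pair [(n, s)] stands for
   [s 0 *: x 0 + ... + s n.-1 *: x n.-1]; so each countably generated module is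
   isomorphic to one carried by a subset of [words]. *)
Definition words : small := (nat * (nat -> S))%type.

Definition rep : small :=
  {Q : set words & {c : GRing.Lmodule.axioms_ S {w | Q w} &
    {s : coring_str (GRing.Lmodule.Pack c) |
      P (str_coring s) /\ countably_generated (cobj (str_coring s))}}}.

Definition rep_obj (t : rep) : K :=
  exist _ (str_coring (sval (projT2 (projT2 t)))) (proj2_sig (projT2 (projT2 t))).1.

Lemma rep_cg t : countably_generated (cobj (sval (rep_obj t))).
Proof. exact: (proj2_sig (projT2 (projT2 t))).2. Qed.

Lemma rep_ex (X : K) : countably_generated (cobj (sval X)) ->
  exists (t : rep) (a : hom X (rep_obj t)) (b : hom (rep_obj t) X),
    comp b a = idm X /\ comp a b = idm (rep_obj t).
Proof.
case: X => C PC /= Ccg; have [x CE] := (countably_generatedP _).1 Ccg.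
pose ev (w : words) : C := \sum_(j < w.1) w.2 j *: x j.
(* One word is chosen for each element, which makes evaluation bijective on the chosen words.
   Entries beyond the length are never evaluated, so their value is arbitrary. *)
have /choice [w wE] (y : C) : exists w, ev w = y.
  have : gspan (range x) y by rewrite -CE.
  move=> /gspan_rangeP [n [v ->]].
  exists (n, fun j => if insub j is Some i then v 0 i else 0).
  by apply: eq_bigr => j _ /=; rewrite valK.
pose Q := range w.
pose f (y : C) : {w | Q w} := exist _ (w y) (ex_intro2 _ _ y I erefl).
pose g (z : {w | Q w}) : C := ev (sval z).
have fK : cancel f g by move=> y; exact: wE.
have gK : cancel g f.
  by move=> [z hz]; apply: eq_exist; have [y _ yz] := hz; rewrite /g /= -yz wE.
have [c [f1 [g1 [f1K g1K]]]] := transport_lmod fK gK.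
have [s [f2 [g2 [f2K g2K]]]] := transport_coring f1K g1K.
have Ps : P (str_coring s) := closed_iso f2K g2K PC.
have cgs : countably_generated (cobj (str_coring s)).
  rewrite /countably_generated (_ : [set: _] = f2 @` [set: C]); first exact: cg_image.
  by apply/seteqP; split=> // z _; exists (g2 z).
exists (existT _ Q (existT _ c (exist _ s (conj Ps cgs)))), f2, g2.
by split; apply: coring_hom_eq => y; [exact: f2K | exact: g2K].
Qed.

Hypothesis noethS : left_countably_noetherian S.
Hypothesis Pchain : closed_chains P.

Theorem subcat_accessible : aleph1_accessible K.
Proof.
split=> [I D dI|]; first exact: subcat_has_colimits.
exists rep, rep_obj; split=> [t|X].
  exact: (cg_coring_presentable noethS Pcolim (rep_cg t)).
have scg (s : subcorings X) : countably_generated (cobj (sval (sc_system X s))).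
  exact: cgsub_cg.
have tP (s : subcorings X) : exists p : {t : rep &
    (hom (sc_system X s) (rep_obj t) * hom (rep_obj t) (sc_system X s))%type},
  comp (tagged p).2 (tagged p).1 = idm _ /\ comp (tagged p).1 (tagged p).2 = idm _.
  by have [t [a [b h]]] := rep_ex (scg s); exists (existT _ t (a, b)).
pose p s := projT1 (cid (tP s)).
have pE1 s : comp (tagged (p s)).2 (tagged (p s)).1 = idm _.
  exact: (projT2 (cid (tP s))).1.
have pE2 s : comp (tagged (p s)).1 (tagged (p s)).2 = idm _.
  exact: (projT2 (cid (tP s))).2.
have dJ : aleph1_directed (subcorings X) := sc_directed noethS Pchain (C := X).
exists (subcorings X), (iso_diagram (fun s => pE1 s) (fun s => pE2 s)), (iso_cocone (sc_cocone X) _ _).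
split=> //; first by move=> s; exists (tag (p s)).
apply: iso_colimit; apply: (coring_elementwise_colimit dJ).
exact: sc_elementwise.
Qed.

Theorem subcat_presentable (X : K) :
  (aleph1_presentable X <-> aleph1_presentable (C := Mod S) (cobj (sval X))) /\
  (aleph1_presentable (C := Mod S) (cobj (sval X)) <-> countably_generated (cobj (sval X))).
Proof.
have cgM : aleph1_presentable (C := Mod S) (cobj (sval X)) <->
    countably_generated (cobj (sval X)).
  by split; [exact: presentable_cg | exact: cg_presentable].
split=> //; rewrite cgM; split.
  exact: (coring_presentable_cg noethS Pchain).
exact: (cg_coring_presentable noethS Pcolim).
Qed.

End Representatives.

(** * Surjective counits and flat kernels *)

Section Instances.
Variables (k : comPzRingType) (R : kalgebra k).
Local Notation S := (env R).

(** The counit is left [R]-linear and [R] is generated by [1], so a single preimage controls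
    surjectivity. *)
Lemma surjective_counit_lift (C : coring R) (e : C) :
  counit C e = (1 : R) -> surjective_counit C.
Proof.
move=> e1 r; exists (lact r e); rewrite lact_linear e1.
by rewrite [lact _ _]rbim_scale_pure !mulr1.
Qed.

Lemma surjective_closed_colimits : closed_colimits (@surjective_counit k R).
Proof.
move=> I D c dI cE Dsur r; have [i _] := ub_nonempty dI; have [x xr] := Dsur i r.
exists (cfun (leg c i) x); rewrite -xr; exact: cfun_counit.
Qed.

Lemma surjective_chain (C : coring R) (e : C) (E : coring R) (f : coring_hom E C)
    (N : set C) : counit C e = (1 : R) -> N e -> N `<=` range f -> surjective_counit E.
Proof.
move=> e1 Ne Nf; have [e' _ fe'] := Nf e Ne.
by apply: (@surjective_counit_lift E e'); rewrite -(cfun_counit f) fe'.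
Qed.

Lemma surjective_closed_chains : closed_chains (@surjective_counit k R).
Proof.
move=> C /(_ 1) [e e1].
have [Xi XiP] : exists Xi : cgsub C -> cgsub C, forall N, sval (Xi N) e.
  exists (fun=> cgsub_gspan (countable1 e)) => N; exact: sub_gspan.
exists Xi => E f d _ _ dXi fE.
(* The element [e] is guaranteed only from stage 1 on, which contains [Xi (d 0)]. *)
apply: (@surjective_chain C e E f (sval (d 1%N)) e1); first exact: dXi (XiP _).
by rewrite fE => x xd; exists 1%N.
Qed.

Definition ker_counit (C : coring R) : set C := [set x | counit C x = 0].

Arguments ker_counit C : clear implicits.

Lemma ker_counit_submodule (C : coring R) : is_submodule (ker_counit C).
Proof.
split=> [|a x y xK yK]; rewrite /ker_counit /= ?linear0 //.
by rewrite linearP xK yK scaler0 addr0.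
Qed.

(** Converts flatness of the kernel, a type of its own, into a condition on elements of [C], where
    different stages can be compared. *)
Lemma flat_kerP (C : coring R) :
  flat (kernel (counit C)) <-> eqflat_in (ker_counit C) (ker_counit C).
Proof.
have vL : linear (fun x : kernel (counit C) => val x) by move=> a x y; rewrite linearP.
have [v vE] := linear_ex vL.
have vI : injective v by move=> x y; rewrite !vE => /val_inj.
have vR : range v = ker_counit C.
  apply/seteqP; split=> [_ [x _ <-]|x /eqP xK].
    by rewrite vE; apply/eqP; exact: (valP x).
  by exists (exist _ x xK : kernel (counit C)) => //; rewrite vE.
rewrite -vR -(eqflat_range vI); split; [exact: flat_eqflat | exact: eqflat_flat].
Qed.

(** A relation in the kernel involves finitely many elements, so it already holds at some stage. The
    transition maps and legs preserve counits, so the elements lie in the kernel there, and flatness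
    at that stage supplies the trivialisation. *)
Lemma flat_closed_colimits : closed_colimits (@flat_kernel k R).
Proof.
move=> I D c dI cE Dfl; split.
  by apply: (surjective_closed_colimits dI cE) => i; case: (Dfl i).
pose UD := functor_comp (forget R) D.
pose uc : cocone UD := map_cocone (forget R) c.
have lK i x : counit (apex c) (lg uc i x) = counit (D i) x.
  exact: (@cfun_counit _ _ _ _ (leg c i)).
have tK i j (h : ple i j) x : counit (D j) (@tr _ _ UD i j h x) = counit (D i) x.
  exact: (@cfun_counit _ _ _ _ (fmap D h)).
apply/flat_kerP => r a m mK am.
have /choice [n nE] (i : 'I_r) : exists p : {j & UD j}, lg uc (tag p) (tagged p) = m i.
  by have [j [y yE]] := cE.1 (m i); exists (existT _ j y).
have [u uP] := ub_image dI (A := [set: 'I_r]) (fun i => tag (n i)) (countableP _).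
pose m' i : UD u := tr (uP i Logic.I) (tagged (n i)).
have m'E i : lg uc u (m' i) = m i by rewrite lg_tr.
have [|j [h h0]] := cE.2 u (lincomb a m').
  rewrite lincomb_linear -am; congr lincomb; apply/funext => i; exact: m'E.
have /flat_kerP flj := (Dfl j).2.
have [i||r' [B [y [yK yE aB]]]] := flj r a (fun i => tr h (m' i)).
- by rewrite /ker_counit /= tK -lK m'E; exact: mK.
- by rewrite -h0 lincomb_linear.
exists r', B, (fun i => lg uc j (y i)); split=> // i.
  by rewrite /ker_counit /= lK; exact: yK.
by rewrite -m'E -(lg_tr uc h) [tr h _]yE lincomb_linear.
Qed.

(** The finitely many elements of a relation lie in one stage [d N]; [Xi (d N)], hence the next
    stage, trivialises it, and injectivity of [f] brings the result back to [E]. *)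
Lemma flat_closed_chains : left_countably_noetherian S -> closed_chains (@flat_kernel k R).
Proof.
move=> noethS C [/(_ 1) [e e1] /flat_kerP flC]; pose K := ker_counit C.
have /choice [Xi XiP] (N : cgsub C) : exists N' : cgsub C,
    sval N' e /\ eqflat_in (K `&` sval N) (K `&` sval N').
  have [N' [NN' hN' cN' fl]] := eqflat_step noethS (@ker_counit_submodule C)
    (proj2_sig N).1 flC (proj2_sig N).2.
  (* One enlargement serves both purposes: trivialising the relations inside [N] and containing a
     preimage of [1]. *)
  have [u [u1 u2]] := ub2 (cgsub_directed (M := C)) (cgsub_mk hN' cN')
    (cgsub_gspan (countable1 e)).
  exists u; split; first by apply: u2; exact: sub_gspan.
  move=> r a m mK /(fl _ _ _ mK) [r' [B [y [yK yE aB]]]]; exists r', B, y; split=> // j.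
  by split; [exact: (yK j).1 | exact: u1 (yK j).2].
exists Xi => E f d fI dS dXi fE; split.
  apply: (@surjective_chain C e E f (sval (d 1%N)) e1); first exact: dXi (XiP _).1.
  by rewrite fE => x xd; exists 1%N.
apply/flat_kerP => r a m mK am.
have /choice [n nP] (i : 'I_r) : exists n, sval (d n) (f (m i)).
  have : range f (f (m i)) by exists (m i).
  by rewrite fE => -[n _ h]; exists n.
pose N := \max_i n i.
have mN i : sval (d N) (f (m i)).
  have : ple (d (n i)) (d N).
    exact: (homo_leq (@ple_refl _) (@ple_trans _) dS) (leq_bigmax i).
  by apply; exact: nP.
have [i||r' [B [y [yK yE aB]]]] := (XiP (d N)).2 r a (fun i => f (m i)).
- by split; rewrite ?/K /ker_counit /= ?cfun_counit; [exact: mK | exact: mN].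
- by rewrite -[LHS](lincomb_linear f) am linear0.
have /choice [z zE] j : exists z, f z = y j.
  have : (\bigcup_n sval (d n)) (y j) by exists N.+1 => //; exact: dXi (yK j).2.
  by rewrite -fE => -[z _ <-]; exists z.
exists r', B, z; split=> // [j|i].
  by rewrite /ker_counit /= -(cfun_counit f) zE; exact: (yK j).1.
apply: fI; rewrite lincomb_linear [LHS]yE.
by congr lincomb; apply/funext => j; rewrite /= zE.
Qed.

End Instances.

Theorem theorem7p3 (k : comPzRingType) (R : kalgebra k)
    (noethR : left_countably_noetherian (env R)) :
  (aleph1_accessible (Corings_sur R) /\
   forall C : Corings_sur R,
     (aleph1_presentable (C := Corings_sur R) C <->
      aleph1_presentable (C := Mod (env R)) (cobj (sval C))) /\
     (aleph1_presentable (C := Mod (env R)) (cobj (sval C)) <->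
      countably_generated (cobj (sval C))))
  /\
  (aleph1_accessible (Corings_bifl R) /\
   forall C : Corings_bifl R,
     (aleph1_presentable (C := Corings_bifl R) C <->
      aleph1_presentable (C := Mod (env R)) (cobj (sval C))) /\
     (aleph1_presentable (C := Mod (env R)) (cobj (sval C)) <->
      countably_generated (cobj (sval C)))).
Proof.
have surL := @surjective_closed_colimits k R; have surC := @surjective_closed_chains k R.
have flL := @flat_closed_colimits k R; have flC := flat_closed_chains noethR.
split; split; try exact: subcat_accessible; move=> C; exact: subcat_presentable.
Qed.
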